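(* Let $\mathcal A$ be an operator ideal. Then: (a$_1$) If $\mathcal A$ is left accessible, then $$(\mathcal A^{com})^{inj}=(\mathcal A^{min})^{inj}=\mathcal K\circ\mathcal A^{inj}.$$ (a$_2$) If $\mathcal A$ is right accessible and also has the $\ell_\infty$-extension property, then $$(\mathcal A^{com})^{inj}=(\mathcal A^{min})^{inj}=\mathcal A^{inj}\circ\mathcal K.$$ (b$_1$) If $\mathcal A$ is right accessible, then $$(\mathcal A^{com})^{sur}=(\mathcal A^{min})^{sur}=\mathcal A^{sur}\circ\mathcal K.$$ (b$_2$) If $\mathcal A$ is left accessible and also has the $\ell_1$-lifting property, then $$(\mathcal A^{com})^{sur}=(\mathcal A^{min})^{sur}=\mathcal K\circ\mathcal A^{sur}.$$
   Context: Operator ideals are quasi-normed operator ideals $(\mathcal A,\alpha)$ between Banach spaces in the sense of Pietsch (with complete components); equalities are equalities of operator ideals. $\mathcal K,\overline{\mathcal F}$ denote the compact and the approximable (operator-norm limits of finite rank) operators; $B_X$ is the closed unit ball of $X$. Composition: $T\in\mathcal A_1\circ\mathcal A_2(X,Y)$ iff $T=U\circ V$ with $V\in\mathcal A_2(X,Z)$, $U\in\mathcal A_1(Z,Y)$ for some Banach space $Z$. $\mathcal A^{com}=\mathcal K\circ\mathcal A\circ\mathcal K$ and $\mathcal A^{min}=\overline{\mathcal F}\circ\mathcal A\circ\overline{\mathcal F}$. Injective hull: let $i_Y:Y\hookrightarrow\ell_\infty(B_{Y^*})$, $i_Y(y)=(y^*(y))_{y^*\in B_{Y^*}}$; $T\in\mathcal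 A^{inj}(X,Y)$ iff $i_Y\circ T\in\mathcal A$. Surjective hull: let $q_X:\ell_1(B_X)\to X$, $q_X((\lambda_b)_b)=\sum_b\lambda_b b$; $T\in\mathcal A^{sur}(X,Y)$ iff $T\circ q_X\in\mathcal A$. $\ell_\infty$-extension property of $(\mathcal A,\alpha)$: for every Banach space $X$, set $\Gamma$ and $T\in\mathcal A(X,\ell_\infty(\Gamma))$ there is $\tilde T\in\mathcal A(\ell_\infty(B_{X^*}),\ell_\infty(\Gamma))$ with $T=\tilde T\circ i_X$ and $\alpha(\tilde T)=\alpha(T)$. $\ell_1$-lifting property of $(\mathcal A,\alpha)$: for every set $\Gamma$, Banach space $Y$ and $T\in\mathcal A(\ell_1(\Gamma),Y)$ there is $\hat T\in\mathcal A(\ell_1(\Gamma),\ell_1(B_Y))$ with $q_Y\circ\hat T=T$ and $\alpha(\hat T)=\alpha(T)$. Accessibility (standard, Defant–Floret). Right accessible: for every finite-dimensional $M$, Banach space $Y$, $T\in\mathcal A(M,Y)$ and $\epsilon>0$ there are a finite-dimensional subspace $N\subset Y$ and $S\in\mathcal A(M,N)$ with $T=I_N\circ S$ ($I_N$ the inclusion) and $\alpha(S)\le(1+\epsilon)\alpha(T)$. Left accessible: for every Banach space $X$, finite-dimensional $N$, $T\in\mathcal A(X,N)$ and $\epsilon>0$ there are a closed finite-codimensional subspace $L\subset X$ and $S\in\mathcal A(X/L,N)$ with $T=S\circ Q_L$ ($Q_L$ the quotient map) and $\alpha(S)\le(1+\epsilon)\alpha(T)$. *)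

(* Defs.v *)
From HB Require Import structures.
From mathcomp Require Import all_boot all_order all_algebra finmap.
From mathcomp Require Import generic_quotient ring_quotient.
From mathcomp Require Import all_classical all_reals all_analysis.
From mathcomp Require Import summability.
From mathcomp Require Import complex lra.

Set Implicit Arguments.
Unset Strict Implicit.
Unset Printing Implicit Defensive.
Import Order.TTheory GRing.Theory Num.Theory.
Import numFieldNormedType.Exports.

Local Open Scope classical_set_scope.
Local Open Scope ring_scope.

(* Banach spaces are taken over the reals or over the complex numbers; every
   definition is uniform in the choice. [ofreal] embeds R into the scalars. *)
Variant scalar_kind := RealScalars | ComplexScalars.

Definition scalars (R : realType) (s : scalar_kind) : numFieldType :=
  match s with RealScalars => R | ComplexScalars => R[i] end.

Section Scalars.
Context {R : realType} {s : scalar_kind}.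
Local Notation K := (scalars R s).

Definition ofreal : R -> K :=
  match s return R -> scalars R s with
  | RealScalars => fun x => x
  | ComplexScalars => fun x => real_complex R x
  end.

Definition repart : K -> R :=
  match s return scalars R s -> R with
  | RealScalars => fun x => x
  | ComplexScalars => fun z => complex.Re z
  end.

Lemma ofrealK : cancel ofreal repart.
Proof. by rewrite /ofreal /repart; case: s. Qed.

Lemma ofrealD x y : ofreal (x + y) = ofreal x + ofreal y.
Proof. by rewrite /ofreal; case: s => //; rewrite rmorphD. Qed.

Lemma ofrealM x y : ofreal (x * y) = ofreal x * ofreal y.
Proof. by rewrite /ofreal; case: s => //; rewrite rmorphM. Qed.

Lemma ofreal0 : ofreal 0 = 0.
Proof. by rewrite /ofreal; case: s. Qed.

Lemma ofreal1 : ofreal 1 = 1.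
Proof. by rewrite /ofreal; case: s. Qed.

Lemma ler_ofreal x y : (ofreal x <= ofreal y) = (x <= y).
Proof. by rewrite /ofreal; case: s => //; rewrite lecR. Qed.

Lemma ltr_ofreal x y : (ofreal x < ofreal y) = (x < y).
Proof. by rewrite /ofreal; case: s => //; rewrite ltcR. Qed.

Lemma repartK k : 0 <= k -> ofreal (repart k) = k.
Proof.
rewrite /ofreal /repart; case: s k => // -[a b] /=.
by rewrite lecE /= => /andP[/eqP -> _].
Qed.

End Scalars.

Section RealNorm.
Context {R : realType} {s : scalar_kind}.
Local Notation K := (scalars R s).

(* Norms in a [normedModType K] take values in K; [rnorm] is the same number
   seen in R. *)
Definition rnorm {V : normedModType K} (x : V) : R := repart `|x|.

Section Theory.
Variable V : normedModType K.
Implicit Types (x y z : V) (u : nat -> V).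

Lemma rnormE x : ofreal (rnorm x) = `|x|.
Proof. exact/repartK. Qed.

Lemma rnorm_ge0 x : 0 <= rnorm x.
Proof. by rewrite -(@ler_ofreal R s) rnormE ofreal0. Qed.

Lemma rnorm0 : rnorm (0 : V) = 0.
Proof. by rewrite /rnorm normr0 -ofreal0 ofrealK. Qed.

Lemma rnorm0_eq0 x : rnorm x = 0 -> x = 0.
Proof. by move=> x0; apply/normr0_eq0; rewrite -rnormE x0 ofreal0. Qed.

Lemma rnormN x : rnorm (- x) = rnorm x.
Proof. by rewrite /rnorm normrN. Qed.

Lemma rnormBC x y : rnorm (x - y) = rnorm (y - x).
Proof. by rewrite /rnorm distrC. Qed.

Lemma rnormD x y : rnorm (x + y) <= rnorm x + rnorm y.
Proof. by rewrite -(@ler_ofreal R s) ofrealD !rnormE ler_normD. Qed.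

Lemma rnorm_distD z x y : rnorm (x - y) <= rnorm (x - z) + rnorm (z - y).
Proof. by rewrite -[x - y](subrKA z) rnormD. Qed.

Lemma rnormZ (k : K) x : rnorm (k *: x) = repart `|k| * rnorm x.
Proof.
apply: (can_inj (@ofrealK R s)).
by rewrite ofrealM !rnormE normrZ repartK.
Qed.

Lemma rnorm_lt x (e : R) : (`|x| < ofreal e) = (rnorm x < e).
Proof. by rewrite -rnormE ltr_ofreal. Qed.

Lemma rnorm_le x (e : R) : (`|x| <= ofreal e) = (rnorm x <= e).
Proof. by rewrite -rnormE ler_ofreal. Qed.

End Theory.

Local Notation hf := (2^-1 : R).

Let hf_ge0 n : 0 <= hf ^+ n. Proof. by rewrite exprn_ge0. Qed.
Let hf_gt0 n : 0 < hf ^+ n. Proof. by rewrite exprn_gt0. Qed.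

Lemma half_smallW (e : R) : 0 < e ->
  exists n, forall m, (n <= m)%N -> hf ^+ m < e.
Proof.
move=> e0; have h1 : `|hf| < 1 by rewrite ger0_norm// invf_lt1// ltr1n.
have := @cvg_expr _ _ h1 => /cvgrPdist_lt /(_ _ e0) [n _ nP].
by exists n => m /nP; rewrite sub0r normrN ger0_norm.
Qed.

Lemma half_small (e : R) : 0 < e -> exists n, hf ^+ n < e.
Proof. by move=> /half_smallW[n nP]; exists n; exact: nP. Qed.

Lemma half_tail (V : zmodType) (N : V -> R) (u : nat -> V) n m :
  N 0 = 0 -> (forall x y, N (x + y) <= N x + N y) ->
  (forall k, N (u k.+1 - u k) <= hf ^+ k) ->
  (n <= m)%N -> N (u m - u n) <= 2 * hf ^+ n.
Proof.
move=> N0 ND uf /subnKC <-.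
apply: (@le_trans _ _ (2 * hf ^+ n - 2 * hf ^+ (n + (m - n)))).
  elim: (m - n)%N => [|k IH]; first by rewrite addn0 !subrr N0.
  rewrite addnS -[_ - u n](subrKA (u (n + k)%N)).
  apply: le_trans (ND _ _) _.
  apply: (le_trans (lerD (uf _) IH)).
  rewrite exprS mulrA divff ?pnatr_eq0// mul1r.
  by rewrite [2 * hf ^+ (n + k)]mulr_natl mulr2n; lra.
by rewrite gerBl mulr_ge0.
Qed.

Definition fast (V : normedModType K) (u : nat -> V) :=
  forall n, rnorm (u n.+1 - u n) <= hf ^+ n.

Lemma fast_tail (V : normedModType K) (u : nat -> V) n m :
  fast u -> (n <= m)%N -> rnorm (u m - u n) <= 2 * hf ^+ n.
Proof. by move=> uf; apply: half_tail => //; [exact: rnorm0|exact: rnormD]. Qed.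

Lemma fast_complete (V : normedModType K) :
  (forall u : nat -> V, fast u ->
     exists l, forall n, rnorm (u n - l) <= 4 * hf ^+ n) ->
  forall F : set_system V, ProperFilter F -> cauchy F -> cvg F.
Proof.
move=> fastV F FF /cauchyP Fc.
have /choice [u uP] n : exists x, F (ball x (ofreal (hf ^+ n.+1))).
  by apply: Fc; rewrite -ofreal0 ltr_ofreal.
have [n|l lP] := fastV u.
  have [x [xn xn1]] := filter_ex (filterI (uP n) (uP n.+1)).
  move: xn xn1; rewrite -!ball_normE /= !rnorm_lt => xn xn1.
  apply: le_trans (rnorm_distD x _ _) _; rewrite [rnorm (x - _)]rnormBC.
  apply: (le_trans (lerD (ltW xn1) (ltW xn))).
  by rewrite !exprS; have := hf_ge0 n; lra.
apply/cvg_ex; exists l; apply/cvgrPdist_lt => e e0.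
have e0' : 0 < repart e.
  by rewrite -(@ltr_ofreal R s) ofreal0 repartK ?ltW.
have [|n ne] := @half_small (repart e / 5); first by rewrite divr_gt0.
rewrite -(repartK (ltW e0)); near=> x; rewrite rnorm_lt.
have : ball (u n) (ofreal (hf ^+ n.+1)) x by near: x.
rewrite -ball_normE /= rnorm_lt => ux.
apply: (le_lt_trans (rnorm_distD (u n) _ _)); rewrite rnormBC.
apply: (le_lt_trans (lerD (lP n) (ltW ux))).
by rewrite exprS; have := hf_ge0 n; lra.
Unshelve. all: by end_near. Qed.

Lemma fast_cvg (V : completeNormedModType K) (u : nat -> V) : fast u ->
  exists l, forall n, rnorm (u n - l) <= 2 * hf ^+ n.
Proof.
move=> uf; have : cvg (u @ \oo).
  apply/cauchy_cvgP/cauchy_exP => e e0.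
  have e0' : 0 < repart e.
    by rewrite -(@ltr_ofreal R s) ofreal0 repartK ?ltW.
  have [|n ne] := @half_small (repart e / 2); first by rewrite divr_gt0.
  exists (u n); rewrite -(repartK (ltW e0)); exists n => // m /= nm.
  rewrite -ball_normE /= rnorm_lt rnormBC.
  by apply: (le_lt_trans (fast_tail uf nm)); lra.
move=> /cvg_ex [l ul]; exists l => n; apply/ler_addgt0Pr => e e0.
move/cvgrPdist_lt : ul => /(_ (ofreal e)).
rewrite -{1}ofreal0 ltr_ofreal => /(_ e0) [m _ mP].
have := mP (maxn n m) (leq_maxr _ _); rewrite rnorm_lt => le.
apply: (le_trans (rnorm_distD (u (maxn n m)) _ _)).
rewrite lerD//; first by rewrite rnormBC fast_tail// leq_maxl.
by rewrite rnormBC ltW.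
Qed.

End RealNorm.

Section ScalarBanach.
Variable R : realType.

Let complex_norm_le (z : R[i]) :
  complex.Re `|z| <= `|complex.Re z| + `|complex.Im z|.
Proof.
case: z => a b; rewrite normc_def /=.
rewrite -(@ler_sqr R) ?nnegrE ?sqrtr_ge0 ?addr_ge0//.
rewrite sqr_sqrtr ?addr_ge0 ?sqr_ge0// sqrrD !real_normK ?num_real//.
by rewrite lerD2r lerDl mulrn_wge0 ?mulr_ge0.
Qed.

Let Re_norm_le (z : R[i]) : `|complex.Re z| <= complex.Re `|z|.
Proof.
case: z => a b; rewrite normc_def /= -sqrtr_sqr.
by rewrite ler_wsqrtr// lerDl sqr_ge0.
Qed.

Let Im_norm_le (z : R[i]) : `|complex.Im z| <= complex.Re `|z|.
Proof.
case: z => a b; rewrite normc_def /= -sqrtr_sqr.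
by rewrite ler_wsqrtr// lerDr sqr_ge0.
Qed.

Lemma scalars_complete (s : scalar_kind) (F : set_system (scalars R s)^o) :
  ProperFilter F -> cauchy F -> cvg F.
Proof.
case: s F => [|F FF Fc]; first exact: R_complete.
apply: fast_complete FF Fc => u uf.
have [|a aP] := @fast_cvg R RealScalars R^o (fun n => complex.Re (u n)).
  by move=> n; apply: le_trans (uf n); rewrite /rnorm /= -raddfB Re_norm_le.
have [|b bP] := @fast_cvg R RealScalars R^o (fun n => complex.Im (u n)).
  by move=> n; apply: le_trans (uf n); rewrite /rnorm /= -raddfB Im_norm_le.
exists (a +i* b)%C => n; apply: (le_trans (complex_norm_le _)).
have := aP n; have := bP n; rewrite /rnorm /=.
by rewrite !raddfB /= => ? ?; lra.
Qed.

Definition scalar_space (s : scalar_kind) : Type := (scalars R s)^o.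

HB.instance Definition _ (s : scalar_kind) :=
  NormedModule.copy (scalar_space s) (scalars R s)^o.
HB.instance Definition _ (s : scalar_kind) :=
  Uniform_isComplete.Build (scalar_space s) (@scalars_complete s).

End ScalarBanach.

Notation banach R s := (completeNormedModType (scalars R s)).

(* A norm on a space of functions that is the least upper bound of the finite
   sums of |f g| along the sequences in F: singletons give the supremum norm,
   enumerations of finite sets give the l_1 norm. *)
Section FunctionSpaceNorm.
Context {R : realType} {s : scalar_kind}.
Local Notation K := (scalars R s).
Local Notation S := (scalar_space R s).
Local Notation hf := (2^-1 : R).
Variables (G : choiceType) (E : lmodType K) (v : E -> G -> S) (N : E -> R).
Variable (F : set (seq G)).

Local Notation B M f :=
  (forall r : seq G, F r -> \sum_(g <- r) rnorm (f g : S) <= M) (only parsing).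

Hypothesis v_lin : forall k x y g, v (k *: x + y) g = k *: v x g + v y g.
Hypothesis v_inj : injective v.
Hypothesis v_surj : forall (f : G -> S) (M : R), B M f -> exists x, v x = f.
Hypothesis N_ge0 : forall x, 0 <= N x.
Hypothesis B_N : forall x, B (N x) (v x).
Hypothesis N_B : forall x (M : R), 0 <= M -> B M (v x) -> N x <= M.
Hypothesis F_cover : forall g, exists2 r, F r & g \in r.

Let vD x y g : v (x + y) g = v x g + v y g.
Proof. by rewrite -[x in LHS]scale1r v_lin scale1r. Qed.

Let v0 g : v 0 g = 0.
Proof. by apply: (addrI (v 0 g)); rewrite -vD !addr0. Qed.

Let vZ k x g : v (k *: x) g = k *: v x g.
Proof. by rewrite -[k *: x]addr0 v_lin v0 addr0. Qed.

Let vB x y g : v (x - y) g = v x g - v y g.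
Proof. by rewrite vD -scaleN1r vZ scaleN1r. Qed.

Let rnorm_N x g : rnorm (v x g) <= N x.
Proof.
have [r Fr gr] := F_cover g; apply: (le_trans _ (B_N x Fr)).
by rewrite (big_rem g)//= lerDl sumr_ge0// => h _; exact: rnorm_ge0.
Qed.

Lemma funnormD x y : N (x + y) <= N x + N y.
Proof.
apply: N_B => [|r Fr]; first by rewrite addr_ge0.
apply: (le_trans _ (lerD (B_N _ Fr) (B_N _ Fr))).
by rewrite -big_split/= ler_sum// => g _; rewrite vD rnormD.
Qed.

Let N0 : N 0 = 0.
Proof.
apply/eqP; rewrite eq_le N_ge0 andbT; apply: N_B => // r _.
by rewrite big1// => g _; rewrite v0 rnorm0.
Qed.

Lemma funnormZ k x : N (k *: x) = repart `|k| * N x.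
Proof.
have k0 (l : K) : 0 <= repart `|l| by rewrite -(@ler_ofreal R s) ofreal0 repartK.
have le l y : N (l *: y) <= repart `|l| * N y.
  apply: N_B => [|r Fr]; first by rewrite mulr_ge0.
  apply: (le_trans _ (ler_wpM2l (k0 l) (B_N _ Fr))).
  by rewrite mulr_sumr ler_sum// => g _; rewrite vZ rnormZ.
have [->|kn0] := eqVneq k 0.
  by rewrite scale0r N0 normr0 -ofreal0 ofrealK mul0r.
apply/eqP; rewrite eq_le le/=.
have := ler_wpM2l (k0 k) (le k^-1 (k *: x)).
rewrite scalerA mulVf// scale1r => /le_trans; apply.
rewrite mulrA -[X in X * _ <= _](@ofrealK R s) ofrealM !repartK//.
by rewrite -normrM divff// normr1 -ofreal1 ofrealK mul1r.
Qed.

Lemma funnorm0_eq0 x : N x = 0 -> x = 0.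
Proof.
move=> x0; apply: v_inj; apply/funext => g; rewrite v0; apply: rnorm0_eq0.
by apply/eqP; rewrite eq_le rnorm_ge0 andbT -x0 rnorm_N.
Qed.

Lemma funnorm_fast (u : nat -> E) :
  (forall n, N (u n.+1 - u n) <= hf ^+ n) ->
  exists l, forall n, N (u n - l) <= 4 * hf ^+ n.
Proof.
move=> uf.
have /choice [l lP] g : exists l : S,
    forall n, rnorm (v (u n) g - l) <= 2 * hf ^+ n.
  apply: fast_cvg => n; apply: le_trans (uf n).
  by rewrite -vB rnorm_N.
have sumP n r : F r -> \sum_(g <- r) rnorm (v (u n) g - l g) <= 2 * hf ^+ n.
  move=> Fr; apply/ler_addgt0Pr => e e0.
  have [|m0 m0P] := @half_smallW R (e / (2 * (size r).+1%:R)).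
    by rewrite divr_gt0.
  pose m := maxn m0 n.
  have nm : (n <= m)%N := leq_maxr _ _.
  have := m0P m (leq_maxl _ _); rewrite ltr_pdivlMr// => me.
  apply: (@le_trans _ _ (\sum_(g <- r) rnorm (v (u m - u n) g)
                         + \sum_(g <- r) (2 * hf ^+ m))).
    rewrite -big_split/= ler_sum// => g _.
    apply: (le_trans (rnorm_distD (v (u m) g) _ _)).
    by rewrite lerD// vB rnormBC.
  apply: lerD.
    by apply: le_trans (B_N _ Fr) _; exact: half_tail N0 funnormD uf nm.
  rewrite big_const_seq count_predT iter_addr addr0.
  apply: ltW; apply: le_lt_trans me.
  by rewrite -[leLHS]mulr_natr [leRHS]mulrCA mulrA ler_wpM2l ?ler_nat //.
have [|x xl] := @v_surj l (N (u 0) + 2).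
  move=> r Fr; apply: (@le_trans _ _ (\sum_(g <- r) rnorm (v (u 0) g) +
      \sum_(g <- r) rnorm (v (u 0) g - l g))).
    rewrite -big_split/= ler_sum// => g _.
    by rewrite addrC -{1}[l g]subr0 -[0]subr0 (le_trans (rnorm_distD (v (u 0) g) _ _))// !subr0 rnormBC.
  by rewrite lerD ?B_N//; have := sumP 0 r Fr; rewrite expr0 mulr1.
exists x => n; apply: N_B => [|r Fr]; first by rewrite mulr_ge0 ?exprn_ge0.
apply: le_trans (_ : 2 * hf ^+ n <= _); last by rewrite ler_wpM2r ?exprn_ge0 ?ler_nat.
by under eq_bigr do rewrite vB xl; exact: sumP.
Qed.

End FunctionSpaceNorm.

(* Index sets are [choiceType]s; classically this is no restriction. *)
Section Linfty.
Context {R : realType} {s : scalar_kind}.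
Local Notation K := (scalars R s).
Local Notation S := (scalar_space R s).
Variable G : choiceType.

Definition bounded_family : {pred G -> S} :=
  fun f => `[< has_ubound (range (fun g => rnorm (f g))) >].

Lemma bounded_familyP (f : G -> S) :
  reflect (exists M, forall g, rnorm (f g) <= M) (f \in bounded_family).
Proof.
apply: (iffP (asboolP _)) => -[M fM]; exists M.
  by move=> g; apply: fM; exists g.
by move=> _ [g _ <-].
Qed.

Lemma bounded_family_submod : submod_closed bounded_family.
Proof.
split=> [|k f h /bounded_familyP[M fM] /bounded_familyP[L hL]].
  by apply/bounded_familyP; exists 0 => g; rewrite rnorm0.
apply/bounded_familyP; exists (repart `|k| * M + L) => g.
apply: (le_trans (rnormD _ _)); rewrite rnormZ lerD// ler_wpM2l//.
by rewrite -(@ler_ofreal R s) ofreal0 repartK.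
Qed.

HB.instance Definition _ :=
  GRing.isSubmodClosed.Build K (G -> S) bounded_family bounded_family_submod.

Record linfty := Linfty
  { linfty_fun :> G -> S; linfty_funP : linfty_fun \in bounded_family }.

HB.instance Definition _ := [isSub for linfty_fun].
HB.instance Definition _ := [Choice of linfty by <:].
HB.instance Definition _ := [SubChoice_isSubLmodule of linfty by <:].

(* [sup set0 = 0], so this is also right for an empty index set. *)
Definition linfty_norm (f : linfty) : R := sup (range (fun g => rnorm (f g))).

Let singletons : set (seq G) := range (fun g => [:: g]).

Let linfty_fun_lin k (x y : linfty) g :
  (k *: x + y : linfty) g = k *: (x g : S) + y g.
Proof. by []. Qed.

Let linfty_fun_inj : injective linfty_fun.
Proof. exact: val_inj. Qed.

Let linfty_fun_surj (f : G -> S) (M : R) :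
  (forall r, singletons r -> \sum_(g <- r) rnorm (f g) <= M) ->
  exists x, linfty_fun x = f.
Proof.
move=> fM; have fb : f \in bounded_family.
  apply/bounded_familyP; exists M => g.
  by have := fM _ (imageT _ g); rewrite big_seq1.
by exists (Linfty fb).
Qed.

Let linfty_normP (x : linfty) r : singletons r -> \sum_(g <- r) rnorm (x g) <= linfty_norm x.
Proof.
move=> [g _ <-]; rewrite big_seq1; apply: ub_le_sup; last by exists g.
by have /asboolP := linfty_funP x.
Qed.

Let linfty_norm_le (x : linfty) (M : R) : 0 <= M ->
  (forall r, singletons r -> \sum_(g <- r) rnorm (x g) <= M) ->
  linfty_norm x <= M.
Proof.
move=> M0 xM; rewrite /linfty_norm.
have [->|/set0P ne] := eqVneq (range (fun g => rnorm (x g))) set0.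
  by rewrite sup0.
apply: ge_sup => // _ [g _ <-].
by have := xM _ (imageT _ g); rewrite big_seq1.
Qed.

Let linfty_norm_ge0 (x : linfty) : 0 <= linfty_norm x.
Proof.
rewrite /linfty_norm.
have [->|/set0P[_ [g _ _]]] := eqVneq (range (fun g => rnorm (x g))) set0.
  by rewrite sup0.
by have := @linfty_normP x _ (imageT _ g); rewrite big_seq1; apply/le_trans/rnorm_ge0.
Qed.

Let singletons_cover g : exists2 r, singletons r & g \in r.
Proof. by exists [:: g]; [exact: imageT|rewrite mem_head]. Qed.

Let linfty_normD (x y : linfty) : ofreal (linfty_norm (x + y)) <=
  ofreal (linfty_norm x) + ofreal (linfty_norm y) :> K.
Proof.
rewrite -ofrealD ler_ofreal.
exact: (funnormD linfty_fun_lin linfty_norm_ge0 linfty_normP linfty_norm_le).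
Qed.

Let linfty_normZ (k : K) (x : linfty) :
  ofreal (linfty_norm (k *: x)) = `|k| * ofreal (linfty_norm x) :> K.
Proof.
rewrite (funnormZ linfty_fun_lin linfty_norm_ge0 linfty_normP linfty_norm_le).
by rewrite ofrealM repartK.
Qed.

Let linfty_norm0_eq0 (x : linfty) : ofreal (linfty_norm x) = 0 :> K -> x = 0.
Proof.
rewrite -ofreal0 => /(can_inj (@ofrealK R s)).
exact: (funnorm0_eq0 linfty_fun_lin linfty_fun_inj linfty_normP singletons_cover).
Qed.

HB.instance Definition _ := @Lmodule_isNormed.Build K linfty
  (fun x => ofreal (linfty_norm x)) linfty_normD linfty_normZ linfty_norm0_eq0.

Lemma rnorm_linfty (x : linfty) : rnorm x = linfty_norm x.
Proof. exact: ofrealK. Qed.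

Lemma linfty_complete (F : set_system linfty) :
  ProperFilter F -> cauchy F -> cvg F.
Proof.
apply: fast_complete => u uf.
have [|l lP] := funnorm_fast linfty_fun_lin linfty_fun_surj linfty_norm_ge0
  linfty_normP linfty_norm_le singletons_cover (u := u).
  by move=> n; rewrite -rnorm_linfty; exact: uf.
by exists l => n; rewrite rnorm_linfty.
Qed.

HB.instance Definition _ := Uniform_isComplete.Build linfty linfty_complete.

End Linfty.

Arguments linfty : clear implicits.

Section Lone.
Context {R : realType} {s : scalar_kind}.
Local Notation K := (scalars R s).
Local Notation S := (scalar_space R s).
Variable G : choiceType.

Definition summable_family : {pred G -> S} :=
  fun f => (\esum_(g in [set: G]) (rnorm (f g))%:E < +oo)%E.

Let esum_leP (f : G -> S) (M : R) :
  (\esum_(g in [set: G]) (rnorm (f g))%:E <= M%:E)%E <->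
  (forall A : {fset G}, \sum_(g <- A) rnorm (f g) <= M).
Proof.
split=> [fM A|fM].
  rewrite -lee_fin -sumEFin; apply: le_trans fM.
  apply: ereal_sup_ubound; exists [set` A]; first by split=> //; exact: finite_fset.
  by rewrite fsbig_finite ?set_fsetK//=; exact: finite_fset.
apply: ge_ereal_sup => _ [A [Afin _] <-].
by rewrite fsbig_finite//= sumEFin lee_fin.
Qed.

Lemma summable_familyP (f : G -> S) :
  reflect (exists M, forall A : {fset G}, \sum_(g <- A) rnorm (f g) <= M)
          (f \in summable_family).
Proof.
apply: (iffP idP) => [fs|[M /esum_leP fM]]; last exact: le_lt_trans (ltry M).
exists (fine (\esum_(g in [set: G]) (rnorm (f g))%:E)); apply/esum_leP.
rewrite fineK// ge0_fin_numE//; apply: esum_ge0 => g _.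
by rewrite lee_fin rnorm_ge0.
Qed.

Lemma summable_family_submod : submod_closed summable_family.
Proof.
split=> [|k f h /summable_familyP[M fM] /summable_familyP[L hL]].
  by apply/summable_familyP; exists 0 => A; rewrite big1// => g _; rewrite rnorm0.
apply/summable_familyP; exists (repart `|k| * M + L) => A.
apply: le_trans (lerD (ler_wpM2l _ (fM A)) (hL A)); last first.
  by rewrite -(@ler_ofreal R s) ofreal0 repartK.
rewrite mulr_sumr -big_split/= ler_sum// => g _.
by apply: (le_trans (rnormD _ _)); rewrite rnormZ.
Qed.

HB.instance Definition _ := GRing.isSubmodClosed.Build K (G -> S)
  summable_family summable_family_submod.

Record lone := Lone
  { lone_fun :> G -> S; lone_funP : lone_fun \in summable_family }.

HB.instance Definition _ := [isSub for lone_fun].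
HB.instance Definition _ := [Choice of lone by <:].
HB.instance Definition _ := [SubChoice_isSubLmodule of lone by <:].

Definition lone_norm (f : lone) : R :=
  fine (\esum_(g in [set: G]) (rnorm (f g))%:E).

Let finsets : set (seq G) := range (fun A : {fset G} => A : seq G).

Let lone_fun_lin k (x y : lone) g :
  (k *: x + y : lone) g = k *: (x g : S) + y g.
Proof. by []. Qed.

Let lone_fun_inj : injective lone_fun.
Proof. exact: val_inj. Qed.

Let lone_fun_surj (f : G -> S) (M : R) :
  (forall r, finsets r -> \sum_(g <- r) rnorm (f g) <= M) ->
  exists x, lone_fun x = f.
Proof.
move=> fM; have fb : f \in summable_family.
  by apply/summable_familyP; exists M => A; exact/fM/imageT.
by exists (Lone fb).
Qed.

Let lone_norm_fin (x : lone) :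
  ((lone_norm x)%:E = \esum_(g in [set: G]) (rnorm (x g))%:E)%E.
Proof.
rewrite fineK// ge0_fin_numE//; first exact: lone_funP.
by apply: esum_ge0 => g _; rewrite lee_fin rnorm_ge0.
Qed.

Let lone_normP (x : lone) r : finsets r -> \sum_(g <- r) rnorm (x g) <= lone_norm x.
Proof. by move=> [A _ <-]; move: A; apply/esum_leP; rewrite -lone_norm_fin. Qed.

Let lone_norm_le (x : lone) (M : R) : 0 <= M ->
  (forall r, finsets r -> \sum_(g <- r) rnorm (x g) <= M) ->
  lone_norm x <= M.
Proof.
move=> _ xM; rewrite -lee_fin lone_norm_fin; apply/esum_leP => A.
exact/xM/imageT.
Qed.

Let lone_norm_ge0 (x : lone) : 0 <= lone_norm x.
Proof.
by rewrite fine_ge0// esum_ge0// => g _; rewrite lee_fin rnorm_ge0.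
Qed.

Let finsets_cover g : exists2 r, finsets r & g \in r.
Proof. by exists [fset g]%fset; [exact: imageT|rewrite inE]. Qed.

Let lone_normD (x y : lone) : ofreal (lone_norm (x + y)) <=
  ofreal (lone_norm x) + ofreal (lone_norm y) :> K.
Proof.
rewrite -ofrealD ler_ofreal.
exact: (funnormD lone_fun_lin lone_norm_ge0 lone_normP lone_norm_le).
Qed.

Let lone_normZ (k : K) (x : lone) :
  ofreal (lone_norm (k *: x)) = `|k| * ofreal (lone_norm x) :> K.
Proof.
rewrite (funnormZ lone_fun_lin lone_norm_ge0 lone_normP lone_norm_le).
by rewrite ofrealM repartK.
Qed.

Let lone_norm0_eq0 (x : lone) : ofreal (lone_norm x) = 0 :> K -> x = 0.
Proof.
rewrite -ofreal0 => /(can_inj (@ofrealK R s)).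
exact: (funnorm0_eq0 lone_fun_lin lone_fun_inj lone_normP finsets_cover).
Qed.

HB.instance Definition _ := @Lmodule_isNormed.Build K lone
  (fun x => ofreal (lone_norm x)) lone_normD lone_normZ lone_norm0_eq0.

Lemma rnorm_lone (x : lone) : rnorm x = lone_norm x.
Proof. exact: ofrealK. Qed.

Lemma lone_complete (F : set_system lone) :
  ProperFilter F -> cauchy F -> cvg F.
Proof.
apply: fast_complete => u uf.
have [|l lP] := funnorm_fast lone_fun_lin lone_fun_surj lone_norm_ge0
  lone_normP lone_norm_le finsets_cover (u := u).
  by move=> n; rewrite -rnorm_lone; exact: uf.
by exists l => n; rewrite rnorm_lone.
Qed.

HB.instance Definition _ := Uniform_isComplete.Build lone lone_complete.

End Lone.

Arguments lone : clear implicits.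

Record closed_subspace {R : realType} {s : scalar_kind} (X : banach R s) :=
  ClosedSubspace {
    csub_set : set X;
    csub0 : csub_set 0;
    csubP : forall (k : scalars R s) x y,
      csub_set x -> csub_set y -> csub_set (k *: x + y);
    csub_closed : closed csub_set }.

Section Subspace.
Context {R : realType} {s : scalar_kind} {X : banach R s}.
Local Notation K := (scalars R s).
Local Notation hf := (2^-1 : R).

Definition csub_pred (L : closed_subspace X) : {pred X} := fun x => `[< csub_set L x >].

Lemma csub_predP (L : closed_subspace X) x : reflect (csub_set L x) (x \in csub_pred L).
Proof. exact: asboolP. Qed.

Lemma csub_submod (L : closed_subspace X) : submod_closed (csub_pred L).
Proof.
split=> [|k x y /csub_predP Lx /csub_predP Ly]; apply/csub_predP.
  exact: csub0.
exact: csubP.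
Qed.

HB.instance Definition _ (L : closed_subspace X) :=
  GRing.isSubmodClosed.Build K X (csub_pred L) (csub_submod L).

Lemma csub_limit (L : closed_subspace X) (u : nat -> X) l :
  (forall n, csub_set L (u n)) -> (forall n, rnorm (u n - l) <= 2 * hf ^+ n) -> csub_set L l.
Proof.
move=> Lu ul; apply: csub_closed => B /nbhs_ballP[e /= e0 eB].
have e0' : 0 < repart e.
  by rewrite -(@ltr_ofreal R s) ofreal0 repartK ?ltW.
have [|n ne] := @half_small R (repart e / 2); first by rewrite divr_gt0.
exists (u n); split=> //; apply: eB.
rewrite -ball_normE /= -(repartK (ltW e0)) rnorm_lt rnormBC.
by apply: (le_lt_trans (ul n)); lra.
Qed.

Record sub_banach (L : closed_subspace X) := SubBanach
  { sub_incl :> X; sub_inclP : sub_incl \in csub_pred L }.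

Section SubBanach.
Variable L : closed_subspace X.

HB.instance Definition _ := [isSub for @sub_incl L].
HB.instance Definition _ := [Choice of sub_banach L by <:].
HB.instance Definition _ := [SubChoice_isSubLmodule of sub_banach L by <:].

Let sub_normD (x y : sub_banach L) :
  `|sub_incl (x + y)| <= `|sub_incl x| + `|sub_incl y|.
Proof. exact: ler_normD. Qed.

Let sub_normZ (k : K) (x : sub_banach L) :
  `|sub_incl (k *: x)| = `|k| * `|sub_incl x|.
Proof. exact: normrZ. Qed.

Let sub_norm0_eq0 (x : sub_banach L) : `|sub_incl x| = 0 -> x = 0.
Proof. by move=> /normr0_eq0 x0; apply: val_inj. Qed.

HB.instance Definition _ := @Lmodule_isNormed.Build K (sub_banach L)
  (fun x => `|sub_incl x|) sub_normD sub_normZ sub_norm0_eq0.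

Lemma sub_complete (F : set_system (sub_banach L)) :
  ProperFilter F -> cauchy F -> cvg F.
Proof.
apply: fast_complete => u uf.
have [|l lP] := @fast_cvg R s X (fun n => sub_incl (u n)).
  by move=> n; exact: (uf n).
have Ll : l \in csub_pred L.
  apply/csub_predP/(csub_limit _ lP) => n.
  exact/csub_predP/sub_inclP.
exists (SubBanach Ll) => n; apply: (le_trans (lP n)).
by rewrite ler_wpM2r ?exprn_ge0 ?ler_nat.
Qed.

HB.instance Definition _ := Uniform_isComplete.Build (sub_banach L) sub_complete.

End SubBanach.

Section QuotientBanach.
Variable L : closed_subspace X.

Definition quot_banach : Type := Quotient.quot (csub_pred L).

HB.instance Definition _ := GRing.Zmodule.on quot_banach.

Definition quot_map (x : X) : quot_banach := \pi_(Quotient.quot (csub_pred L))%qT x.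

Lemma quot_map_surj q : exists x, quot_map x = q.
Proof. by exists (repr q); rewrite /quot_map reprK. Qed.

Lemma quot_map_eq x y : quot_map x = quot_map y <-> csub_set L (x - y).
Proof.
rewrite /quot_map; split=> [/eqP|Lxy].
  by rewrite -Quotient.idealrBE => /csub_predP.
by apply/eqP; rewrite -Quotient.idealrBE; apply/csub_predP.
Qed.

Lemma quot_mapD x y : quot_map (x + y) = quot_map x + quot_map y.
Proof. by rewrite /quot_map !piE. Qed.

Definition quot_scale (k : K) (q : quot_banach) : quot_banach :=
  quot_map (k *: repr q).

Lemma quot_mapZ k x : quot_map (k *: x) = quot_scale k (quot_map x).
Proof.
apply/quot_map_eq; rewrite -scalerBr -[k *: _]addr0; apply: csubP; last exact: csub0.
by apply/quot_map_eq; rewrite /quot_map reprK.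
Qed.

Lemma quot_scaleA a b q : quot_scale a (quot_scale b q) = quot_scale (a * b) q.
Proof. by have [x <-] := quot_map_surj q; rewrite -!quot_mapZ scalerA. Qed.

Lemma quot_scale1 : left_id 1 quot_scale.
Proof. by move=> q; have [x <-] := quot_map_surj q; rewrite -quot_mapZ scale1r. Qed.

Lemma quot_scaleDr : right_distributive quot_scale +%R.
Proof.
move=> k p q; have [x <-] := quot_map_surj p; have [y <-] := quot_map_surj q.
by rewrite -quot_mapD -!quot_mapZ scalerDr quot_mapD.
Qed.

Lemma quot_scaleDl q : {morph quot_scale^~ q : a b / a + b}.
Proof.
move=> a b; have [x <-] := quot_map_surj q.
by rewrite -!quot_mapZ scalerDl quot_mapD.
Qed.

HB.instance Definition _ := GRing.Zmodule_isLmodule.Build K quot_banach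
  quot_scaleA quot_scale1 quot_scaleDr quot_scaleDl.

Definition quot_norm (q : quot_banach) : R :=
  inf [set rnorm x | x in [set x | quot_map x = q]].

Let quot_norm_le x : quot_norm (quot_map x) <= rnorm x.
Proof.
apply: ge_inf; last by exists x.
by exists 0 => _ [y _ <-]; exact: rnorm_ge0.
Qed.

Let quot_norm_ge M q :
  (forall x, quot_map x = q -> M <= rnorm x) -> M <= quot_norm q.
Proof.
move=> Mq; apply: lb_le_inf => [|_ [x xq <-]]; last exact: Mq.
by have [x xq] := quot_map_surj q; exists (rnorm x); exists x.
Qed.

Let quot_norm_lift q e : quot_norm q < e ->
  exists2 x, quot_map x = q & rnorm x < e.
Proof.
move=> qe; apply: contrapT => /forall2NP nx.
have : e <= quot_norm q.
  by apply: quot_norm_ge => x xq; case: (nx x) => [//|/negP]; rewrite -leNgt.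
by rewrite leNgt qe.
Qed.

Let quot_norm_ge0 q : 0 <= quot_norm q.
Proof. by apply: quot_norm_ge => x _; exact: rnorm_ge0. Qed.

Let quot_norm_subD p q : quot_norm (p + q) <= quot_norm p + quot_norm q.
Proof.
apply/ler_addgt0Pr => e e0.
have e2 : 0 < e / 2 by rewrite divr_gt0.
have [x <- xe] := @quot_norm_lift p (quot_norm p + e / 2) ltac:(by rewrite ltrDl).
have [y <- ye] := @quot_norm_lift q (quot_norm q + e / 2) ltac:(by rewrite ltrDl).
rewrite -quot_mapD; apply: (le_trans (quot_norm_le _)).
apply: (le_trans (rnormD _ _)).
move: xe ye; set p' := quot_norm _; set q' := quot_norm _ => xe ye.
lra.
Qed.

Let rabs_ge0 (k : K) : 0 <= repart `|k|.
Proof. by rewrite -(@ler_ofreal R s) ofreal0 repartK. Qed.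

Let quot_norm_subZ k q : quot_norm (k *: q) <= repart `|k| * quot_norm q.
Proof.
have [->|k0] := eqVneq k 0.
  have [x <-] := quot_map_surj q.
  rewrite scale0r normr0 -ofreal0 ofrealK mul0r.
  have <- : quot_map 0 = 0 by rewrite /quot_map piE.
  by rewrite (le_trans (quot_norm_le _))// rnorm0.
have k0' : 0 < repart `|k|.
  by rewrite -(@ltr_ofreal R s) ofreal0 repartK// normr_gt0.
rewrite -ler_pdivrMl//; apply: quot_norm_ge => x <-.
by rewrite ler_pdivrMl// -rnormZ; rewrite -[k *: quot_map x]quot_mapZ.
Qed.

Let quot_normD p q :
  ofreal (quot_norm (p + q)) <= ofreal (quot_norm p) + ofreal (quot_norm q) :> K.
Proof. by rewrite -ofrealD ler_ofreal. Qed.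

Let quot_normZ (k : K) q :
  ofreal (quot_norm (k *: q)) = `|k| * ofreal (quot_norm q) :> K.
Proof.
rewrite -[in RHS](repartK (normr_ge0 k)) -ofrealM; congr ofreal.
have [->|k0] := eqVneq k 0.
  apply/eqP; rewrite eq_le quot_norm_subZ normr0 -ofreal0 ofrealK mul0r.
  exact: quot_norm_ge0.
apply/eqP; rewrite eq_le quot_norm_subZ/=.
have := ler_wpM2l (rabs_ge0 k) (quot_norm_subZ k^-1 (k *: q)).
rewrite scalerA mulVf// scale1r => /le_trans; apply.
rewrite mulrA -[X in X * _ <= _](@ofrealK R s) ofrealM !repartK//.
by rewrite -normrM divff// normr1 -ofreal1 ofrealK mul1r.
Qed.

Let quot_norm0_eq0 q : ofreal (quot_norm q) = 0 :> K -> q = 0.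
Proof.
rewrite -ofreal0 => /(can_inj (@ofrealK R s)) q0.
have [x xq] := quot_map_surj q; rewrite -xq.
have -> : 0 = quot_map 0 by rewrite /quot_map piE.
apply/quot_map_eq; rewrite subr0.
have /choice[y yP] n : exists y, csub_set L (x - y) /\ rnorm y <= 2 * hf ^+ n.
  have [|y yq /ltW yn] := @quot_norm_lift q (2 * hf ^+ n).
    by rewrite q0 mulr_gt0 ?exprn_gt0.
  by exists y; split=> //; apply/quot_map_eq; rewrite xq yq.
apply: (@csub_limit L (fun n => x - y n)) => n; first by have [] := yP n.
by rewrite addrAC subrr add0r rnormN; have [] := yP n.
Qed.

HB.instance Definition _ := @Lmodule_isNormed.Build K quot_banach
  (fun q => ofreal (quot_norm q)) quot_normD quot_normZ quot_norm0_eq0.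

Lemma rnorm_quot (q : quot_banach) : rnorm q = quot_norm q.
Proof. exact: ofrealK. Qed.

Lemma quot_complete (F : set_system quot_banach) :
  ProperFilter F -> cauchy F -> cvg F.
Proof.
apply: fast_complete => u uf.
have /choice[d dP] n : exists d, quot_map d = u n.+1 - u n /\ rnorm d <= 2 * hf ^+ n.
  have [|d du /ltW dn] := @quot_norm_lift (u n.+1 - u n) (2 * hf ^+ n).
    rewrite -rnorm_quot; apply: (le_lt_trans (uf n)).
    by rewrite ltr_pMl ?exprn_gt0 ?ltr1n.
  by exists d.
have [x0 x0P] := quot_map_surj (u 0).
pose x n := x0 + \sum_(i < n) d i.
have xu n : quot_map (x n) = u n.
  elim: n => [|n IH]; first by rewrite /x big_ord0 addr0.
  rewrite /x big_ord_recr/= addrA quot_mapD -/(x n) IH.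
  by have [-> _] := dP n; rewrite addrC subrK.
have [|l lP] := @fast_cvg R s X (fun n => (ofreal hf : K) *: x n).
  move=> n; rewrite -scalerBr.
  have -> : x n.+1 - x n = d n.
    by rewrite /x big_ord_recr/= addrA [_ + d n]addrC addrK.
  rewrite rnormZ ger0_norm ?ofrealK; last by rewrite -ofreal0 ler_ofreal.
  by have [_ dn] := dP n; rewrite ler_pdivrMl.
exists (quot_map ((ofreal 2 : K) *: l)) => n.
rewrite -xu rnorm_quot.
have -> : quot_map (x n) - quot_map ((ofreal 2 : K) *: l) =
          quot_map ((ofreal 2 : K) *: ((ofreal hf : K) *: x n - l)).
  rewrite scalerBr scalerA -ofrealM divff ?pnatr_eq0// ofreal1 scale1r.
  by apply/eqP; rewrite subr_eq -quot_mapD subrK.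
apply: (le_trans (quot_norm_le _)).
rewrite rnormZ ger0_norm ?ofrealK; last by rewrite -ofreal0 ler_ofreal.
by apply: le_trans (ler_wpM2l _ (lP n)) _; rewrite // mulrA -natrM.
Qed.

HB.instance Definition _ := Uniform_isComplete.Build quot_banach quot_complete.

End QuotientBanach.
End Subspace.

Section Operators.
Context {R : realType} {s : scalar_kind}.
Local Notation K := (scalars R s).
Local Notation S := (scalar_space R s).
Implicit Types X Y Z : banach R s.

Definition bounded_op X Y (T : X -> Y) : Prop := linear T /\ continuous T.

Definition unit_ball X : set X := [set x | `|x| <= 1].
Arguments unit_ball : clear implicits.

Definition opnorm X Y (T : X -> Y) : R :=
  sup [set rnorm (T x) | x in unit_ball X].

Lemma opnormP X Y (T : X -> Y) x :
  bounded_op T -> rnorm (T x) <= opnorm T * rnorm x.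
Proof.
move=> [Tlin Tcont].
have T0 : T 0 = 0.
  by apply: (addrI (T 0)); have := Tlin 1 0 0; rewrite !scale1r !addr0.
have TZ k z : T (k *: z) = k *: T z.
  by have := Tlin k z 0; rewrite T0 !addr0.
have [x0|x0] := eqVneq (rnorm x) 0.
  by rewrite (rnorm0_eq0 x0) T0 !rnorm0 mulr0.
have {}x0 : 0 < rnorm x by rewrite lt_def x0 rnorm_ge0.
pose k : K := ofreal (rnorm x)^-1.
have kE : repart `|k| = (rnorm x)^-1.
  by rewrite /k ger0_norm ?ofrealK// -ofreal0 ler_ofreal invr_ge0 ltW.
rewrite -ler_pdivrMr// mulrC -kE -rnormZ -TZ.
have ballE z : unit_ball X z <-> rnorm z <= 1.
  by rewrite /unit_ball /= -(@ofreal1 R s) rnorm_le.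
apply: ub_le_sup; last first.
  by exists (k *: x) => //; apply/ballE; rewrite rnormZ kE mulVf// gt_eqF.
pose f : {linear X -> Y} := HB.pack T (GRing.isLinear.Build _ _ _ _ T Tlin).
have /bounded_funP /(_ 1)[M fM] : bounded_near f (nbhs 0).
  by apply: continuous_linear_bounded; exact: Tcont.
have M0 : 0 <= M.
  by apply: le_trans (fM 0 _); rewrite ?normr0.
exists (repart M) => _ [z z1 <-].
by rewrite -(@ler_ofreal R s) rnormE repartK//; exact: fM.
Qed.

Definition dual_ball X : set (X -> S) :=
  [set f | bounded_op f /\ opnorm f <= 1].
Arguments dual_ball : clear implicits.

Lemma eval_bounded X (x : X) :
  (fun f : dual_ball X => (\val f : X -> S) x) 
    \in @bounded_family R s (dual_ball X).
Proof.
apply/bounded_familyP; exists (rnorm x) => f.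
have [fb f1] := set_valP f.
by apply: (le_trans (opnormP x fb)); rewrite ler_piMl// rnorm_ge0.
Qed.

Definition linfty_inj X (x : X) : linfty R s (dual_ball X) :=
  Linfty (eval_bounded x).

(* The limit of the finite partial sums, along the directed set of finite
   subsets of the ball. *)
Definition lone_quot X (l : lone R s (unit_ball X)) : X :=
  summability.sum (fun b : unit_ball X => (l b : K) *: (\val b : X)).

Definition finite_dim (V : lmodType K) : Prop :=
  exists n (e : 'I_n -> V), forall x, exists c : 'I_n -> K,
    x = \sum_(i < n) c i *: e i.

Definition finite_rank X Y (T : X -> Y) : Prop :=
  bounded_op T /\
  exists n (e : 'I_n -> Y), forall x, exists c : 'I_n -> K,
    T x = \sum_(i < n) c i *: e i.

End Operators.

Arguments unit_ball {R s} X.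
Arguments dual_ball {R s} X.
Arguments linfty_inj {R s} X.
Arguments lone_quot {R s} X.

Definition opclass (R : realType) (s : scalar_kind) : Type :=
  forall X Y : banach R s, set (X -> Y).

Section OperatorClasses.
Context {R : realType} {s : scalar_kind}.
Implicit Types (A B : opclass R s) (X Y Z : banach R s).

Definition compact_op : opclass R s := fun X Y =>
  [set T | bounded_op T /\ compact (closure (T @` unit_ball X))].

Definition approximable_op : opclass R s := fun X Y =>
  [set T | bounded_op T /\ forall e : R, 0 < e ->
     exists2 F : X -> Y, finite_rank F & opnorm (T \- F) < e].

Definition comp_op A B : opclass R s := fun X Y =>
  [set T | exists Z (V : X -> Z) (U : Z -> Y),
     [/\ B X Z V, A Z Y U & T = U \o V]].

Definition com_ideal A : opclass R s :=
  comp_op compact_op (comp_op A compact_op).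

Definition min_ideal A : opclass R s :=
  comp_op approximable_op (comp_op A approximable_op).

Definition inj_hull A : opclass R s := fun X Y =>
  [set T | bounded_op T /\ A X (linfty R s (dual_ball Y)) (linfty_inj Y \o T)].

Definition sur_hull A : opclass R s := fun X Y =>
  [set T | bounded_op T /\ A (lone R s (unit_ball X)) Y (T \o lone_quot X)].

End OperatorClasses.

(* Quasi-normed operator ideals as axiomatized by Pietsch. Homogeneity of
   [alpha], closure under scalars, and ||T|| <= alpha T (hence definiteness)
   follow from the ideal property. Values of [alpha] off the ideal are
   irrelevant. *)
Record operator_ideal (R : realType) (s : scalar_kind) := OperatorIdeal {
  ideal_mem : forall X Y : banach R s, set (X -> Y);
  alpha : forall X Y : banach R s, (X -> Y) -> R;
  ideal_bounded : forall (X Y : banach R s) (T : X -> Y),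
    ideal_mem T -> bounded_op T;
  alpha_ge0 : forall (X Y : banach R s) (T : X -> Y),
    ideal_mem T -> 0 <= alpha T;
  ideal_id : ideal_mem (@idfun (scalar_space R s));
  alpha_id : alpha (@idfun (scalar_space R s)) = 1;
  idealD : forall (X Y : banach R s) (T1 T2 : X -> Y),
    ideal_mem T1 -> ideal_mem T2 -> ideal_mem (T1 \+ T2);
  alphaD : exists2 kappa : R, 1 <= kappa &
    forall (X Y : banach R s) (T1 T2 : X -> Y),
      ideal_mem T1 -> ideal_mem T2 ->
      alpha (T1 \+ T2) <= kappa * (alpha T1 + alpha T2);
  ideal_comp : forall (X0 X Y Y0 : banach R s)
      (V : X0 -> X) (T : X -> Y) (U : Y -> Y0),
    bounded_op V -> ideal_mem T -> bounded_op U ->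
    ideal_mem (U \o T \o V);
  alpha_comp : forall (X0 X Y Y0 : banach R s)
      (V : X0 -> X) (T : X -> Y) (U : Y -> Y0),
    bounded_op V -> ideal_mem T -> bounded_op U ->
    alpha (U \o T \o V) <= opnorm U * alpha T * opnorm V;
  ideal_complete : forall (X Y : banach R s) (T : nat -> X -> Y),
    (forall n, ideal_mem (T n)) ->
    (forall e : R, 0 < e -> exists N, forall m n, (N <= m)%N -> (N <= n)%N ->
       alpha (T m \- T n) < e) ->
    exists2 T' : X -> Y, ideal_mem T' &
      forall e : R, 0 < e -> exists N, forall n, (N <= n)%N ->
        alpha (T n \- T') < e }.

Arguments ideal_mem {R s} _ {X Y} _.
Arguments alpha {R s} _ {X Y} T.

Coercion ideal_class (R : realType) (s : scalar_kind) (A : operator_ideal R s) :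
  opclass R s := @ideal_mem R s A.

Section IdealProperties.
Context {R : realType} {s : scalar_kind}.
Variable A : operator_ideal R s.

Definition linfty_extension : Prop :=
  forall (X : banach R s) (G : choiceType) (T : X -> linfty R s G),
    ideal_mem A T ->
    exists T' : linfty R s (dual_ball X) -> linfty R s G,
      [/\ ideal_mem A T', T = T' \o linfty_inj X & alpha A T' = alpha A T].

Definition lone_lifting : Prop :=
  forall (G : choiceType) (Y : banach R s) (T : lone R s G -> Y),
    ideal_mem A T ->
    exists T' : lone R s G -> lone R s (unit_ball Y),
      [/\ ideal_mem A T', lone_quot Y \o T' = T & alpha A T' = alpha A T].

(* A finite-dimensional subspace is automatically closed. *)
Definition right_accessible : Prop :=
  forall (M Y : banach R s) (T : M -> Y) (e : R),
    finite_dim M -> ideal_mem A T -> 0 < e ->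
    exists N : closed_subspace Y, finite_dim (sub_banach N) /\
      exists S : M -> sub_banach N,
        [/\ ideal_mem A S, T = @sub_incl _ _ _ N \o S &
            alpha A S <= (1 + e) * alpha A T].

Definition left_accessible : Prop :=
  forall (X N : banach R s) (T : X -> N) (e : R),
    finite_dim N -> ideal_mem A T -> 0 < e ->
    exists L : closed_subspace X, finite_dim (quot_banach L) /\
      exists S : quot_banach L -> N,
        [/\ ideal_mem A S, T = S \o quot_map L &
            alpha A S <= (1 + e) * alpha A T].

End IdealProperties.

(* Main.v *)
Require Import Defs.
From HB Require Import structures.
From mathcomp Require Import all_boot all_order all_algebra finmap.
From mathcomp Require Import all_classical all_reals all_analysis.
From mathcomp Require Import summability complex ring lra.

Set Implicit Arguments.
Unset Strict Implicit.
Unset Printing Implicit Defensive.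
Import Order.TTheory GRing.Theory Num.Theory.
Import numFieldNormedType.Exports.

Local Open Scope classical_set_scope.
Local Open Scope ring_scope.

(* Both hulls are handled through one idea: inj_hull and sur_hull only see the
   compositions with linfty_inj and lone_quot, and a compact operator into
   l_oo(Gamma), or out of l_1(Gamma), is approximable because it is uniformly
   close to an operator that depends on Gamma only through a finite colouring;
   its approximants moreover extend along isometries (Hahn-Banach), respectively
   lift through lone_quot.
   If T = B o S with one factor in A and the other approximable, the latter is a
   fast converging series of finite rank operators, each of which factors
   through the quotient by its kernel. Accessibility then turns T into
   a series of B_n S_n C_n, with S_n in A between finite-dimensional spaces and
   alpha (S_n) rapidly decreasing, and such a series factors through the l_oo
   sums of these spaces as an element of the minimal kernel.
   Conversely, a factorization of linfty_inj Y o T or T o lone_quot X is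
   cut down to one of T, by restricting to the preimage of the (closed) range of
   linfty_inj Y, or by dividing by the kernel of the left factor. *)

(** * Bounded operators and the Hahn-Banach theorem *)

(** A compact operator between general Banach spaces need not be approximable, so the two kernels
    cannot be compared inside the ideal itself. The hulls place l_oo or l_1 next to an outer factor,
    where compact operators are approximable. In (a1) and (b1) this outer factor is the compact one.
    In (a2) and (b2) the factor from the ideal stands in between; the extension or lifting property
    lets it start at, or end in, an l_oo or l_1 space attached to the intermediate space, and the
    compact operator then meets that space. The constants come from the quasi-norm. Summing n terms
    may cost kappa ^ n, so the middle factors must decay like (2 kappa) ^ -n, while each outer
    factor needs decay 2 ^ -n to be approximable. An approximable operator can be decomposed at any
    geometric rate, and the rate (8 kappa) ^ -n pays for all of this at once. In one direction
    accessibility puts the decay on the middle factor, in the other on an outer one, and scalar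
    weights with product 1 redistribute it. *)

Section LinearFunctions.
Context {R : realType} {s : scalar_kind}.
Local Notation K := (scalars R s).
Implicit Types X Y Z : lmodType K.

Lemma lin0 X Y (T : X -> Y) : linear T -> T 0 = 0.
Proof.
by move=> Tl; apply: (addrI (T 0)); have := Tl 1 0 0; rewrite !scale1r !addr0.
Qed.

Lemma linZ X Y (T : X -> Y) k x : linear T -> T (k *: x) = k *: T x.
Proof. by move=> Tl; have := Tl k x 0; rewrite (lin0 Tl) !addr0. Qed.

Lemma linD X Y (T : X -> Y) x y : linear T -> T (x + y) = T x + T y.
Proof. by move=> Tl; have := Tl 1 x y; rewrite !scale1r. Qed.

Lemma linN X Y (T : X -> Y) x : linear T -> T (- x) = - T x.
Proof. by move=> Tl; rewrite -scaleN1r linZ// scaleN1r. Qed.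

Lemma linB X Y (T : X -> Y) x y : linear T -> T (x - y) = T x - T y.
Proof. by move=> Tl; rewrite linD// linN. Qed.

Lemma lin_sum X Y (T : X -> Y) I (r : seq I) (P : pred I) (F : I -> X) :
  linear T -> T (\sum_(i <- r | P i) F i) = \sum_(i <- r | P i) T (F i).
Proof.
move=> Tl; apply: (big_morph T) => [x y|]; [exact: linD|exact: lin0].
Qed.

Lemma linear_comp X Y Z (T : X -> Y) (U : Y -> Z) :
  linear T -> linear U -> linear (U \o T).
Proof. by move=> Tl Ul k x y /=; rewrite Tl Ul. Qed.

Lemma linear_add X Y (T U : X -> Y) : linear T -> linear U -> linear (T \+ U).
Proof. by move=> Tl Ul k x y /=; rewrite Tl Ul scalerDr addrACA. Qed.

Lemma linear_sub X Y (T U : X -> Y) : linear T -> linear U -> linear (T \- U).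
Proof.
by move=> Tl Ul k x y /=; rewrite Tl Ul scalerBr opprD addrACA.
Qed.

Lemma linear_scale X Y (T : X -> Y) k : linear T -> linear (fun x => k *: T x).
Proof.
by move=> Tl a x y; rewrite Tl scalerDr !scalerA [k * a]mulrC.
Qed.

Lemma linear_id X : linear (@idfun X).
Proof. by []. Qed.

Lemma linear_sum X Y n (T : 'I_n -> X -> Y) :
  (forall i, linear (T i)) -> linear (fun x => \sum_(i < n) T i x).
Proof.
move=> Tl k x y; rewrite scaler_sumr -big_split/=.
by apply: eq_bigr => i _; rewrite Tl.
Qed.

End LinearFunctions.

Section BoundedOperators.
Context {R : realType} {s : scalar_kind}.
Local Notation K := (scalars R s).
Implicit Types X Y Z : banach R s.

Lemma rabs_ge0 (k : K) : 0 <= repart `|k|.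
Proof. by rewrite -(@ler_ofreal R s) ofreal0 repartK. Qed.

Lemma rnormZr X (a : R) (x : X) : 0 <= a -> rnorm (ofreal a *: x) = a * rnorm x.
Proof.
move=> a0; rewrite rnormZ ger0_norm ?ofrealK//.
by rewrite -ofreal0 ler_ofreal.
Qed.

Lemma rnorm_sum X I (r : seq I) (F : I -> X) :
  rnorm (\sum_(i <- r) F i) <= \sum_(i <- r) rnorm (F i).
Proof.
elim/big_ind2 : _ => [|x a y b xa yb|//]; first by rewrite rnorm0.
by apply: (le_trans (rnormD _ _)); exact: lerD.
Qed.

Lemma eq_of_rnorm_le X (x y : X) : (forall e : R, 0 < e -> rnorm (x - y) <= e) -> x = y.
Proof.
move=> xy; apply/eqP; rewrite -subr_eq0; apply/eqP/rnorm0_eq0/eqP.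
rewrite eq_le rnorm_ge0 andbT; apply/ler_addgt0Pr => e e0.
by rewrite add0r; exact: xy.
Qed.

Lemma unit_ballE X (x : X) : unit_ball X x <-> rnorm x <= 1.
Proof. by rewrite /unit_ball/= -(@ofreal1 R s) rnorm_le. Qed.

Lemma bounded_opI X Y (T : X -> Y) (M : R) :
  linear T -> (forall x, rnorm (T x) <= M * rnorm x) -> bounded_op T.
Proof.
move=> Tl TM; split=> //.
pose f : {linear X -> Y} := HB.pack T (GRing.isLinear.Build _ _ _ _ T Tl).
suff : continuous f by [].
apply/linear_bounded_continuous/linear_boundedP.
near=> k => x.
have k0 : 0 <= k by near: k; apply: nbhs_pinfty_ge; exact: real0.
have : ofreal M <= k.
  near: k; apply: nbhs_pinfty_ge.
  by rewrite realE -ofreal0 !ler_ofreal le_total.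
rewrite -(repartK k0) ler_ofreal => Mk.
rewrite -!rnormE -ofrealM ler_ofreal; apply: (le_trans (TM x)).
by rewrite ler_wpM2r// rnorm_ge0.
Unshelve. all: by end_near. Qed.


Lemma bounded_linear X Y (T : X -> Y) : bounded_op T -> linear T.
Proof. by case. Qed.

Lemma opnorm_ge0 X Y (T : X -> Y) : 0 <= opnorm T.
Proof.
rewrite /opnorm; set A := (X in sup X).
have [Ab|Ab] := pselect (has_ubound A); last by rewrite sup_out// => -[_].
have A0 : A (rnorm (T 0)) by exists 0 => //; apply/unit_ballE; rewrite rnorm0.
by apply: (le_trans (rnorm_ge0 (T 0))); exact: ub_le_sup.
Qed.

Lemma opnorm_le X Y (T : X -> Y) (M : R) : 0 <= M ->
  (forall x, rnorm (T x) <= M * rnorm x) -> opnorm T <= M.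
Proof.
move=> M0 TM; apply: ge_sup.
  by exists (rnorm (T 0)), 0 => //; apply/unit_ballE; rewrite rnorm0.
move=> _ [x /unit_ballE x1 <-]; apply: (le_trans (TM x)).
by rewrite -[leRHS]mulr1 ler_wpM2l.
Qed.

Lemma bounded_op_comp X Y Z (T : X -> Y) (U : Y -> Z) :
  bounded_op T -> bounded_op U -> bounded_op (U \o T).
Proof.
move=> Tb Ub.
apply: (@bounded_opI _ _ _ (opnorm U * opnorm T)) => [|x].
  by apply: linear_comp; exact: bounded_linear.
rewrite -mulrA; apply: (le_trans (opnormP _ Ub)).
by rewrite ler_wpM2l ?opnorm_ge0// opnormP.
Qed.

Lemma bounded_op_add X Y (T U : X -> Y) :
  bounded_op T -> bounded_op U -> bounded_op (T \+ U).
Proof.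
move=> Tb Ub; apply: (@bounded_opI _ _ _ (opnorm T + opnorm U)) => [|x].
  by apply: linear_add; exact: bounded_linear.
by rewrite mulrDl (le_trans (rnormD _ _))// lerD// opnormP.
Qed.

Lemma bounded_op_scale X Y (T : X -> Y) k :
  bounded_op T -> bounded_op (fun x => k *: T x).
Proof.
move=> Tb; apply: (@bounded_opI _ _ _ (repart `|k| * opnorm T)) => [|x].
  by apply: linear_scale; exact: bounded_linear.
by rewrite rnormZ -mulrA ler_wpM2l ?rabs_ge0// opnormP.
Qed.

Lemma bounded_op_sub X Y (T U : X -> Y) :
  bounded_op T -> bounded_op U -> bounded_op (T \- U).
Proof.
move=> Tb Ub; have := bounded_op_add Tb (bounded_op_scale (- 1) Ub).
by congr bounded_op; apply/funext => x /=; rewrite scaleN1r.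
Qed.

Lemma bounded_op_id X : bounded_op (@idfun X).
Proof. by apply: (@bounded_opI _ _ _ 1) => // x; rewrite mul1r. Qed.

Lemma bounded_op_sum X Y n (T : 'I_n -> X -> Y) :
  (forall i, bounded_op (T i)) -> bounded_op (fun x => \sum_(i < n) T i x).
Proof.
move=> Tb; apply: (@bounded_opI _ _ _ (\sum_(i < n) opnorm (T i))) => [|x].
  by apply: linear_sum => i; exact: bounded_linear.
rewrite mulr_suml (le_trans (rnorm_sum _ _))// ler_sum// => i _.
exact: opnormP.
Qed.

Lemma opnorm_comp_le X Y Z (T : X -> Y) (U : Y -> Z) :
  bounded_op T -> bounded_op U -> opnorm (U \o T) <= opnorm U * opnorm T.
Proof.
move=> Tb Ub; apply: opnorm_le => [|x]; first by rewrite mulr_ge0 ?opnorm_ge0.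
rewrite -mulrA (le_trans (opnormP _ Ub))// ler_wpM2l ?opnorm_ge0//.
exact: opnormP.
Qed.

End BoundedOperators.

(** * The Hahn-Banach theorem for real and complex scalars *)

Section HahnBanach.
Context {R : realType} {s : scalar_kind}.
Local Notation K := (scalars R s).
Local Notation S := (scalar_space R s).

Lemma ofrealN (a : R) : ofreal (- a) = - ofreal a :> K.
Proof. by apply: (addrI (ofreal a)); rewrite -ofrealD !subrr ofreal0. Qed.

(* The graphs of the real linear functionals dominated by p on real subspaces
   of V; domination by p at 0 makes such a graph single-valued. *)
Definition real_graph (V : lmodType K) (p : V -> R) (G : set (V * R)) : Prop :=
  (forall (a : R) v w, G v -> G w ->
     G ((ofreal a : K) *: v.1 + w.1, a * v.2 + w.2)) /\
  (forall v, G v -> v.2 <= p v.1).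

Section Real.
Variables (V : lmodType K) (p : V -> R).
Hypothesis pD : forall x y, p (x + y) <= p x + p y.
Hypothesis pZ : forall (a : R) x, 0 <= a -> p ((ofreal a : K) *: x) = a * p x.

Let p0 : p 0 = 0.
Proof. by rewrite -(scaler0 _ (ofreal 0 : K)) pZ// mul0r. Qed.

Let realZ (a b : R) (x : V) :
  (ofreal a : K) *: ((ofreal b : K) *: x) = (ofreal (a * b) : K) *: x.
Proof. by rewrite scalerA -ofrealM. Qed.

Let realZ1 (x : V) : (ofreal 1 : K) *: x = x.
Proof. by rewrite ofreal1 scale1r. Qed.

Lemma real_graph_scale (G : set (V * R)) a v : real_graph p G -> G (0, 0) ->
  G v -> G ((ofreal a : K) *: v.1, a * v.2).
Proof. by move=> [Gl _] G0 /(Gl a _ _) /(_ G0)/=; rewrite !addr0. Qed.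

Lemma real_graph_fun (G : set (V * R)) x a b : real_graph p G ->
  G (x, a) -> G (x, b) -> a = b.
Proof.
move=> [Gl Gp]; have le c d : G (x, c) -> G (x, d) -> d <= c.
  move=> xc xd; have /Gp/= := Gl (- 1) _ _ xc xd; rewrite ofrealN ofreal1.
  by rewrite scaleN1r addNr p0 mulN1r addrC subr_le0.
by move=> xa xb; apply/eqP; rewrite eq_le !le.
Qed.

(** The value at [v] must lie above every x.2 - p (x.1 - v) and below every p (y.1 + v) - y.2.
    Subadditivity puts the former below the latter, so the supremum of the lower bounds is
    admissible. Positive homogeneity reduces a general multiple of [v] to [v] and [- v]. *)
Lemma real_graph_extend (G : set (V * R)) v : real_graph p G -> G (0, 0) ->
  exists c, real_graph p [set y | exists (x : V * R) (a : R),
    G x /\ y = (x.1 + (ofreal a : K) *: v, x.2 + a * c)].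
Proof.
move=> Gg G0; have [Gl Gp] := Gg.
pose A := [set x.2 - p (x.1 - v) | x in G].
have Aub y : G y -> ubound A (p (y.1 + v) - y.2).
  move=> Gy _ [x Gx <-]; rewrite lerBlDr addrAC lerBrDr.
  have := Gp _ (Gl 1 _ _ Gx Gy); rewrite /= realZ1 mul1r.
  move=> /le_trans; apply; rewrite [leRHS]addrC [leRHS]addrC.
  by apply: le_trans (pD _ _); rewrite addrACA subrr addr0 addrC.
have A0 : A !=set0 by exists (0 - p (0 - v)), (0, 0).
have cge x : G x -> x.2 - p (x.1 - v) <= sup A.
  move=> Gx; apply: ub_le_sup; last by exists x.
  by exists (p (0 + v) - 0); exact: Aub G0.
have cle y : G y -> sup A <= p (y.1 + v) - y.2.
  by move=> Gy; apply: ge_sup => //; exact: Aub.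
exists (sup A); split=> [k _ _ [x [a [Gx ->]]] [y [b [Gy ->]]] /=|].
  exists ((ofreal k : K) *: x.1 + y.1, k * x.2 + y.2), (k * a + b).
  split; first exact: Gl.
  congr pair; last by rewrite /= mulrDl mulrDr -mulrA addrACA.
  rewrite /= ofrealD scalerDl -realZ [RHS]addrACA -scalerDr.
  by [].
move=> _ [x [a [Gx ->]]] /=.
have [a0|a0|->] := ltgtP a 0; last by rewrite ofreal0 scale0r mul0r !addr0; exact: Gp.
- have a0' : 0 < - a by rewrite oppr_gt0.
  have := cge _ (real_graph_scale (- a)^-1 Gg G0 Gx).
  rewrite /= lerBlDr -(ler_pM2l a0') [leRHS]mulrDr -(pZ _ (ltW a0')).
  rewrite scalerBr realZ mulrA !mulfV ?gt_eqF// realZ1 mul1r.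
  rewrite ofrealN scaleNr opprK mulNr => h.
  by rewrite -lerBrDr; apply: le_trans h _; rewrite addrC.
- have := cle _ (real_graph_scale a^-1 Gg G0 Gx).
  rewrite /= lerBrDr -(ler_pM2l a0) -(pZ _ (ltW a0)) scalerDr realZ mulfV ?gt_eqF//.
  by rewrite realZ1 mulrDr mulrA mulfV ?gt_eqF// mul1r addrC.
Qed.

Lemma real_hahn_banach (G : set (V * R)) : real_graph p G -> G (0, 0) ->
  exists2 g : V -> R, (forall v, g v <= p v) /\
    (forall a x y, g ((ofreal a : K) *: x + y) = a * g x + g y) &
    forall v, G v -> g v.1 = v.2.
Proof.
move=> Gg G0; have [Gl Gp] := Gg.
(* Zorn's lemma runs over the sets that become dominated graphs after adding [G]; the union of the
   empty chain is then admissible. *)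
have [|H [Hg Hmax]] := @Zorn_bigcup _ (fun A => real_graph p (A `|` G)).
  move=> F FP Ftot; split=> [a v w vF wF|v [[A FA Av]|]]; last exact: Gp.
    have [A [FA Av Aw]] : exists A, [/\ A = set0 \/ F A, (A `|` G) v & (A `|` G) w].
      case: vF => [[A FA Av]|Gv]; case: wF => [[B FB Bw]|Gw].
      - have [AB|BA] := Ftot _ _ FA FB.
          by exists B; split; [right|left; exact: AB|left].
        by exists A; split; [right|left|left; exact: BA].
      - by exists A; split; [right|left|right].
      - by exists B; split; [right|right|left].
      - by exists set0; split; [left|right|right].
    case: FA => [A0|FA]; last first.
      by have [/(_ a _ _ Av Aw)[?|?] _] := FP _ FA; [left; exists A|right].
    move: Av Aw; rewrite A0 !set0U => Gv Gw; right; exact: Gl.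
  by have [_] := FP _ FA; apply; left.
pose H' := H `|` G.
have H0 : H' (0, 0) by right.
(* A maximal graph is defined at every [v], since its extension to [v] would otherwise be strictly
   larger. *)
have Htot v : exists c, H' (v, c).
  have [c cP] := real_graph_extend v Hg H0.
  set H2 := (X in real_graph p X) in cP.
  have HH2 : H' `<=` H2.
    move=> x Hx; exists x, 0; split=> //.
    by rewrite ofreal0 scale0r mul0r !addr0 -surjective_pairing.
  have H2G : H2 `|` G = H2.
    by apply/setUidPl => x Gx; apply: HH2; right.
  have H2v : H2 (v, c).
    by exists (0, 0), 1; split=> //=; rewrite realZ1 mul1r !add0r.
  exists c; left; apply: contrapT => nH.
  apply: (Hmax H2); last by rewrite H2G.
  split; first by move=> x Hx; apply: HH2; left.
  by move=> /(_ _ H2v).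
have [g gP] := choice Htot.
have gE v : H' v -> g v.1 = v.2.
  by case: v => v c vc; exact: (real_graph_fun Hg (gP v) vc).
have [Hl Hp] := Hg.
exists g; last by move=> v Gv; apply: gE; right.
split=> [v|a x y]; first exact: (Hp _ (gP v)).
by have := gE _ (Hl a _ _ (gP x) (gP y)).
Qed.

End Real.

(** In the complex case the functional is F x = g x - i g (i x). *)
Lemma linear_functional_of_real_part (V : lmodType K) (g : V -> R) :
  (forall a x y, g ((ofreal a : K) *: x + y) = a * g x + g y) ->
  exists2 F : V -> S, linear F & forall x, repart (F x : K) = g x.
Proof.
rewrite /S /scalar_space; move: V g; rewrite /ofreal /repart.
case: s => /= V g gl; first by exists g => // k x y; exact: gl.
have gD x y : g (x + y) = g x + g y.
  by have := gl 1 x y; rewrite rmorph1 scale1r mul1r.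
have g0 : g 0 = 0 by apply: (addrI (g 0)); rewrite -gD !addr0.
have gZ a x : g (a%:C%C *: x) = a * g x.
  by have := gl a x 0; rewrite g0 !addr0.
have gN x : g (- x) = - g x by apply: (addrI (g x)); rewrite -gD !subrr.
have gC k x : g (k *: x) = complex.Re k * g x + complex.Im k * g ('i%C *: x).
  by rewrite {1}(complexE k) mulrC scalerDl -scalerA gl gZ.
have gi x : g ('i%C *: ('i%C *: x)) = - g x.
  by rewrite scalerA -expr2 sqr_i scaleN1r gN.
exists (fun x => (g x +i* - g ('i%C *: x))%C) => // k x y.
have gik : g ('i%C *: (k *: x)) = complex.Re k * g ('i%C *: x) - complex.Im k * g x.
  by rewrite scalerA mulrC -scalerA gC gi mulrN.
apply/eqP; rewrite eq_complex /= scalerDr !gD gC gik.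
by case: k {gik} => a b /=; apply/andP; split; apply/eqP; ring.
Qed.

(** Multiplying x by |F x| / F x turns the value into |F x|, which is its own real part. *)
Lemma linear_functional_ext (V : lmodType K) (F : V -> S) :
  linear F -> (forall x, repart (F x : K) = 0) -> forall x, F x = 0.
Proof.
move=> Fl F0 x; have [//|Fx] := eqVneq (F x) 0.
have := F0 ((`|F x : K| / F x) *: x); rewrite linZ//.
rewrite -[X in repart X]/((`|F x : K| / F x) * F x) divfK// => r0.
by apply: rnorm0_eq0; exact: r0.
Qed.

(* In place of a subspace of W we extend along an isometry J : V -> W. *)
Theorem hahn_banach (V W : banach R s) (J : V -> W) (f : V -> S) (M : R) :
  linear J -> (forall x, rnorm (J x) = rnorm x) -> linear f ->
  (forall x, rnorm (f x) <= M * rnorm x) -> 0 <= M ->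
  exists F : W -> S,
    [/\ linear F, forall w, rnorm (F w) <= M * rnorm w & F \o J = f].
Proof.
move=> Jl Jiso fl fM M0.
have repart_le (z : S) : repart (z : K) <= rnorm z.
  rewrite -(@ler_ofreal R s) rnormE /repart /ofreal; move: z.
  rewrite /scalar_space; case: (s) => /= z; first exact: ler_norm.
  by apply: le_trans (normc_ge_Re z); rewrite lecR ler_norm.
(* A unimodular factor turns a value of the functional into its modulus, so domination of the real
   part bounds the whole functional. *)
have rotate (z : S) : exists2 k : K, `|k| = 1 & k * (z : K) = `|z : K|.
  have [->|z0] := eqVneq z 0.
    by exists 1; rewrite ?normr1// mulr0 normr0.
  exists (`|z : K| / z); last by rewrite divfK.
  by rewrite normrM normr_id normrV ?unitfE// divff// normr_eq0.
pose p w := M * rnorm (w : W).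
have pD x y : p (x + y) <= p x + p y by rewrite -mulrDr ler_wpM2l// rnormD.
have pZ (a : R) x : 0 <= a -> p ((ofreal a : K) *: x) = a * p x.
  by move=> a0; rewrite /p rnormZr// mulrCA.
pose G := [set (J x, repart (f x : K)) | x in [set: V]].
have repD (x y : S) (a : R) : repart ((ofreal a : K) *: x + y : K) =
    a * repart (x : K) + repart (y : K).
  rewrite /repart /ofreal; move: x y; rewrite /scalar_space.
  case: (s) => //= x y; case: x => x1 x2; case: y => y1 y2 /=.
  by rewrite mul0r subr0.
have Gg : real_graph p G.
  split=> [a _ _ [x _ <-] [y _ <-] /=|_ [x _ <-] /=].
    by exists ((ofreal a : K) *: x + y) => //; rewrite Jl fl repD.
  by apply: (le_trans (repart_le _)); rewrite /p Jiso.
have G0 : G (0, 0).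
  exists 0 => //; rewrite lin0// lin0//; congr pair.
  by rewrite -[RHS](@ofrealK R s) ofreal0.
have [g [gp gl] gG] := real_hahn_banach pD pZ Gg G0.
have [F Fl Fg] := linear_functional_of_real_part gl.
exists F; split=> [//|w|].
  have [k k1 kF] := rotate (F w).
  have := gp (k *: w); rewrite -Fg linZ// -[_ *: _]/(k * (F w : K)) kF /p rnormZ.
  by rewrite k1 -(@ofreal1 R s) ofrealK mul1r.
apply/funext => x; apply/eqP; rewrite -subr_eq0; apply/eqP.
apply: (@linear_functional_ext _ (fun x => F (J x) - f x)) => [|{}x].
  by apply: linear_sub => //; exact: linear_comp.
have := repD (f x) (F (J x)) (- 1).
rewrite ofrealN ofreal1 scaleN1r addrC => ->; rewrite Fg.
have -> : g (J x) = repart (f x : K) by apply: (gG (J x, _)); exists x.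
by rewrite mulN1r addNr.
Qed.

End HahnBanach.

(** * Duality and total boundedness *)

Section Duality.
Context {R : realType} {s : scalar_kind}.
Local Notation K := (scalars R s).
Local Notation S := (scalar_space R s).
Implicit Types X Y Z : banach R s.

(** The identity of the scalars is extended along the isometry k |-> (k / |x|) x, which sends |x| to
    x. *)
Lemma norming_functional X (x : X) : exists F : X -> S,
  [/\ linear F, forall y, rnorm (F y) <= rnorm y & F x = `|x| :> K].
Proof.
have [->|x0] := eqVneq x 0.
  exists (fun=> 0); split=> [k y z|y|]; rewrite ?scaler0 ?addr0 ?rnorm0//.
    exact: rnorm_ge0.
  by rewrite normr0.
pose J (k : S) : X := (k / `|x| : K) *: x.
have Jl : linear J by move=> k a b; rewrite /J scalerA -scalerDl mulrA -mulrDl.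
have Ji k : rnorm (J k) = rnorm k.
  apply: (can_inj (@ofrealK R s)).
  by rewrite !rnormE normrZ normrM normfV normr_id divfK// normr_eq0.
have id1 (k : S) : rnorm (idfun k) <= 1 * rnorm k by rewrite mul1r.
have [F [Fl F1 FJ]] := hahn_banach Jl Ji (@linear_id _ _ _) id1 ler01.
exists F; split=> // [y|]; first by rewrite (le_trans (F1 _))// mul1r.
have Jx : J `|x| = x by rewrite /J divff ?normr_eq0// scale1r.
by rewrite -[in LHS]Jx -[LHS]/((F \o J) `|x|) FJ.
Qed.

Lemma linfty_coord (G : choiceType) (f : linfty R s G) g : rnorm (f g) <= rnorm f.
Proof.
rewrite rnorm_linfty; apply: ub_le_sup; last by exists g.
by have /asboolP := linfty_funP f.
Qed.

Lemma linfty_le (G : choiceType) (f : linfty R s G) (M : R) : 0 <= M ->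
  (forall g, rnorm (f g) <= M) -> rnorm f <= M.
Proof.
move=> M0 fM; rewrite rnorm_linfty /linfty_norm.
have [->|/set0P ne] := eqVneq (range (fun g => rnorm (f g))) set0.
  by rewrite sup0.
by apply: ge_sup => // _ [g _ <-].
Qed.

Lemma linfty_inj_linear X : linear (linfty_inj X).
Proof.
move=> k x y; apply: val_inj; apply/funext => f /=.
by have [[Fl _] _] := set_valP f; rewrite Fl.
Qed.

(** The coordinate at a norming functional of x attains the norm. *)
Lemma linfty_inj_isometry X (x : X) : rnorm (linfty_inj X x) = rnorm x.
Proof.
apply/eqP; rewrite eq_le; apply/andP; split.
  apply: linfty_le => [|f]; first exact: rnorm_ge0.
  have [fb f1] := set_valP f.
  by apply: (le_trans (opnormP x fb)); rewrite ler_piMl// rnorm_ge0.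
have [F [Fl F1 Fx]] := norming_functional x.
have Fd : F \in dual_ball X.
  apply/mem_set; split.
    by apply: (@bounded_opI _ _ _ _ _ 1) => // y; rewrite mul1r.
  by apply: opnorm_le => // y; rewrite mul1r.
apply: le_trans (linfty_coord (linfty_inj X x) (SigSub Fd)).
by rewrite /= Fx /rnorm normr_id.
Qed.

Lemma linfty_inj_bounded X : bounded_op (linfty_inj X).
Proof.
apply: (@bounded_opI _ _ _ _ _ 1) => [|x]; first exact: linfty_inj_linear.
by rewrite mul1r linfty_inj_isometry.
Qed.

(* Post- and precomposing T with rank-one maps through x and a functional
   norming T x gives a multiple of the identity of the scalars. *)
Lemma ideal_opnorm_le (A : operator_ideal R s) X Y (T : X -> Y) x :
  ideal_mem A T -> rnorm (T x) <= alpha A T * rnorm x.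
Proof.
move=> AT; have [->|Tx] := eqVneq (T x) 0.
  by rewrite rnorm0 mulr_ge0 ?rnorm_ge0// alpha_ge0.
have [F [Fl F1 FT]] := norming_functional (T x).
have Tx0 : 0 < rnorm (T x).
  rewrite lt_neqAle rnorm_ge0 andbT eq_sym; apply: contra_neq Tx.
  exact: rnorm0_eq0.
pose V (k : S) : X := (k : K) *: x.
pose c : K := ofreal (rnorm (T x))^-1.
have Vb : bounded_op V.
  apply: (@bounded_opI _ _ _ _ _ (rnorm x)) => [a k l|k].
    by rewrite /V scalerA -scalerDl.
  by rewrite rnormZ mulrC.
have Fb : bounded_op F by apply: (@bounded_opI _ _ _ _ _ 1) => // y; rewrite mul1r.
pose U y := c *: F y.
have Ub : bounded_op U by exact: bounded_op_scale.
have UTV : U \o T \o V = idfun.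
  apply/funext => k; rewrite /U /V /= (linZ _ _ (bounded_linear (ideal_bounded AT))).
  rewrite linZ// FT /c -rnormE scalerA -[LHS]/(_ * _ * _) mulrAC -ofrealM.
  by rewrite mulVf ?gt_eqF// ofreal1 mul1r.
have := alpha_comp Vb AT Ub; rewrite UTV alpha_id => le1.
have Un : opnorm U <= (rnorm (T x))^-1.
  apply: opnorm_le => [|y]; first by rewrite invr_ge0 ltW.
  by rewrite rnormZr ?invr_ge0 ?(ltW Tx0)// ler_wpM2l// invr_ge0 ltW.
have Vn : opnorm V <= rnorm x.
  by apply: opnorm_le => [|k]; rewrite ?rnorm_ge0// rnormZ mulrC.
have : 1 <= (rnorm (T x))^-1 * alpha A T * rnorm x.
  apply: (le_trans le1); apply: ler_pM; rewrite ?opnorm_ge0 ?mulr_ge0 ?opnorm_ge0 ?alpha_ge0//.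
  by rewrite ler_wpM2r ?alpha_ge0.
by rewrite -mulrA ler_pdivlMl// mulr1.
Qed.

End Duality.

(** * Total boundedness and compact operators *)

Section TotallyBounded.
Context {R : realType} {s : scalar_kind}.
Local Notation K := (scalars R s).

(** The centres may lie outside [A], so the property passes to subsets directly. *)
Definition totally_bounded (V : normedModType K) (A : set V) :=
  forall e : R, 0 < e -> exists r : seq V,
    forall x, A x -> exists2 y, y \in r & rnorm (x - y) <= e.

Lemma totally_boundedS (V : normedModType K) (A B : set V) :
  A `<=` B -> totally_bounded B -> totally_bounded A.
Proof. by move=> AB + e e0 => /(_ e e0)[r rP]; exists r => x /AB/rP. Qed.

Lemma totally_bounded_approx (V : normedModType K) (A : set V) :
  (forall e : R, 0 < e -> exists2 B, totally_bounded B &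
     forall x, A x -> exists2 y, B y & rnorm (x - y) <= e) ->
  totally_bounded A.
Proof.
move=> AP e e0; have e2 : 0 < e / 2 by rewrite divr_gt0.
have [B Bt AB] := AP _ e2; have [r rP] := Bt _ e2.
exists r => x /AB[y /rP[z zr yz] xy]; exists z => //.
by apply: (le_trans (rnorm_distD y _ _)); rewrite [leRHS](splitr e) lerD.
Qed.

Lemma totally_bounded_image (V W : normedModType K) (f : V -> W) (M : R) A :
  (forall x y, rnorm (f x - f y) <= M * rnorm (x - y)) ->
  totally_bounded A -> totally_bounded (f @` A).
Proof.
move=> fM At e e0; have M1 : 0 < `|M| + 1 by rewrite ltr_wpDl.
have [r rP] := At (e / (`|M| + 1)) ltac:(by rewrite divr_gt0).
exists (map f r) => _ [x /rP[y yr xy] <-].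
exists (f y); first exact: map_f.
apply: (le_trans (fM _ _)).
apply: (@le_trans _ _ ((`|M| + 1) * rnorm (x - y))).
  rewrite ler_wpM2r ?rnorm_ge0//; apply: (le_trans (ler_norm _)).
  by rewrite lerDl.
by rewrite mulrC -ler_pdivlMr.
Qed.

(** The centres of a net of the image may lie off the range of f. Each is replaced by a value of f
    within e / 2 of it, if there is one, which doubles the radius. *)
Lemma totally_bounded_isometry (V W : normedModType K) (f : V -> W) A :
  (forall x y, rnorm (f x - f y) = rnorm (x - y)) ->
  totally_bounded (f @` A) -> totally_bounded A.
Proof.
move=> fi At e e0; have e2 : 0 < e / 2 by rewrite divr_gt0.
have [r rP] := At _ e2.
have /choice[h hP] y : exists z : V, (exists x, rnorm (f x - y) <= e / 2) ->
    rnorm (f z - y) <= e / 2.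
  have [[x xy]|n] := pselect (exists x, rnorm (f x - y) <= e / 2).
    by exists x.
  by exists 0 => /n.
exists (map h r) => x Ax; have [y yr xy] := rP (f x) (imageP f Ax).
exists (h y); first exact: map_f.
rewrite -fi; apply: (le_trans (rnorm_distD y _ _)).
rewrite [leRHS](splitr e) lerD// rnormBC; apply: hP; by exists x.
Qed.

Lemma totally_bounded_closure (V : normedModType K) (A : set V) :
  totally_bounded A -> totally_bounded (closure A).
Proof.
move=> At; apply: totally_bounded_approx => e e0; exists A => // x Ax.
have [|y [Ay xy]] := Ax (ball x (ofreal e)).
  by apply: nbhsx_ballx; rewrite -ofreal0 ltr_ofreal.
by exists y => //; move: xy; rewrite -ball_normE /= rnorm_lt => /ltW.
Qed.

(** Selects from a finite net one ball that belongs to the ultrafilter. *)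
Lemma ultra_big_setU T (F : set_system T) (I : eqType) (r : seq I)
    (P : I -> set T) : UltraFilter F ->
  F [set x | exists2 i, i \in r & P i x] -> exists2 i, i \in r & F (P i).
Proof.
move=> FU; elim: r => [|i r IH] Fr.
  by have [x [j]] := filter_ex Fr.
have [Fi|Fi] := in_ultra_setVsetC (P i) FU; first by exists i; rewrite ?mem_head.
have [|j jr Fj] := IH; last by exists j; rewrite // in_cons jr orbT.
apply: filterS (filterI Fr Fi) => x [[j jir Pj] nPi]; move: jir; rewrite in_cons.
by case/orP => [/eqP ij|jr]; [rewrite ij in Pj|exists j].
Qed.

(** An ultrafilter on the closure contains a ball of every radius, hence is Cauchy and converges by
    completeness. *)
Lemma totally_bounded_compact (V : completeNormedModType K) (A : set V) :
  totally_bounded A -> compact (closure A).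
Proof.
move=> /totally_bounded_closure At; rewrite compact_ultra => F FU FA.
have : cvg F.
  apply/cauchy_cvgP/cauchy_exP => e e0.
  have e0' : 0 < repart e by rewrite -(@ltr_ofreal R s) ofreal0 repartK ?ltW.
  have [r rP] := At (repart e / 2) ltac:(by rewrite divr_gt0).
  have [|y yr Fy] := @ultra_big_setU _ F _ r (fun y x => rnorm (x - y) <= repart e / 2) FU.
    by apply: filterS FA.
  exists y; apply: filterS Fy => x xy.
  rewrite -ball_normE /= -(repartK (ltW e0)) rnorm_lt rnormBC.
  by apply: (le_lt_trans xy); rewrite ltr_pdivrMr// ltr_pMr// ltr1n.
move=> /cvg_ex[p Fp]; exists p; split=> //=.
apply: closed_closure => B pB; apply: (@filter_ex _ F).
exact: filterI FA (Fp _ pB).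
Qed.

Lemma compact_totally_bounded (V : normedModType K) (A : set V) :
  compact A -> totally_bounded A.
Proof.
rewrite compact_cover => Ac e e0.
have e0' : 0 < ofreal e :> K by rewrite -ofreal0 ltr_ofreal.
have [|x Ax|D _ DA] := Ac V setT (fun y => ball y (ofreal e)).
- by move=> y _; exact: ball_open.
- by exists x => //; exact: ballxx.
exists D => x /DA[y yD]; rewrite -ball_normE /= rnorm_lt rnormBC => /ltW.
by exists y.
Qed.

Lemma compact_opP (X Y : banach R s) (T : X -> Y) :
  compact_op T <-> bounded_op T /\ totally_bounded (T @` unit_ball X).
Proof.
split=> -[Tb Tc]; split=> //; last exact: totally_bounded_compact.
by apply: totally_boundedS (compact_totally_bounded Tc); exact: subset_closure.
Qed.

End TotallyBounded.

(** * Finite rank, approximable and compact operators *)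

Section FiniteDimension.
Context {R : realType} {s : scalar_kind}.
Local Notation K := (scalars R s).
Local Notation S := (scalar_space R s).

(** [finite_dim] and [finite_rank] are, by conversion, statements about this span of a possibly
    dependent family. *)
Definition lspan (V : lmodType K) n (e : 'I_n -> V) : set V :=
  [set x | exists c : 'I_n -> K, x = \sum_(i < n) c i *: e i].

Lemma lspan_lin (V : lmodType K) n (e : 'I_n -> V) k x y :
  lspan e x -> lspan e y -> lspan e (k *: x + y).
Proof.
move=> [c ->] [d ->]; exists (fun i => k * c i + d i).
rewrite scaler_sumr -big_split/=; apply: eq_bigr => i _.
by rewrite scalerDl scalerA.
Qed.

Lemma lspan_recr (V : lmodType K) n (e : 'I_n.+1 -> V) x : lspan e x ->
  exists y k, lspan (e \o widen_ord (leqnSn n)) y /\ x = y + k *: e ord_max.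
Proof.
move=> [c ->]; rewrite big_ord_recr/=.
by eexists; exists (c ord_max); split; last reflexivity;
  exists (c \o widen_ord (leqnSn n)).
Qed.

(** The clause on [P] transfers membership in a given subspace from the old vectors and [a] to the
    enlarged family. *)
Lemma lspan_rcons (V : lmodType K) n (e : 'I_n -> V) a : exists e' : 'I_n.+1 -> V,
  (forall P : V -> Prop, P a -> (forall i, P (e i)) -> forall i, P (e' i)) /\
  forall x k, lspan e x -> lspan e' (x + k *: a).
Proof.
exists (fun i => oapp e a (unlift ord_max i)); split=> [P Pa Pe i|_ k [c ->]].
  by case: unliftP => [j _|_] /=.
exists (fun i => oapp c k (unlift ord_max i)).
rewrite big_ord_recr/= unlift_none/=; congr (_ + _).
apply: eq_bigr => i _.
have -> : widen_ord (leqnSn n) i = lift ord_max i.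
  by apply: val_inj; rewrite /= /bump leqNgt ltn_ord.
by rewrite liftK.
Qed.

Lemma lspan_cat (V : lmodType K) n m (e : 'I_n -> V) (f : 'I_m -> V) :
  exists g : 'I_(n + m) -> V,
    forall x y, lspan e x -> lspan f y -> lspan g (x + y).
Proof.
exists (fun i => match fintype.split i with inl j => e j | inr j => f j end).
move=> _ _ [c ->] [d ->].
exists (fun i => match fintype.split i with inl j => c j | inr j => d j end).
rewrite big_split_ord/=; congr (_ + _); apply: eq_bigr => i _.
  by rewrite -[lshift m i]/(unsplit (inl i)) unsplitK.
by rewrite -[rshift n i]/(unsplit (inr i)) unsplitK.
Qed.

(** Induction on the number of spanning vectors: if some a in A lies outside the span [e0] of all
    but the last, subtracting a multiple of a moves any element of A into that span. So A is spanned
    by a together with a family for the intersection of A and the span of [e0]. *)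
Lemma lspan_sub (V : lmodType K) n (e : 'I_n -> V) (A : set V) : A 0 ->
  (forall k x y, A x -> A y -> A (k *: x + y)) -> A `<=` lspan e ->
  exists m (e' : 'I_m -> V), (forall i, A (e' i)) /\ A `<=` lspan e'.
Proof.
elim: n e A => [|n IH] e A A0 Al Ae.
  by exists 0, e; split=> // -[].
pose e0 := e \o widen_ord (leqnSn n).
have e00 : lspan e0 0.
  by exists (fun=> 0); rewrite big1// => i _; rewrite scale0r.
have [|k x y [Ax ex] [Ay ey]|x []//|m [e' [Ae' e'A]]] := IH e0 (A `&` lspan e0).
- by split.
- by split; [exact: Al|exact: lspan_lin].
have [AA|] := pselect (A `<=` lspan e0).
  by exists m, e'; split=> [i|x Ax]; [have [] := Ae' i|apply: e'A; split=> //; exact: AA].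
move=> /existsNP[a /not_implyP[Aa ea]].
have [b [k [eb ak]]] := lspan_recr (Ae _ Aa).
have k0 : k != 0.
  by apply: contra_notN ea => /eqP k0; rewrite ak k0 scale0r addr0.
have [e2 [e2P e2A]] := lspan_rcons e' a.
exists m.+1, e2; split=> [|x Ax]; first by apply: e2P => // i; have [] := Ae' i.
have [y [l [ey xl]]] := lspan_recr (Ae _ Ax).
rewrite -[x](subrK ((l / k) *: a)); apply: e2A; apply: e'A.
rewrite -scaleNr addrC; split; first exact: Al.
have -> : (- (l / k)) *: a + x = (- (l / k)) *: b + y.
  rewrite {1}ak xl scalerDr scalerA mulNr divfK// scaleNr -!addrA; congr (_ + _).
  by rewrite scaleNr addrC addrK.
exact: lspan_lin.
Qed.

(** The vectors [e] may lie off the range of f; [lspan_sub] exchanges them for values of f, whose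
    preimages span V. *)
Lemma finite_dim_inj (V W : lmodType K) (f : V -> W) n (e : 'I_n -> W) :
  linear f -> injective f -> (forall x, lspan e (f x)) -> finite_dim V.
Proof.
move=> fl fi fe.
have [|k _ _ [x _ <-] [y _ <-]|_ [x _ <-]|m [e' [ef fe']]] :=
  @lspan_sub W n e (range f) => //.
- by exists 0 => //; exact: lin0.
- by exists (k *: x + y) => //; rewrite fl.
have /choice[v vE] i : exists v, f v = e' i.
  by have [v _ <-] := ef i; exists v.
exists m, v => x; have [c fx] := fe' _ (imageT f x).
exists c; apply: fi; rewrite fx lin_sum//; apply: eq_bigr => i _.
by rewrite linZ// vE.
Qed.

Lemma real_net (C e : R) : 0 < e ->
  exists r : seq R, forall a, `|a| <= C -> exists2 y, y \in r & `|a - y| <= e.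
Proof.
move=> e0.
have [r rP] := @compact_totally_bounded R RealScalars R^o _ (@segment_compact R (- C) C) e e0.
by exists r => a aC; apply: rP; rewrite /= in_itv/= -ler_norml.
Qed.

Lemma Im_le_normc (z : R[i]) : `|complex.Im z| <= complex.Re `|z|.
Proof.
case: z => a b; rewrite normc_def /= -sqrtr_sqr.
by rewrite ler_wsqrtr// lerDr sqr_ge0.
Qed.

Lemma normc_le_half (z : R[i]) (e : R) : 0 < e ->
  `|complex.Re z| <= e / 2 -> `|complex.Im z| <= e / 2 -> complex.Re `|z| <= e.
Proof.
case: z => x y e0; rewrite normc_def /= => xe ye.
rewrite -(@ler_sqr R) ?nnegrE ?sqrtr_ge0 ?(ltW e0)//.
rewrite sqr_sqrtr ?addr_ge0 ?sqr_ge0// -(real_normK (num_real x)).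
rewrite -(real_normK (num_real y)).
by have := normr_ge0 x; have := normr_ge0 y; nra.
Qed.

Lemma totally_bounded_scalars (C : R) :
  totally_bounded [set k : S | rnorm k <= C].
Proof.
move=> e e0; have [r rP] := @real_net C (e / 2) ltac:(by rewrite divr_gt0).
rewrite /rnorm /scalar_space /repart; case: (s) => /=.
  exists r => a /rP[y yr ay]; exists y => //; apply: (le_trans ay).
  by rewrite ler_pdivrMr// ler_pMr// ler1n.
exists [seq (a +i* b)%C | a <- r, b <- r] => z zC.
have [a ar za] : exists2 a, a \in r & `|complex.Re z - a| <= e / 2.
  apply: rP; apply: le_trans zC.
  by have := normc_ge_Re z; rewrite lecE => /andP[].
have [b br zb] : exists2 b, b \in r & `|complex.Im z - b| <= e / 2.
  by apply: rP; apply: le_trans zC; exact: Im_le_normc.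
exists (a +i* b)%C; first exact: allpairs_f.
by apply: normc_le_half => //; rewrite raddfB.
Qed.

Lemma totally_bounded_add (V : normedModType K) (A B : set V) :
  totally_bounded A -> totally_bounded B ->
  totally_bounded [set z | exists x y, [/\ A x, B y & z = x + y]].
Proof.
move=> At Bt e e0; have e2 : 0 < e / 2 by rewrite divr_gt0.
have [r rP] := At _ e2; have [q qP] := Bt _ e2.
exists [seq x + y | x <- r, y <- q] => _ [x [y [/rP[x' xr xx] /qP[y' yq yy] ->]]].
exists (x' + y'); first exact: allpairs_f.
rewrite opprD addrACA; apply: (le_trans (rnormD _ _)).
by rewrite [leRHS](splitr e) lerD.
Qed.

(* Either the last vector is at positive distance from the span of the others,
   and then the coefficients are bounded, or it can be replaced by a vector of
   that span up to an arbitrarily small error. *)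
Lemma totally_bounded_lspan (V : normedModType K) n (e : 'I_n -> V) (M : R) :
  totally_bounded [set x | lspan e x /\ rnorm x <= M].
Proof.
elim: n e M => [|n IH] e M.
  move=> d d0; exists [:: 0] => x [[c ->] _]; exists 0; first exact: mem_head.
  by rewrite big_ord0 subrr rnorm0 ltW.
pose e0 := e \o widen_ord (leqnSn n).
have [near0|] := pselect (forall d : R, 0 < d ->
    exists2 u, lspan e0 u & rnorm (e ord_max - u) <= d).
  apply: totally_bounded_approx => d d0.
  exists [set x | lspan e0 x /\ rnorm x <= M + d]; first exact: IH.
  move=> x [/lspan_recr[y [k [ey ->]]] xM].
  have k1 : 0 < repart `|k| + 1 by rewrite ltr_wpDl ?rabs_ge0.
  have [|u eu ud] := near0 (d / (repart `|k| + 1)); first by rewrite divr_gt0.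
  have le : rnorm (y + k *: e ord_max - (y + k *: u)) <= d.
    rewrite opprD addrACA subrr add0r -scalerBr rnormZ.
    apply: (@le_trans _ _ ((repart `|k| + 1) * rnorm (e ord_max - u))).
      by rewrite ler_wpM2r ?rnorm_ge0// lerDl.
    by rewrite mulrC -ler_pdivlMr.
  exists (y + k *: u) => //; split.
    by rewrite addrC; exact: lspan_lin.
  rewrite -[y + k *: u]subr0; apply: (le_trans (rnorm_distD (y + k *: e ord_max) _ _)).
  by rewrite subr0 addrC rnormBC lerD.
move=> /existsNP[d /not_implyP[d0 dP]].
have far u : lspan e0 u -> d <= rnorm (e ord_max - u).
  by move=> eu; rewrite leNgt; apply/negP => /ltW ud; apply: dP; exists u.
(* Since k e + y has norm at least d |k| for y in the span of the others, [C] bounds the last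
   coefficient, and [M'] then bounds the remaining part. *)
pose C := M / d; pose M' := M + C * rnorm (e ord_max).
apply: totally_boundedS (totally_bounded_add (IH e0 M') (totally_bounded_image
    (f := fun k : S => (k : K) *: e ord_max) (M := rnorm (e ord_max)) _
    (totally_bounded_scalars C))); last first.
  by move=> k l; rewrite -scalerBl rnormZ mulrC.
move=> _ [/lspan_recr[y [k [ey ->]]] xM].
have kC : repart `|k| <= C.
  have [->|k0] := eqVneq k 0.
    rewrite normr0 -(@ofreal0 R s) ofrealK divr_ge0 ?(ltW d0)//.
    exact: le_trans (rnorm_ge0 _) xM.
  rewrite ler_pdivlMr//; apply: le_trans xM.
  have := far (- k^-1 *: y).
  have eky : lspan e0 (- k^-1 *: y).
    rewrite -[_ *: y]addr0; apply: lspan_lin => //.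
    by exists (fun=> 0); rewrite big1// => i _; rewrite scale0r.
  move=> /(_ eky) /(ler_wpM2l (rabs_ge0 k)) /le_trans; apply.
  by rewrite -rnormZ scalerBr scalerA mulrN divff// scaleN1r opprK addrC.
exists y, (k *: e ord_max); split=> //; last by exists k.
split=> //; rewrite -[y](addrK (k *: e ord_max)).
apply: (le_trans (rnormD _ _)); rewrite rnormN rnormZ lerD//.
by rewrite ler_wpM2r ?rnorm_ge0.
Qed.

End FiniteDimension.

(** * Finite rank operators and their norm limits *)

Section FiniteRank.
Context {R : realType} {s : scalar_kind}.
Local Notation K := (scalars R s).
Local Notation hf := (2^-1 : R).
Implicit Types X Y Z : banach R s.

Lemma finite_rank_bounded X Y (T : X -> Y) : finite_rank T -> bounded_op T.
Proof. by case. Qed.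

Lemma finite_rank_compl X Y Z (T : X -> Y) (U : Y -> Z) :
  finite_rank T -> bounded_op U -> finite_rank (U \o T).
Proof.
move=> [Tb [n [e eT]]] Ub; split; first exact: bounded_op_comp.
exists n, (U \o e) => x; have [c Tx] := eT x; exists c.
have Ul := bounded_linear Ub.
by rewrite /= Tx lin_sum//; apply: eq_bigr => i _; rewrite linZ.
Qed.

Lemma finite_rank_compr X Y Z (T : X -> Y) (U : Y -> Z) :
  bounded_op T -> finite_rank U -> finite_rank (U \o T).
Proof.
move=> Tb [Ub [n [e eU]]]; split; first exact: bounded_op_comp.
by exists n, e => x; exact: eU.
Qed.

Lemma finite_rank_add X Y (T U : X -> Y) :
  finite_rank T -> finite_rank U -> finite_rank (T \+ U).
Proof.
move=> [Tb [n [e eT]]] [Ub [m [f fU]]]; split; first exact: bounded_op_add.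
have [g gP] := lspan_cat e f.
by exists (n + m)%N, g => x; exact: gP.
Qed.

Lemma finite_rank_scale X Y (T : X -> Y) k :
  finite_rank T -> finite_rank (fun x => k *: T x).
Proof.
move=> Tf; have kb : bounded_op (fun y : Y => k *: y).
  by apply: bounded_op_scale; exact: bounded_op_id.
exact: finite_rank_compl Tf kb.
Qed.

Lemma finite_rank_sub X Y (T U : X -> Y) :
  finite_rank T -> finite_rank U -> finite_rank (T \- U).
Proof.
move=> Tf Uf; have := finite_rank_add Tf (finite_rank_scale (- 1) Uf).
by congr finite_rank; apply/funext => x /=; rewrite scaleN1r.
Qed.

Lemma finite_rank_dom X Y (T : X -> Y) :
  bounded_op T -> finite_dim X -> finite_rank T.
Proof.
move=> Tb [n [e eX]]; split=> //; exists n, (T \o e) => x.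
have [c ->] := eX x; exists c; have Tl := bounded_linear Tb.
by rewrite lin_sum//; apply: eq_bigr => i _; rewrite linZ.
Qed.

Lemma finite_rank_cod X Y (T : X -> Y) :
  bounded_op T -> finite_dim Y -> finite_rank T.
Proof. by move=> Tb [n [e eY]]; split=> //; exists n, e => x; exact: eY. Qed.

Lemma finite_rank_sum X Y n (T : 'I_n -> X -> Y) :
  (forall i, finite_rank (T i)) -> finite_rank (fun x => \sum_(i < n) T i x).
Proof.
move=> Tf; elim: n T Tf => [|n IH] T Tf.
  split; first by apply: bounded_op_sum => i; exact: finite_rank_bounded.
  by exists 0, (fun=> 0) => x; exists (fun=> 0); rewrite !big_ord0.
have := finite_rank_add (IH (T \o widen_ord (leqnSn n)) (fun i => Tf _)) (Tf ord_max).
by congr finite_rank; apply/funext => x /=; rewrite big_ord_recr.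
Qed.

Lemma finite_rank_image_totally_bounded X Y (T : X -> Y) :
  finite_rank T -> totally_bounded (T @` unit_ball X).
Proof.
move=> [Tb [n [e eT]]]; apply: totally_boundedS (totally_bounded_lspan e (opnorm T)).
move=> _ [x /unit_ballE x1 <-]; split; first exact: eT.
apply: (le_trans (opnormP x Tb)).
by rewrite -[leRHS]mulr1 ler_wpM2l ?opnorm_ge0.
Qed.

Lemma approximable_compact X Y (T : X -> Y) : approximable_op T -> compact_op T.
Proof.
move=> [Tb TF]; apply/compact_opP; split=> //.
apply: totally_bounded_approx => e /TF[F Ff Fe].
exists (F @` unit_ball X); first exact: finite_rank_image_totally_bounded.
move=> _ [x x1 <-]; exists (F x); first exact: imageP.
apply: (le_trans (opnormP x (bounded_op_sub Tb (finite_rank_bounded Ff)))).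
apply: (le_trans _ (ltW Fe)); rewrite -[leRHS]mulr1 ler_wpM2l ?opnorm_ge0//.
exact/unit_ballE.
Qed.

Lemma approximable_compl X Y Z (T : X -> Y) (U : Y -> Z) :
  approximable_op T -> bounded_op U -> approximable_op (U \o T).
Proof.
move=> [Tb TF] Ub; split; first exact: bounded_op_comp.
move=> e e0; have U1 : 0 < opnorm U + 1 by rewrite ltr_wpDl ?opnorm_ge0.
have [F Ff Fe] := TF (e / (opnorm U + 1)) ltac:(by rewrite divr_gt0).
exists (U \o F); first exact: finite_rank_compl.
have TFb := bounded_op_sub Tb (finite_rank_bounded Ff).
have -> : (U \o T) \- (U \o F) = U \o (T \- F).
  by apply/funext => x /=; rewrite linB//; exact: bounded_linear.
apply: (le_lt_trans (opnorm_comp_le TFb Ub)).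
move: Fe; rewrite ltr_pdivlMr// mulrC => /(le_lt_trans _); apply.
by rewrite ler_wpM2r ?opnorm_ge0// lerDl.
Qed.

Lemma compact_compl X Y Z (T : X -> Y) (U : Y -> Z) :
  compact_op T -> bounded_op U -> compact_op (U \o T).
Proof.
move=> /compact_opP[Tb Tt] Ub; apply/compact_opP; split; first exact: bounded_op_comp.
rewrite -(image_comp T U); apply: (totally_bounded_image (M := opnorm U)) Tt => x y.
by rewrite -linB ?opnormP//; exact: bounded_linear.
Qed.

Lemma compact_compr X Y Z (T : X -> Y) (U : Y -> Z) :
  bounded_op T -> compact_op U -> compact_op (U \o T).
Proof.
move=> Tb /compact_opP[Ub Ut]; apply/compact_opP; split; first exact: bounded_op_comp.
have Ul := bounded_linear Ub; have Tl := bounded_linear Tb.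
pose c := opnorm T + 1.
have c0 : 0 < c by rewrite ltr_wpDl ?opnorm_ge0.
have c0' := ltW c0.
apply: (@totally_boundedS _ _ _ _ ((fun z => (ofreal c : K) *: z) @` (U @` unit_ball Y))).
  move=> _ [x /unit_ballE x1 <-] /=.
  exists (U ((ofreal c^-1 : K) *: T x)); last first.
    by rewrite -linZ// scalerA -ofrealM mulfV ?gt_eqF// ofreal1 scale1r.
  apply: imageP; apply/unit_ballE; rewrite rnormZr ?invr_ge0//.
  rewrite ler_pdivrMl// mulr1; apply: (le_trans (opnormP x Tb)).
  apply: (@le_trans _ _ (opnorm T)); last by rewrite lerDl.
  by rewrite -[leRHS]mulr1 ler_wpM2l ?opnorm_ge0.
apply: (totally_bounded_image (M := c)) Ut => x y.
by rewrite -scalerBr rnormZr.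
Qed.

(** Limits are identified through estimates of this form. The offset [m] serves coordinates of
    partial sums, which are correct only from some index on. *)
Lemma eq_of_half X (x y : X) (C : R) m :
  (forall n, (m <= n)%N -> rnorm (x - y) <= C * hf ^+ n) -> x = y.
Proof.
move=> xy; apply: eq_of_rnorm_le => e e0.
have C1 : 0 < `|C| + 1 by rewrite ltr_wpDl.
have [n ne] := @half_smallW R (e / (`|C| + 1)) ltac:(by rewrite divr_gt0).
apply: (le_trans (xy (maxn n m) (leq_maxr _ _))).
have := ne _ (leq_maxl n m); rewrite ltr_pdivlMr// mulrC => /ltW.
apply: le_trans; rewrite ler_wpM2r ?exprn_ge0//.
by apply: (le_trans (ler_norm _)); rewrite lerDl.
Qed.

Lemma half_cvg X (u : nat -> X) (C : R) : 0 <= C ->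
  (forall n, rnorm (u n.+1 - u n) <= C * hf ^+ n) ->
  exists l, forall n, rnorm (u n - l) <= 2 * C * hf ^+ n.
Proof.
move=> C0 uC; have [C1|C1] := eqVneq C 0.
  have uE n : u n = u 0.
    elim: n => [//|n <-]; apply: eq_of_rnorm_le => e e0.
    by apply: (le_trans (uC n)); rewrite C1 mul0r ltW.
  by exists (u 0) => n; rewrite uE subrr rnorm0 C1 mulr0 mul0r.
have {}C0 : 0 < C by rewrite lt_def C1.
have [|l lP] := @fast_cvg R s X (fun n => (ofreal C^-1 : K) *: u n).
  move=> n; rewrite -scalerBr rnormZr ?invr_ge0 ?(ltW C0)//.
  by rewrite ler_pdivrMl.
exists ((ofreal C : K) *: l) => n.
have -> : u n - (ofreal C : K) *: l =
    (ofreal C : K) *: ((ofreal C^-1 : K) *: u n - l).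
  by rewrite scalerBr scalerA -ofrealM mulfV// ofreal1 scale1r.
rewrite rnormZr ?(ltW C0)// mulrAC mulrC ler_wpM2r ?(ltW C0)//; exact: lP.
Qed.

(** The approximable operators constructed below are such series; the explicit rate is what later
    identifies the limit. *)
Lemma approximable_series X Y (D : nat -> X -> Y) (M : R) : 0 <= M ->
  (forall n, finite_rank (D n)) ->
  (forall n x, rnorm (D n x) <= M * hf ^+ n * rnorm x) ->
  exists2 T : X -> Y, approximable_op T &
    forall n x, rnorm (\sum_(i < n) D i x - T x) <= 2 * M * hf ^+ n * rnorm x.
Proof.
move=> M0 Df DM.
have /choice[T TP] x : exists l, forall n,
    rnorm (\sum_(i < n) D i x - l) <= 2 * M * hf ^+ n * rnorm x.
  have [|n|l lP] := @half_cvg _ (fun n => \sum_(i < n) D i x) (M * rnorm x).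
  - by rewrite mulr_ge0 ?rnorm_ge0.
  - by rewrite /= big_ord_recr/= [X in rnorm X]addrC addKr mulrAC.
  by exists l => n; rewrite mulrAC -[2 * M * _]mulrA.
have Tl : linear T.
  move=> k x y; pose C := 2 * M * (rnorm (k *: x + y) + repart `|k| * rnorm x + rnorm y).
  apply: (@eq_of_half _ _ _ C 0) => n _.
  apply: (le_trans (rnorm_distD (\sum_(i < n) D i (k *: x + y)) _ _)).
  have -> : \sum_(i < n) D i (k *: x + y) - (k *: T x + T y) =
     k *: (\sum_(i < n) D i x - T x) + (\sum_(i < n) D i y - T y).
    rewrite scalerBr addrACA -opprD scaler_sumr -big_split/=; congr (_ - _).
    by apply: eq_bigr => i _; rewrite (bounded_linear (finite_rank_bounded (Df i))).
  have h1 := TP (k *: x + y) n; have h2 := TP x n; have h3 := TP y n.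
  have h4 := rnormD (k *: (\sum_(i < n) D i x - T x)) (\sum_(i < n) D i y - T y).
  rewrite rnormBC; apply: (le_trans (lerD h1 h4)); rewrite rnormZ.
  have := ler_wpM2l (rabs_ge0 k) h2 => h5.
  rewrite /C [leRHS]mulrAC -[X in _ <= _ * X]addrA 2!mulrDr; apply: lerD => //.
  by apply: lerD => //; rewrite mulrCA.
have Tb : bounded_op T.
  apply: (bounded_opI (M := 2 * M)) => // x; have := TP x 0.
  by rewrite big_ord0 sub0r rnormN expr0 mulr1.
exists T => //; split=> // e e0.
have M1 : 0 < 2 * M + 1 by rewrite ltr_wpDl ?mulr_ge0.
have [n ne] := @half_small R (e / (2 * M + 1)) ltac:(by rewrite divr_gt0).
exists (fun x => \sum_(i < n) D i x); first exact: finite_rank_sum.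
move: ne; rewrite ltr_pdivlMr// mulrC => /(le_lt_trans _); apply.
apply: (@le_trans _ _ (2 * M * hf ^+ n)).
  apply: opnorm_le => [|x]; first by rewrite !mulr_ge0 ?exprn_ge0.
  by rewrite /= rnormBC; exact: TP.
by rewrite ler_wpM2r ?exprn_ge0// lerDl.
Qed.

End FiniteRank.

(** * The l_oo sum of a sequence of Banach spaces *)

Section DirectSum.
Context {R : realType} {s : scalar_kind}.
Local Notation K := (scalars R s).
Local Notation hf := (2^-1 : R).
Variable E : nat -> banach R s.

(** Boundedness is stored as a boolean, so that an element is determined by its coordinates. *)
Record dsum := Dsum
  { dsum_fun :> forall n, E n;
    dsum_funP : `[< exists M : R, forall n, rnorm (dsum_fun n) <= M >] }.

Lemma dsum_ext (f g : dsum) : (forall n, f n = g n) -> f = g.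
Proof.
case: f g => f fP [g gP] /= fg.
have {fg} E1 : f = g by exact: functional_extensionality_dep.
by rewrite {}E1 in fP *; congr Dsum; exact: bool_irrelevance.
Qed.

HB.instance Definition _ := gen_eqMixin dsum.
HB.instance Definition _ := gen_choiceMixin dsum.

Let bound0 : `[< exists M : R, forall n, rnorm (0 : E n) <= M >].
Proof. by apply/asboolP; exists 0 => n; rewrite rnorm0. Qed.

Let boundD (k : K) (f g : dsum) :
  `[< exists M : R, forall n, rnorm (k *: f n + g n) <= M >].
Proof.
have /asboolP[M fM] := dsum_funP f; have /asboolP[L gL] := dsum_funP g.
apply/asboolP; exists (repart `|k| * M + L) => n.
by apply: (le_trans (rnormD _ _)); rewrite rnormZ lerD// ler_wpM2l// rabs_ge0.
Qed.

(** Sum, multiple and opposite are all instances of this one operation, so closure is proved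
    once. *)
Let dlin k (f g : dsum) := Dsum (boundD k f g).

Let dsum_zero := Dsum bound0.
Let dsum_add (f g : dsum) := dlin 1 f g.
Let dsum_scale k (f : dsum) := dlin k f dsum_zero.
Let dsum_opp (f : dsum) := dsum_scale (- 1) f.

Let dsum_addE f g n : dsum_add f g n = f n + g n.
Proof. by rewrite /= scale1r. Qed.

Let dsum_scaleE k f n : dsum_scale k f n = k *: f n.
Proof. by rewrite /= addr0. Qed.

Let dsum_addA : associative dsum_add.
Proof. by move=> f g h; apply: dsum_ext => n; rewrite !dsum_addE addrA. Qed.

Let dsum_addC : commutative dsum_add.
Proof. by move=> f g; apply: dsum_ext => n; rewrite !dsum_addE addrC. Qed.

Let dsum_add0 : left_id dsum_zero dsum_add.
Proof. by move=> f; apply: dsum_ext => n; rewrite dsum_addE add0r. Qed.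

Let dsum_addN : left_inverse dsum_zero dsum_opp dsum_add.
Proof.
by move=> f; apply: dsum_ext => n; rewrite dsum_addE dsum_scaleE scaleN1r addNr.
Qed.

HB.instance Definition _ :=
  GRing.isZmodule.Build dsum dsum_addA dsum_addC dsum_add0 dsum_addN.

Let dsum_scaleA a b f : dsum_scale a (dsum_scale b f) = dsum_scale (a * b) f.
Proof. by apply: dsum_ext => n; rewrite !dsum_scaleE scalerA. Qed.

Let dsum_scale1 : left_id 1 dsum_scale.
Proof. by move=> f; apply: dsum_ext => n; rewrite dsum_scaleE scale1r. Qed.

Let dsum_scaleDr : right_distributive dsum_scale +%R.
Proof.
move=> k f g; apply: dsum_ext => n.
by rewrite !(dsum_addE, dsum_scaleE) scalerDr.
Qed.

Let dsum_scaleDl f : {morph dsum_scale^~ f : a b / a + b}.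
Proof.
move=> a b; apply: dsum_ext => n.
by rewrite !(dsum_addE, dsum_scaleE) scalerDl.
Qed.

HB.instance Definition _ := GRing.Zmodule_isLmodule.Build K dsum
  dsum_scaleA dsum_scale1 dsum_scaleDr dsum_scaleDl.

Lemma dsum_coord_linear n : linear (fun f : dsum => f n).
Proof. by move=> k f g; rewrite dsum_addE dsum_scaleE. Qed.

Definition dsum_norm (f : dsum) : R := sup (range (fun n => rnorm (f n))).

Let dsum_coord_le (f : dsum) n : rnorm (f n) <= dsum_norm f.
Proof.
apply: ub_le_sup; last by exists n.
by have /asboolP[M fM] := dsum_funP f; exists M => _ [m _ <-].
Qed.

Let dsum_norm_le (f : dsum) (M : R) : (forall n, rnorm (f n) <= M) -> dsum_norm f <= M.
Proof. by move=> fM; apply: ge_sup => [|_ [n _ <-]//]; exists (rnorm (f 0)), 0. Qed.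

Let dsum_norm_ge0 f : 0 <= dsum_norm f.
Proof. exact: le_trans (rnorm_ge0 _) (dsum_coord_le f 0). Qed.

Let dsum_normD (f g : dsum) :
  ofreal (dsum_norm (f + g)) <= ofreal (dsum_norm f) + ofreal (dsum_norm g) :> K.
Proof.
rewrite -ofrealD ler_ofreal; apply: dsum_norm_le => n.
by rewrite dsum_addE (le_trans (rnormD _ _))// lerD.
Qed.

Let dsum_normZ_le (k : K) (f : dsum) : dsum_norm (k *: f) <= repart `|k| * dsum_norm f.
Proof.
by apply: dsum_norm_le => n; rewrite dsum_scaleE rnormZ ler_wpM2l ?rabs_ge0.
Qed.

Let dsum_normZ (k : K) (f : dsum) :
  ofreal (dsum_norm (k *: f)) = `|k| * ofreal (dsum_norm f) :> K.
Proof.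
rewrite -(repartK (normr_ge0 k)) -ofrealM; congr ofreal; apply/eqP.
rewrite eq_le dsum_normZ_le/=; have [->|k0] := eqVneq k 0.
  by rewrite normr0 -(@ofreal0 R s) ofrealK mul0r; exact: dsum_norm_ge0.
have k0' : 0 < repart `|k|.
  by rewrite -(@ltr_ofreal R s) ofreal0 repartK// normr_gt0.
rewrite mulrC -ler_pdivlMr//; apply: dsum_norm_le => n.
by rewrite ler_pdivlMr// mulrC -rnormZ -dsum_scaleE; exact: dsum_coord_le.
Qed.

Let dsum_norm0_eq0 (f : dsum) : ofreal (dsum_norm f) = 0 :> K -> f = 0.
Proof.
rewrite -ofreal0 => /(can_inj (@ofrealK R s)) f0; apply: dsum_ext => n.
by apply: rnorm0_eq0; apply/eqP; rewrite eq_le rnorm_ge0 andbT -f0.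
Qed.

HB.instance Definition _ := @Lmodule_isNormed.Build K dsum
  (fun f => ofreal (dsum_norm f)) dsum_normD dsum_normZ dsum_norm0_eq0.

Lemma rnorm_dsum (f : dsum) : rnorm f = dsum_norm f.
Proof. exact: ofrealK. Qed.

Lemma dsum_coord (f : dsum) n : rnorm (f n) <= rnorm f.
Proof. by rewrite rnorm_dsum. Qed.

Lemma dsum_le (f : dsum) (M : R) : (forall n, rnorm (f n) <= M) -> rnorm f <= M.
Proof. by rewrite rnorm_dsum; exact: dsum_norm_le. Qed.

Lemma dsum_complete (F : set_system dsum) : ProperFilter F -> cauchy F -> cvg F.
Proof.
apply: fast_complete => u uf.
have uB k l n : (u k - u l : dsum) n = u k n - u l n.
  exact: (linB _ _ (dsum_coord_linear n)).
have /all_sig[l lP] n : {l : E n | forall k, rnorm (u k n - l) <= 2 * hf ^+ k}.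
  apply: cid; apply: fast_cvg => k; apply: le_trans (uf k).
  by rewrite -uB dsum_coord.
have lb : `[< exists M : R, forall n, rnorm (l n) <= M >].
  apply/asboolP; exists (2 + rnorm (u 0)) => n.
  rewrite -[l n](subrK (u 0 n)) (le_trans (rnormD _ _))// lerD ?dsum_coord//.
  by rewrite rnormBC; have := lP n 0; rewrite expr0 mulr1.
exists (Dsum lb) => k; apply: dsum_le => n.
rewrite (linB _ _ (dsum_coord_linear n)); apply: (le_trans (lP n k)).
by rewrite ler_wpM2r ?exprn_ge0 ?ler_nat.
Qed.

HB.instance Definition _ := Uniform_isComplete.Build dsum dsum_complete.

Lemma dsum_coord_bounded n : bounded_op (fun f : dsum => f n).
Proof.
apply: (bounded_opI (M := 1)) => [|f]; first exact: dsum_coord_linear.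
by rewrite mul1r dsum_coord.
Qed.

Lemma dsum_coord_opnorm n : opnorm (fun f : dsum => f n) <= 1.
Proof. by apply: opnorm_le => // f; rewrite mul1r dsum_coord. Qed.

Lemma dsum_inj_bound n (x : E n) : 
  `[< exists M : R, forall m, rnorm (eqtype.dfwith (fun m => 0 : E m) x m) <= M >].
Proof.
apply/asboolP; exists (rnorm x) => m.
by case: eqtype.dfwithP => [//|j _]; rewrite rnorm0 rnorm_ge0.
Qed.

Definition dsum_inj n (x : E n) : dsum := Dsum (dsum_inj_bound x).

Lemma dsum_injE n (x : E n) : dsum_inj x n = x.
Proof. exact: eqtype.dfwith_in. Qed.

Lemma dsum_inj_neq n m (x : E n) : n != m -> dsum_inj x m = 0.
Proof. by move=> nm; rewrite /= eqtype.dfwith_out. Qed.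

Lemma dsum_inj_linear n : linear (@dsum_inj n).
Proof.
move=> k x y; apply: dsum_ext => m; rewrite dsum_coord_linear.
have [<-|nm] := eqVneq n m; first by rewrite !dsum_injE.
by rewrite !dsum_inj_neq// scaler0 addr0.
Qed.

Lemma rnorm_dsum_inj n (x : E n) : rnorm (dsum_inj x) <= rnorm x.
Proof.
apply: dsum_le => m; have [<-|nm] := eqVneq n m; first by rewrite dsum_injE.
by rewrite dsum_inj_neq// rnorm0 rnorm_ge0.
Qed.

Lemma dsum_inj_bounded n : bounded_op (@dsum_inj n).
Proof.
apply: (bounded_opI (M := 1)) => [|x]; first exact: dsum_inj_linear.
by rewrite mul1r rnorm_dsum_inj.
Qed.

Lemma dsum_inj_opnorm n : opnorm (@dsum_inj n) <= 1.
Proof. by apply: opnorm_le => // x; rewrite mul1r rnorm_dsum_inj. Qed.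

Lemma dsum_partial_coord n m (x : forall i, E i) : (m < n)%N ->
  (\sum_(i < n) dsum_inj (x i)) m = x m.
Proof.
move=> mn; rewrite (lin_sum _ _ _ (dsum_coord_linear m)).
rewrite (bigD1 (Ordinal mn))// big1 => [|i im].
  by rewrite dsum_injE; exact: addr0.
by apply: dsum_inj_neq; apply: contra im => /eqP e; apply/eqP/val_inj.
Qed.

End DirectSum.

(** * Series in quasi-normed ideals *)

Section Ideals.
Context {R : realType} {s : scalar_kind}.
Local Notation K := (scalars R s).
Local Notation hf := (2^-1 : R).
Implicit Types X Y Z : banach R s.
Variable A : operator_ideal R s.

Lemma ideal_compl X Y Z (T : X -> Y) (U : Y -> Z) :
  ideal_mem A T -> bounded_op U -> ideal_mem A (U \o T).
Proof. exact: (ideal_comp (@bounded_op_id R s X)). Qed.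

Lemma ideal_compr X Y Z (T : X -> Y) (U : Y -> Z) :
  bounded_op T -> ideal_mem A U -> ideal_mem A (U \o T).
Proof. by move=> Tb AU; exact: (ideal_comp Tb AU (@bounded_op_id R s Z)). Qed.

Lemma opnorm_id_le X : opnorm (@idfun X) <= 1.
Proof. by apply: opnorm_le => // x; rewrite mul1r. Qed.

Lemma alpha_compl X Y Z (T : X -> Y) (U : Y -> Z) (M : R) :
  ideal_mem A T -> bounded_op U -> opnorm U <= M ->
  alpha A (U \o T) <= M * alpha A T.
Proof.
move=> AT Ub UM; apply: (le_trans (alpha_comp (@bounded_op_id R s X) AT Ub)).
have M0 : 0 <= M by exact: le_trans (opnorm_ge0 U) UM.
rewrite -[leRHS]mulr1; apply: ler_pM;
  rewrite ?opnorm_id_le ?opnorm_ge0 ?mulr_ge0 ?opnorm_ge0 ?alpha_ge0//.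
by rewrite ler_wpM2r ?alpha_ge0.
Qed.

Lemma alpha_compr X Y Z (T : X -> Y) (U : Y -> Z) (M : R) :
  bounded_op T -> ideal_mem A U -> opnorm T <= M ->
  alpha A (U \o T) <= alpha A U * M.
Proof.
move=> Tb AU TM; apply: (le_trans (alpha_comp Tb AU (@bounded_op_id R s Z))).
rewrite -[leRHS]mul1r -mulrA; apply: ler_pM;
  rewrite ?opnorm_id_le ?opnorm_ge0 ?mulr_ge0 ?opnorm_ge0 ?alpha_ge0//.
by rewrite ler_wpM2l ?alpha_ge0.
Qed.

Let scale_op (X : banach R s) (k : K) : bounded_op (fun x : X => k *: x).
Proof. by apply: bounded_op_scale; exact: bounded_op_id. Qed.

Lemma ideal_scale X Y (T : X -> Y) k : ideal_mem A T -> ideal_mem A (fun x => k *: T x).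
Proof. by move=> AT; exact: ideal_compl AT (@scale_op Y k). Qed.

Lemma alpha_scale X Y (T : X -> Y) k : ideal_mem A T ->
  alpha A (fun x => k *: T x) <= repart `|k| * alpha A T.
Proof.
move=> AT; apply: (alpha_compl AT (@scale_op Y k)).
by apply: opnorm_le => [|y]; rewrite ?rabs_ge0// rnormZ.
Qed.

Lemma ideal_sub X Y (T U : X -> Y) :
  ideal_mem A T -> ideal_mem A U -> ideal_mem A (T \- U).
Proof.
move=> AT AU; have := idealD AT (ideal_scale (- 1) AU).
by congr ideal_mem; apply/funext => x /=; rewrite scaleN1r.
Qed.

Lemma alpha_subC X Y (T U : X -> Y) : ideal_mem A T -> ideal_mem A U ->
  alpha A (T \- U) <= alpha A (U \- T).
Proof.
move=> AT AU; have := alpha_scale (- 1) (ideal_sub AU AT).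
rewrite normrN1 -(@ofreal1 R s) ofrealK mul1r.
by congr (alpha A _ <= _); apply/funext => x /=; rewrite ofreal1 scaleN1r opprB.
Qed.

Let zero_op X Y : bounded_op (fun _ : X => 0 : Y).
Proof.
apply: (bounded_opI (M := 0)) => [k x y|x]; first by rewrite scaler0 addr0.
by rewrite rnorm0 mul0r.
Qed.

Lemma ideal0 X Y : ideal_mem A (fun _ : X => 0 : Y).
Proof. exact: (ideal_comp (zero_op X _) (ideal_id A) (zero_op _ Y)). Qed.

Lemma alpha0 X Y : alpha A (fun _ : X => 0 : Y) = 0.
Proof.
apply/eqP; rewrite eq_le alpha_ge0 ?andbT; last exact: ideal0.
apply: (le_trans (alpha_comp (zero_op X _) (ideal_id A) (zero_op _ Y))).
have -> : opnorm (fun _ : X => 0 : scalar_space R s) = 0.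
  apply/eqP; rewrite eq_le opnorm_ge0 andbT; apply: opnorm_le => // x.
  by rewrite rnorm0 mul0r.
by rewrite mulr0.
Qed.

Lemma ideal_sum X Y n (T : nat -> X -> Y) : (forall i, ideal_mem A (T i)) ->
  ideal_mem A (fun x => \sum_(i < n) T i x).
Proof.
move=> AT; elim: n => [|n IH].
  have := @ideal0 X Y; by congr ideal_mem; apply/funext => x; rewrite big_ord0.
have := idealD IH (AT n).
by congr ideal_mem; apply/funext => x /=; rewrite big_ord_recr.
Qed.

(* Every addition costs a factor kappa, so the terms have to decay faster than
   kappa ^- n. *)
Lemma ideal_series X Y (T : nat -> X -> Y) (kappa M : R) : 1 <= kappa ->
  (forall (X Y : banach R s) (T1 T2 : X -> Y),
     ideal_mem A T1 -> ideal_mem A T2 ->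
     alpha A (T1 \+ T2) <= kappa * (alpha A T1 + alpha A T2)) ->
  0 <= M -> (forall n, ideal_mem A (T n)) ->
  (forall n, alpha A (T n) <= M * (2 * kappa)^-1 ^+ n) ->
  exists2 T' : X -> Y, ideal_mem A T' &
    forall x (e : R), 0 < e -> exists N, forall n, (N <= n)%N ->
      rnorm (\sum_(i < n) T i x - T' x) <= e.
Proof.
move=> k1 kD M0 AT TM; pose P n x := \sum_(i < n) T i x.
have k0 : 0 < kappa by exact: lt_le_trans k1.
have AP n : ideal_mem A (P n) by exact: ideal_sum.
set q := (2 * kappa)^-1 in TM.
have q0 : 0 < q by rewrite invr_gt0 mulr_gt0.
have qh : q <= hf.
  rewrite /q invfM ler_piMr ?invr_ge0// invf_le1//.
(* The bound reproduces itself when the first term is split off: this gives kappa (M q ^ n + 2 kappa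
   M q ^ n.+1), and 2 kappa q = 1 makes both summands M q ^ n. Splitting off the last term would
   instead multiply the whole bound by kappa each time. *)
have tail k n : alpha A (P (n + k)%N \- P n) <= 2 * kappa * M * q ^+ n.
  elim: k n => [|k IH] n.
    have -> : P (n + 0)%N \- P n = (fun=> 0).
      by apply/funext => x /=; rewrite addn0 subrr.
    by rewrite alpha0 !mulr_ge0 ?exprn_ge0 ?(ltW k0) ?(ltW q0).
  have -> : P (n + k.+1)%N \- P n = T n \+ (P (n.+1 + k)%N \- P n.+1).
    apply/funext => x /=; rewrite addSnnS [P n.+1 x]big_ord_recr/=.
    by rewrite [RHS]addrC opprD addrA addrNK.
  apply: (le_trans (kD _ _ _ _ (AT n) (ideal_sub (AP _) (AP _)))).
  have h1 := TM n; have := IH n.+1; rewrite exprS mulrA.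
  have -> : 2 * kappa * M * q = M.
    by rewrite mulrAC /q mulfV ?mul1r// mulf_neq0// ?pnatr_eq0// gt_eqF.
  move=> h2; have -> : 2 * kappa * M * q ^+ n = kappa * (M * q ^+ n + M * q ^+ n) by ring.
  by rewrite ler_pM2l//; exact: lerD.
have small (e : R) : 0 < e -> exists N, forall n, (N <= n)%N ->
    2 * kappa * M * q ^+ n < e.
  move=> e0; have C0 : 0 <= 2 * kappa * M by rewrite !mulr_ge0// ltW.
  have C1 : 0 < 2 * kappa * M + 1 by rewrite ltr_wpDl.
  have [N NP] := @half_smallW R (e / (2 * kappa * M + 1)) ltac:(by rewrite divr_gt0).
  exists N => n /NP; rewrite ltr_pdivlMr// mulrC => /(le_lt_trans _); apply.
  apply: ler_pM => //; first by rewrite exprn_ge0// ltW.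
    by rewrite lerDl.
  by rewrite lerXn2r// nnegrE ltW.
have [e e0|T' AT' TT'] := ideal_complete AP.
  have [N NP] := small _ e0; exists N.
  have le m n : (N <= n)%N -> (n <= m)%N -> alpha A (P m \- P n) < e.
    by move=> /NP Nn /subnKC <-; exact: le_lt_trans Nn.
  move=> m n Nm Nn; have [mn|/ltnW nm] := leqP m n; last exact: le.
  exact: le_lt_trans (alpha_subC (AP _) (AP _)) (le _ _ Nm mn).
exists T' => // x e e0.
have x1 : 0 < rnorm x + 1 by rewrite ltr_wpDl ?rnorm_ge0.
have [N NP] := TT' (e / (rnorm x + 1)) ltac:(by rewrite divr_gt0).
exists N => n /NP /ltW; rewrite ler_pdivlMr//; apply: le_trans.
apply: (le_trans (ideal_opnorm_le x (ideal_sub (AP n) AT'))).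
by rewrite ler_wpM2l ?alpha_ge0 ?lerDl//; exact: ideal_sub.
Qed.

(** T is the composition of x |-> (C n x), the diagonal operator of the [S n], and f |-> sum of B n
    (f n), through the l_oo sums of the E n and of the F n. The outer two are approximable because
    their terms have finite rank and norms of order 2 ^ -n; the diagonal is a series of [dsum_inj] o
    S n o coordinate converging in [alpha]. *)
Lemma min_ideal_series X Y (E F : nat -> banach R s) (C : forall n, X -> E n)
    (S : forall n, E n -> F n) (B : forall n, F n -> Y) (T : X -> Y) (kappa M : R) :
  1 <= kappa ->
  (forall (X Y : banach R s) (T1 T2 : X -> Y),
     ideal_mem A T1 -> ideal_mem A T2 ->
     alpha A (T1 \+ T2) <= kappa * (alpha A T1 + alpha A T2)) ->
  0 <= M -> (forall n, finite_dim (E n)) -> (forall n, finite_dim (F n)) ->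
  (forall n, bounded_op (C n)) -> (forall n, ideal_mem A (S n)) ->
  (forall n, bounded_op (B n)) ->
  (forall n x, rnorm (C n x) <= M * hf ^+ n * rnorm x) ->
  (forall n, alpha A (S n) <= M * (2 * kappa)^-1 ^+ n) ->
  (forall n y, rnorm (B n y) <= M * hf ^+ n * rnorm y) ->
  (forall x, exists L, forall n,
     rnorm (\sum_(i < n) B i (S i (C i x)) - T x) <= L * hf ^+ n) ->
  min_ideal A T.
Proof.
move=> k1 kD M0 Ef Ff Cb AS Bb CM SM BM BSC.
have [TC TCa TCE] := @approximable_series R s X (dsum E)
  (fun n => @dsum_inj R s E n \o C n) M M0
  (fun n => finite_rank_compl (finite_rank_cod (Cb n) (Ef n)) (dsum_inj_bounded _ n))
  (fun n x => le_trans (rnorm_dsum_inj _) (CM n x)).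
have [|TB TBa TBE] := @approximable_series R s (dsum F) Y
  (fun n => B n \o (fun f : dsum F => f n)) M M0
  (fun n => finite_rank_compr (dsum_coord_bounded _ n) (finite_rank_dom (Bb n) (Ff n))).
  move=> n x; apply: (le_trans (BM _ _)).
  by rewrite ler_wpM2l ?dsum_coord// mulr_ge0 ?exprn_ge0.
(* Coordinate m of a partial sum has its final value as soon as the sum includes index m. *)
have TCc x m : TC x m = C m x.
  apply/esym/(@eq_of_half _ _ _ _ _ (2 * M * rnorm x) m.+1) => n mn.
  rewrite mulrAC; apply: le_trans (TCE n x).
  apply: (le_trans _ (dsum_coord _ m)).
  by rewrite (linB _ _ (dsum_coord_linear m)) (dsum_partial_coord (fun i => C i x) mn).
pose Q n : dsum E -> dsum F := @dsum_inj R s F n \o (S n \o (fun f : dsum E => f n)).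
have ASp n : ideal_mem A (S n \o (fun f : dsum E => f n)).
  exact: ideal_compr (dsum_coord_bounded _ n) (AS n).
have [||TS ATS TSE] := @ideal_series (dsum E) (dsum F) Q kappa M k1 kD M0.
- by move=> n; exact: ideal_compl (ASp n) (dsum_inj_bounded _ n).
- move=> n; apply: le_trans (SM n).
  apply: (le_trans (alpha_compl (ASp n) (dsum_inj_bounded _ n) (dsum_inj_opnorm _ n))).
  rewrite mul1r.
  apply: (le_trans (alpha_compr (dsum_coord_bounded _ n) (AS n)
    (dsum_coord_opnorm _ n))).
  by rewrite mulr1.
have TSc z m : TS z m = S m (z m).
  apply/esym/eq_of_rnorm_le => e /(TSE z)[N NP].
  have := NP (maxn N m.+1) (leq_maxl _ _).
  move=> /(le_trans (dsum_coord _ m)).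
  rewrite (linB _ _ (dsum_coord_linear m)).
  rewrite (dsum_partial_coord (fun i => S i (z i)))//.
  exact: leq_maxr.
exists (dsum F), (TS \o TC), TB; split=> //; last first.
  apply/funext => x /=; have [L LP] := BSC x.
  apply: (@eq_of_half _ _ _ _ _ (L + 2 * M * rnorm (TS (TC x))) 0) => n _.
  apply: (le_trans (rnorm_distD (\sum_(i < n) B i (S i (C i x))) _ _)).
  rewrite mulrDl rnormBC; apply: lerD; first exact: LP.
  rewrite mulrAC; have := TBE n (TS (TC x)).
  by under eq_bigr => i _ do rewrite /= TSc TCc.
by exists (dsum E), TC, TS.
Qed.
End Ideals.

(** * Quotients and accessibility *)

Section Quotients.
Context {R : realType} {s : scalar_kind}.
Local Notation K := (scalars R s).
Local Notation hf := (2^-1 : R).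
Implicit Types X Y Z : banach R s.

Lemma closed_approx X (A : set X) :
  (forall x, (forall e : R, 0 < e -> exists2 y, A y & rnorm (x - y) <= e) -> A x) ->
  closed A.
Proof.
move=> AP x Ax; apply: AP => e e0.
have [|y [Ay xy]] := Ax (ball x (ofreal e)).
  by apply: nbhsx_ballx; rewrite -ofreal0 ltr_ofreal.
by exists y => //; move: xy; rewrite -ball_normE /= rnorm_lt => /ltW.
Qed.

Section Kernel.
Variables (X Y : banach R s) (T : X -> Y).
Hypothesis Tb : bounded_op T.

Let Tl := bounded_linear Tb.

Let ker0 : [set x | T x = 0] 0. Proof. exact: lin0. Qed.

Let kerP (k : K) x y : [set x | T x = 0] x -> [set x | T x = 0] y ->
  [set x | T x = 0] (k *: x + y).
Proof. by rewrite /= => Tx Ty; rewrite Tl Tx Ty scaler0 addr0. Qed.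

Let ker_closed : closed [set x | T x = 0].
Proof.
apply: closed_approx => x xT; apply: eq_of_rnorm_le => e e0.
have T1 : 0 < opnorm T + 1 by rewrite ltr_wpDl ?opnorm_ge0.
have [y Ty xy] := xT (e / (opnorm T + 1)) ltac:(by rewrite divr_gt0).
rewrite -Ty -linB//; apply: (le_trans (opnormP _ Tb)).
apply: (@le_trans _ _ ((opnorm T + 1) * rnorm (x - y))).
  by rewrite ler_wpM2r ?rnorm_ge0// lerDl.
by rewrite mulrC -ler_pdivlMr.
Qed.

Definition ker_subspace : closed_subspace X := ClosedSubspace ker0 kerP ker_closed.

End Kernel.

Section QuotientMap.
Variables (X : banach R s) (L : closed_subspace X).

Lemma rnorm_quot_map x : rnorm (quot_map L x) <= rnorm x.
Proof.
rewrite rnorm_quot; apply: ge_inf; last by exists x.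
by exists 0 => _ [y _ <-]; exact: rnorm_ge0.
Qed.

Lemma quot_map_lift (q : quot_banach L) (e : R) : 0 < e ->
  exists2 x, quot_map L x = q & rnorm x <= rnorm q + e.
Proof.
move=> e0; rewrite rnorm_quot; apply: contrapT => /forall2NP nx.
have : quot_norm q + e <= quot_norm q.
  apply: lb_le_inf => [|_ [x xq <-]].
    by have [x xq] := quot_map_surj q; exists (rnorm x), x.
  by case: (nx x) => // /negP; rewrite -ltNge => /ltW.
by rewrite leNgt ltrDl e0.
Qed.

Lemma quot_map_linear : linear (quot_map L).
Proof. by move=> k x y; rewrite quot_mapD quot_mapZ. Qed.

Lemma quot_map_bounded : bounded_op (quot_map L).
Proof.
apply: (bounded_opI (M := 1)) => [|x]; first exact: quot_map_linear.
by rewrite mul1r rnorm_quot_map.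
Qed.

Lemma quot_map_opnorm : opnorm (quot_map L) <= 1.
Proof. by apply: opnorm_le => // x; rewrite mul1r rnorm_quot_map. Qed.

(** U is T after an arbitrary section [r], whose choice does not matter because T vanishes on L. The
    bound [M] passes to U unchanged, so rates of decay survive the factorization. *)
Lemma quot_factor Y (T : X -> Y) (M : R) : linear T -> 0 <= M ->
  (forall x, rnorm (T x) <= M * rnorm x) ->
  (forall x, csub_set L x -> T x = 0) ->
  exists U : quot_banach L -> Y, [/\ bounded_op U,
    (forall q, rnorm (U q) <= M * rnorm q) & forall x, U (quot_map L x) = T x].
Proof.
move=> Tl M0 TM TL; have /choice[r rP] := @quot_map_surj _ _ _ L.
have UE x : T (r (quot_map L x)) = T x.
  have /quot_map_eq/TL : quot_map L (r (quot_map L x)) = quot_map L x by rewrite rP.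
  by rewrite linB// => /eqP; rewrite subr_eq0 => /eqP.
have UM q : rnorm (T (r q)) <= M * rnorm q.
  apply/ler_addgt0Pr => e e0; have M1 : 0 < M + 1 by rewrite ltr_wpDl.
  have [x <- xe] := @quot_map_lift q (e / (M + 1)) ltac:(by rewrite divr_gt0).
  rewrite UE; apply: (le_trans (TM x)).
  apply: (le_trans (ler_wpM2l M0 xe)); rewrite mulrDr lerD2l mulrCA.
  by rewrite ler_piMr ?(ltW e0)// ler_pdivrMr// mul1r lerDl.
exists (T \o r); split=> //; apply: (bounded_opI (M := M)) => // k p q /=.
rewrite -[p](rP p) -[q](rP q) -quot_map_linear !UE.
by rewrite Tl.
Qed.

End QuotientMap.

(** The induced map on the quotient by the kernel is injective into the finite-dimensional range of
    T. *)
Lemma finite_dim_quot X Y (T : X -> Y) (Tf : finite_rank T) :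
  finite_dim (quot_banach (ker_subspace (finite_rank_bounded Tf))).
Proof.
have Tb := finite_rank_bounded Tf; have Tl := bounded_linear Tb.
set L := ker_subspace _.
have [U [Ub _ UT]] := @quot_factor X L Y T (opnorm T) Tl (opnorm_ge0 T)
  (fun x => opnormP x Tb) (fun x Lx => Lx).
have [_ [n [e eT]]] := Tf.
apply: (@finite_dim_inj _ _ _ _ U n e); first exact: bounded_linear.
  move=> p q; have [x <-] := quot_map_surj p; have [y <-] := quot_map_surj q.
  rewrite !UT => xy; apply/quot_map_eq; rewrite /L /= linB// xy subrr//.
by move=> q; have [x <-] := quot_map_surj q; rewrite UT; exact: eT.
Qed.

Lemma sub_incl_linear X (L : closed_subspace X) : linear (@sub_incl _ _ _ L).
Proof. by []. Qed.

Lemma rnorm_sub_incl X (L : closed_subspace X) (x : sub_banach L) :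
  rnorm (sub_incl x) = rnorm x.
Proof. by []. Qed.

Lemma sub_incl_bounded X (L : closed_subspace X) : bounded_op (@sub_incl _ _ _ L).
Proof. by apply: (bounded_opI (M := 1)) => [|x]; rewrite ?mul1r. Qed.

(** Telescoping of finite rank approximants chosen within q ^ n of T; any rate q can be
    prescribed. *)
Lemma approximable_decomposition X Y (T : X -> Y) (q : R) :
  0 < q -> q <= 1 -> approximable_op T ->
  exists (D : nat -> X -> Y) (M : R), [/\ 0 <= M, forall n, finite_rank (D n),
    forall n x, rnorm (D n x) <= M * q ^+ n * rnorm x &
    forall n x, rnorm (\sum_(i < n) D i x - T x) <= M * q ^+ n * rnorm x].
Proof.
move=> q0 q1 [Tb TF].
have qn0 n : 0 <= q ^+ n by rewrite exprn_ge0// ltW.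
have /choice[F FP] n : exists F : X -> Y, finite_rank F /\ opnorm (T \- F) < q ^+ n.
  by have [F Ff Fq] := TF (q ^+ n) ltac:(by rewrite exprn_gt0); exists F.
(* Starting at 0 makes the n-th partial sum exactly [G n]; the summand [opnorm T] in [B] covers the
   error at n = 0. *)
pose G n : X -> Y := if n is 0 then fun=> 0 else F n.
have Gf n : finite_rank (G n).
  case: n => [|n]; last by have [] := FP n.+1.
  split; last by exists 0, (fun=> 0) => x; exists (fun=> 0); rewrite big_ord0.
  apply: (bounded_opI (M := 0)) => [k x y|x]; first by rewrite scaler0 addr0.
  by rewrite rnorm0 mul0r.
pose B := 1 + opnorm T.
have GT n x : rnorm (G n x - T x) <= B * q ^+ n * rnorm x.
  rewrite rnormBC; case: n => [|n].
    rewrite subr0 mulr1; apply: (le_trans (opnormP x Tb)).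
    by rewrite ler_wpM2r ?rnorm_ge0// lerDr.
  have [Ff Fq] := FP n.+1.
  apply: (le_trans (opnormP x (bounded_op_sub Tb (finite_rank_bounded Ff)))).
  rewrite ler_wpM2r ?rnorm_ge0//; apply: (le_trans (ltW Fq)).
  by rewrite ler_peMl// lerDl opnorm_ge0.
exists (fun n => G n.+1 \- G n), (2 * B); split.
- by rewrite mulr_ge0// addr_ge0// opnorm_ge0.
- by move=> n; exact: finite_rank_sub.
- move=> n x /=; apply: (le_trans (rnorm_distD (T x) _ _)).
  have h1 := GT n.+1 x; have h2 := GT n x; rewrite rnormBC in h2.
  apply: (le_trans (lerD h1 h2)).
  have -> : 2 * B * q ^+ n * rnorm x = B * q ^+ n * rnorm x + B * q ^+ n * rnorm x by ring.
  rewrite lerD2r ler_wpM2r ?rnorm_ge0// ler_wpM2l ?addr_ge0 ?opnorm_ge0//.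
  by rewrite exprS ler_piMl.
- move=> n x.
  have -> : \sum_(i < n) (G i.+1 \- G i) x = G n x.
    elim: n => [|n IH]; first by rewrite big_ord0.
    by rewrite big_ord_recr/= IH addrC subrK.
  apply: (le_trans (GT n x)); rewrite -!mulrA ler_peMl ?ler1n//.
  by rewrite !mulr_ge0 ?rnorm_ge0// addr_ge0// opnorm_ge0.
Qed.

End Quotients.

(** * From accessibility to the minimal kernel *)

Section Accessible.
Context {R : realType} {s : scalar_kind}.
Local Notation K := (scalars R s).
Local Notation hf := (2^-1 : R).
Implicit Types X Y Z : banach R s.
Variable A : operator_ideal R s.

(** With D n = D' n o Q n through X / ker (D n), the operator U o D' n has finite-dimensional
    domain, and right accessibility (with e = 1) puts its range into a finite-dimensional subspace
    of Y. The decay of D n is now in [alpha A (S n)]. *)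
Lemma right_accessible_min X Y (T : X -> Y) : right_accessible A ->
  comp_op A (@approximable_op R s) T -> min_ideal A T.
Proof.
move=> Ar [Z [V [U [Va AU ->]]]].
have [kappa k1 kD] := alphaD A.
have k0 : 0 < kappa by exact: lt_le_trans k1.
(* The weights are 2 ^ -n, 4 ^ n, 2 ^ -n: the outer ones make the outer factors decay, and 4 ^ n q ^
   n = (2 kappa) ^ -n is the rate that the middle factor needs. *)
pose q := (8 * kappa)^-1.
have q0 : 0 < q by rewrite invr_gt0 mulr_gt0.
have qh : q <= hf.
  by rewrite lef_pV2 ?posrE ?mulr_gt0//; lra.
have q1 : q <= 1 by apply: (le_trans qh); rewrite invf_le1// ler1n.
have [D [M [M0 Df DM DV]]] := approximable_decomposition q0 q1 Va.
have Ub := ideal_bounded AU; have Ul := bounded_linear Ub.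
pose L n := ker_subspace (finite_rank_bounded (Df n)).
pose E n : banach R s := quot_banach (L n).
have Mq0 n : 0 <= M * q ^+ n by rewrite mulr_ge0// exprn_ge0// ltW.
have /all_sig[D' D'P] n : {D' : E n -> Z | [/\ bounded_op D',
    (forall p, rnorm (D' p) <= M * q ^+ n * rnorm p) &
    forall x, D' (quot_map (L n) x) = D n x]}.
  apply: cid; apply: quot_factor => //.
  exact: bounded_linear (finite_rank_bounded (Df n)).
have AUD n : ideal_mem A (U \o D' n) by have [D'b _ _] := D'P n; exact: ideal_compr.
have /all_sig[N NP] n : {N : closed_subspace Y | finite_dim (sub_banach N) /\
    exists S : E n -> sub_banach N,
      [/\ ideal_mem A S, U \o D' n = @sub_incl _ _ _ N \o S &
          alpha A S <= (1 + 1) * alpha A (U \o D' n)]}.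
  by apply: cid; apply: Ar => //; exact: finite_dim_quot.
have /all_sig[S SP] n := cid (proj2 (NP n)).
have hf0 n : 0 <= hf ^+ n by rewrite exprn_ge0.
have four0 n : 0 <= 4 ^+ n :> R by rewrite exprn_ge0.
pose M' := 1 + 2 * (alpha A U * M).
have aUM : 0 <= alpha A U * M by rewrite mulr_ge0// alpha_ge0.
apply: (@min_ideal_series R s A X Y E (fun n => sub_banach (N n))
  (fun n x => (ofreal (hf ^+ n) : K) *: quot_map (L n) x)
  (fun n p => (ofreal (4 ^+ n) : K) *: S n p)
  (fun n y => (ofreal (hf ^+ n) : K) *: sub_incl y) _ kappa M') => //.
- by rewrite addr_ge0// mulr_ge0.
- by move=> n; exact: finite_dim_quot.
- by move=> n; have [] := NP n.
- by move=> n; apply: bounded_op_scale; exact: quot_map_bounded.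
- by move=> n; apply: ideal_scale; have [] := SP n.
- by move=> n; apply: bounded_op_scale; exact: sub_incl_bounded.
- move=> n x; rewrite rnormZr// ler_pM ?rnorm_ge0 ?rnorm_quot_map//.
  by rewrite ler_peMl// lerDl mulr_ge0.
- move=> n; have [AS _ aS] := SP n.
  apply: (le_trans (alpha_scale _ AS)); rewrite ger0_norm ?ofrealK; last first.
    by rewrite -ofreal0 ler_ofreal.
  have [D'b D'M _] := D'P n.
  have aUD : alpha A (U \o D' n) <= alpha A U * (M * q ^+ n).
    by apply: alpha_compr => //; exact: opnorm_le.
  apply: (@le_trans _ _ (4 ^+ n * (2 * (alpha A U * (M * q ^+ n))))).
    rewrite ler_wpM2l//; apply: (le_trans aS).
    by rewrite ler_wpM2l//; lra.
  have -> : (2 * kappa)^-1 ^+ n = 4 ^+ n * q ^+ n.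
    rewrite -exprMn; congr (_ ^+ n); rewrite /q; field.
    by rewrite gt_eqF.
  rewrite /M' [leRHS]mulrDl mul1r.
  rewrite [leLHS](_ : _ = 2 * (alpha A U * M) * (4 ^+ n * q ^+ n)); last by ring.
  by rewrite lerDr mulr_ge0// exprn_ge0// ltW.
- move=> n y; rewrite rnormZr// ler_pM ?rnorm_ge0 ?rnorm_sub_incl//.
  by rewrite ler_peMl// lerDl mulr_ge0.
move=> x; exists (opnorm U * (M * rnorm x)) => n.
have -> : \sum_(i < n) (ofreal (hf ^+ i) : K) *: sub_incl ((ofreal (4 ^+ i) : K) *:
    S i ((ofreal (hf ^+ i) : K) *: quot_map (L i) x)) = U (\sum_(i < n) D i x).
  rewrite lin_sum//; apply: eq_bigr => i _.
  have [AS US _] := SP i; have [_ _ <-] := D'P i.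
  rewrite -[U (D' i _)]/((U \o D' i) _) US /=.
  have Sl := bounded_linear (ideal_bounded AS).
  rewrite (linZ _ _ Sl) !(linZ _ _ (@sub_incl_linear R s Y (N i))) !scalerA.
  rewrite -!ofrealM -!exprMn.
  have -> : hf * 4 * hf = 1 by field.
  by rewrite expr1n ofreal1 scale1r.
rewrite /= -linB//; apply: (le_trans (opnormP _ Ub)).
rewrite -!mulrA ler_wpM2l ?opnorm_ge0//; apply: (le_trans (DV n x)).
rewrite mulrAC -mulrA ler_wpM2l// ler_wpM2l ?rnorm_ge0//.
by rewrite lerXn2r// nnegrE ltW.
Qed.

(** Here Q n o W, with Q n the quotient map of Z by ker (D n), has finite-dimensional codomain, and
    left accessibility factors it through a finite-dimensional quotient of X. The [S n] are only
    bounded in [alpha]; the decay stays in D' n. *)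
Lemma left_accessible_min X Y (T : X -> Y) : left_accessible A ->
  comp_op (@approximable_op R s) A T -> min_ideal A T.
Proof.
move=> Al [Z [W [V [AW Va ->]]]].
have [kappa k1 kD] := alphaD A.
have k0 : 0 < kappa by exact: lt_le_trans k1.
pose q := (8 * kappa)^-1.
have q0 : 0 < q by rewrite invr_gt0 mulr_gt0.
have qh : q <= hf.
  by rewrite lef_pV2 ?posrE ?mulr_gt0//; lra.
have q1 : q <= 1 by apply: (le_trans qh); rewrite invf_le1// ler1n.
have [D [M [M0 Df DM DV]]] := approximable_decomposition q0 q1 Va.
have Wb := ideal_bounded AW.
pose L n := ker_subspace (finite_rank_bounded (Df n)).
pose F n : banach R s := quot_banach (L n).
have Mq0 n : 0 <= M * q ^+ n by rewrite mulr_ge0// exprn_ge0// ltW.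
have /all_sig[D' D'P] n : {D' : F n -> Y | [/\ bounded_op D',
    (forall p, rnorm (D' p) <= M * q ^+ n * rnorm p) &
    forall x, D' (quot_map (L n) x) = D n x]}.
  apply: cid; apply: quot_factor => //.
  exact: bounded_linear (finite_rank_bounded (Df n)).
have AQW n : ideal_mem A (quot_map (L n) \o W).
  by apply: ideal_compl => //; exact: quot_map_bounded.
have /all_sig[N NP] n : {N : closed_subspace X | finite_dim (quot_banach N) /\
    exists S : quot_banach N -> F n,
      [/\ ideal_mem A S, quot_map (L n) \o W = S \o quot_map N &
          alpha A S <= (1 + 1) * alpha A (quot_map (L n) \o W : X -> F n)]}.
  exact: cid (Al _ (F n) _ 1 (finite_dim_quot (Df n)) (AQW n) ltr01).
have /all_sig[S SP] n := cid (proj2 (NP n)).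
have hf0 n : 0 <= hf ^+ n by rewrite exprn_ge0.
(* The weights 2 ^ -n, a ^ n, b ^ n multiply to 1. The second supplies the decay of the middle
   factor, and b q = 1 / 2 leaves the decay 2 ^ -n for D' n. *)
pose a := (2 * kappa)^-1; pose b := 4 * kappa.
have a0 n : 0 <= a ^+ n by rewrite exprn_ge0// invr_ge0 mulr_ge0// ltW.
have b0 n : 0 <= b ^+ n by rewrite exprn_ge0// mulr_ge0// ltW.
pose M' := 1 + (2 * alpha A W + M).
have aW := alpha_ge0 AW.
have M'1 : 1 <= M' by rewrite /M'; lra.
have M'2 : 2 * alpha A W <= M' by rewrite /M'; lra.
have M'3 : M <= M' by rewrite /M'; lra.
apply: (@min_ideal_series R s A X Y (fun n => quot_banach (N n)) F
  (fun n x => (ofreal (hf ^+ n) : K) *: quot_map (N n) x)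
  (fun n p => (ofreal (a ^+ n) : K) *: S n p)
  (fun n y => (ofreal (b ^+ n) : K) *: D' n y) _ kappa M') => //.
- by rewrite (le_trans _ M'1).
- by move=> n; have [] := NP n.
- by move=> n; exact: finite_dim_quot.
- by move=> n; apply: bounded_op_scale; exact: quot_map_bounded.
- by move=> n; apply: ideal_scale; have [] := SP n.
- by move=> n; apply: bounded_op_scale; have [] := D'P n.
- move=> n x; rewrite rnormZr// ler_pM ?rnorm_ge0 ?rnorm_quot_map//.
  by rewrite ler_peMl.
- move=> n; have [AS _ aS] := SP n.
  apply: (le_trans (alpha_scale _ AS)); rewrite ger0_norm ?ofrealK; last first.
    by rewrite -ofreal0 ler_ofreal.
  have aQW : alpha A (quot_map (L n) \o W : X -> F n) <= 1 * alpha A W.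
    by apply: alpha_compl => //; [exact: quot_map_bounded|exact: quot_map_opnorm].
  rewrite mulrC ler_wpM2r//; apply: (le_trans aS); apply: le_trans M'2.
  by rewrite ler_wpM2l// -[leRHS]mul1r.
- move=> n y; have [_ D'M _] := D'P n; rewrite rnormZr//.
  apply: (le_trans (ler_wpM2l (b0 n) (D'M y))).
  have -> : hf ^+ n = b ^+ n * q ^+ n.
    rewrite -exprMn; congr (_ ^+ n); rewrite /q /b; field.
    by rewrite gt_eqF.
  rewrite [leLHS]mulrA ler_wpM2r ?rnorm_ge0// [leLHS]mulrCA.
  by rewrite ler_wpM2r// mulr_ge0// exprn_ge0// ltW.
move=> x; exists (M * rnorm (W x)) => n.
have -> : \sum_(i < n) (ofreal (b ^+ i) : K) *: D' i ((ofreal (a ^+ i) : K) *: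
    S i ((ofreal (hf ^+ i) : K) *: quot_map (N i) x)) = \sum_(i < n) D i (W x).
  apply: eq_bigr => i _.
  have [AS QS _] := SP i; have [D'b _ <-] := D'P i.
  rewrite -[quot_map _ (W x)]/((quot_map (L i) \o W) x) QS /=.
  have Sl := bounded_linear (ideal_bounded AS).
  have D'l := bounded_linear D'b.
  rewrite (linZ _ _ Sl) !(linZ _ _ D'l) !scalerA -!ofrealM -!exprMn.
  have -> : b * (a * hf) = 1 by rewrite /a /b; field; rewrite gt_eqF.
  by rewrite expr1n ofreal1 scale1r.
apply: (le_trans (DV n (W x))).
rewrite mulrAC ler_wpM2l ?mulr_ge0 ?rnorm_ge0//.
by rewrite lerXn2r// nnegrE ltW.
Qed.

End Accessible.

(** * Compact operators into l_oo *)

Section Colourings.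
Context {R : realType} {s : scalar_kind}.
Local Notation K := (scalars R s).
Local Notation S := (scalar_space R s).
Local Notation hf := (2^-1 : R).

(** Composition with [r] makes any function on G constant on the colour classes while moving each
    point only within its class. *)
Lemma colouring_representatives (G : Type) (T : finType) (c : G -> T) :
  exists r : G -> G, (forall g, c (r g) = c g) /\
    (forall g h, c g = c h -> r g = r h).
Proof.
have /choice[w wP] t : exists w : option G, forall g, c g = t ->
    exists2 h, w = Some h & c h = t.
  have [[g gt]|nt] := pselect (exists g, c g = t).
    by exists (Some g) => _ _; exists g.
  by exists None => g gt; case: nt; exists g.
exists (fun g => odflt g (w (c g))); split=> [g|g h gh].
  by have [h -> ch] := wP (c g) g erefl.
by rewrite -gh; have [k -> _] := wP (c g) g erefl.
Qed.

(** The colour of g is the index of a net point within e / 2 of f g. *)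
Lemma totally_bounded_colouring (G : Type) (V : normedModType K) (f : G -> V) (e : R) :
  0 < e -> totally_bounded (range f) ->
  exists (T : finType) (c : G -> T),
    forall g h, c g = c h -> rnorm (f g - f h) <= e.
Proof.
move=> e0 ft; have [r rP] := ft (e / 2) ltac:(by rewrite divr_gt0).
have /choice[y yP] g : exists y, y \in r /\ rnorm (f g - y) <= e / 2.
  by have [y yr fy] := rP _ (imageT f g); exists y.
exists 'I_(size r).+1, (fun g => inord (index (y g) r)) => g h /(congr1 (@nat_of_ord _)).
rewrite !inordK ?ltnS ?index_size// => gh.
have [gr gy] := yP g; have [hr hy] := yP h.
have {}gh : y g = y h by rewrite -(nth_index 0 gr) gh nth_index.
apply: (le_trans (rnorm_distD (y g) _ _)).
by rewrite [leRHS](splitr e) lerD// rnormBC gh.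
Qed.

(** Each bounded scalar function has totally bounded range, hence a colouring; the product of these
    serves the whole list. *)
Lemma linfty_list_colouring (G : choiceType) (r : seq (linfty R s G)) (e : R) : 0 < e ->
  exists (T : finType) (c : G -> T), forall g h, c g = c h ->
    forall f : linfty R s G, f \in r -> rnorm (f g - f h) <= e.
Proof.
move=> e0; elim: r => [|f r [T [c cP]]]; first by exists unit, (fun=> tt).
have fS : totally_bounded (range (fun g => f g)).
  apply: totally_boundedS (totally_bounded_scalars (rnorm f)).
  by move=> _ [g _ <-]; exact: linfty_coord.
have [T' [c' c'P]] := totally_bounded_colouring e0 fS.
exists (T' * T)%type, (fun g => (c' g, c g)) => g h [c'gh cgh] k.
by rewrite in_cons => /orP[/eqP ->|kr]; [exact: c'P|exact: (cP g h cgh)].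
Qed.

Lemma homogeneous_le_unit_ball (X Y : banach R s) (T : X -> Y) (P : Y -> R) (M : R) :
  linear T -> (forall a y, 0 <= a -> P ((ofreal a : K) *: y) = a * P y) ->
  (forall x, unit_ball X x -> P (T x) <= M) -> forall x, P (T x) <= M * rnorm x.
Proof.
move=> Tl PZ PM x; have [x0|x0] := eqVneq (rnorm x) 0.
  have P0 : P 0 = 0 by rewrite -(scaler0 _ (ofreal 0 : K)) PZ// mul0r.
  by rewrite (rnorm0_eq0 x0) lin0// P0 rnorm0 mulr0.
have x1 : 0 < rnorm x by rewrite lt_def x0 rnorm_ge0.
have xi0 : 0 <= (rnorm x)^-1 by rewrite invr_ge0 rnorm_ge0.
have := PM ((ofreal (rnorm x)^-1 : K) *: x).
rewrite linZ// PZ// mulrC ler_pdivrMr//; apply.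
by apply/unit_ballE; rewrite rnormZr// mulVf.
Qed.

Section Linfty.
Variable G : choiceType.

Lemma linfty_eval_linear (g : G) : linear (fun f : linfty R s G => f g : S).
Proof. by []. Qed.

(** The image of the ball is within e / 3 of a finite list of functions, and a colouring fine enough
    for the list works for every z at once. *)
Lemma compact_linfty_colouring (Z : banach R s) (U : Z -> linfty R s G) (e : R) :
  0 < e -> compact_op U ->
  exists (T : finType) (c : G -> T), forall g h, c g = c h ->
    forall z, rnorm (U z g - U z h) <= e * rnorm z.
Proof.
move=> e0 /compact_opP[Ub Ut]; have e3 : 0 < e / 3 by rewrite divr_gt0.
have [r rP] := Ut _ e3.
have [T [c cP]] := linfty_list_colouring r e3.
exists T, c => g h gh.
apply: (@homogeneous_le_unit_ball _ _ U (fun f => rnorm (f g - f h : S))) => [|a f a0|z z1].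
- exact: bounded_linear.
- by rewrite -[_ g]/((ofreal a : K) *: (f g : S)) -[_ h]/((ofreal a : K) *: (f h : S))
    -scalerBr rnormZr.
have [f fr Uf] := rP _ (imageP U z1).
have fg k : rnorm (U z k - f k : S) <= e / 3.
  by apply: le_trans Uf; exact: (linfty_coord (U z - f)).
apply: (le_trans (rnorm_distD (f g) _ _)).
have := rnorm_distD (f h) (f g : S) (U z h); have := fg g; have := fg h.
have := cP g h gh f fr; rewrite [rnorm (f h - _)]rnormBC => h1 h2 h3 h4.
by apply: (le_trans (lerD h3 h4)); lra.
Qed.

(** The indicators of the colour classes span the functions constant on them. *)
Lemma linfty_colour_lspan (T : finType) (c : G -> T) :
  exists n (e : 'I_n -> linfty R s G), forall f : linfty R s G,
    (forall g h, c g = c h -> f g = f h) -> lspan e f.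
Proof.
have ind_bound t : (fun g => (c g == t)%:R : S) \in @bounded_family R s G.
  by apply/bounded_familyP; exists 1 => g; case: eqP => _; 
    rewrite /rnorm ?normr1 ?normr0 -?(@ofreal1 R s) -?(@ofreal0 R s) ofrealK.
exists #|T|, (fun i => Linfty (ind_bound (enum_val i))) => f fc.
have /choice[k kP] t : exists k : S, forall g, c g = t -> f g = k.
  have [[g <-]|nt] := pselect (exists g, c g = t).
    by exists (f g) => h hg; exact: fc.
  by exists 0 => g gt; case: nt; exists g.
exists (fun i => k (enum_val i)); apply: val_inj; apply/funext => g /=.
rewrite (lin_sum _ _ _ (@linfty_eval_linear g)).
rewrite (eq_bigr (fun i => (k (enum_val i) : K) * (c g == enum_val i)%:R))//.
rewrite (bigD1 (enum_rank (c g)))//= enum_rankK eqxx mulr1 big1 => [|i ig].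
  by rewrite addr0; exact: kP.
have -> : (c g == enum_val i) = false.
  by apply: contraNF ig => /eqP ->; rewrite enum_valK.
by rewrite mulr0.
Qed.

End Linfty.
End Colourings.

(** * Extension of operators into l_oo along an isometry *)

Section LinftyExtension.
Context {R : realType} {s : scalar_kind}.
Local Notation K := (scalars R s).
Local Notation S := (scalar_space R s).
Local Notation hf := (2^-1 : R).
Variables (Z W : banach R s) (G : choiceType) (J : Z -> W).
Hypothesis Jl : linear J.
Hypothesis Ji : forall z, rnorm (J z) = rnorm z.

(** Hahn-Banach in each coordinate, with one common bound. *)
Lemma linfty_extend (D : Z -> linfty R s G) (M : R) : 0 <= M -> linear D ->
  (forall z, rnorm (D z) <= M * rnorm z) ->
  exists E : W -> linfty R s G, [/\ linear E,
    forall w, rnorm (E w) <= M * rnorm w & forall z, E (J z) = D z].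
Proof.
move=> M0 Dl DM.
have /choice[F FP] g : exists F : W -> S,
    [/\ linear F, forall w, rnorm (F w) <= M * rnorm w & F \o J = (fun z => D z g : S)].
  apply: hahn_banach => // [k x y|z]; first by rewrite Dl.
  by apply: le_trans (DM z); exact: linfty_coord.
have Fb w : (fun g => F g w) \in @bounded_family R s G.
  by apply/bounded_familyP; exists (M * rnorm w) => g; have [_ Fw _] := FP g.
exists (fun w => Linfty (Fb w)); split=> [k x y|w|z].
- by apply: val_inj; apply/funext => g /=; have [Fl _ _] := FP g; rewrite Fl.
- apply: linfty_le => [|g]; first by rewrite mulr_ge0 ?rnorm_ge0.
  by have [_ Fw _] := FP g; exact: Fw.
- apply: val_inj; apply/funext => g /=.
  by have [_ _ FJ] := FP g; rewrite -[LHS]/((F g \o J) z) FJ.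
Qed.

(** Coordinatewise extensions need not agree on a colour class. Reading each coordinate at the
    representative of its class restores this, and with it finite rank, without enlarging the
    norm. *)
Lemma linfty_extend_colour (D : Z -> linfty R s G) (T : finType) (c : G -> T) (M : R) :
  0 <= M -> linear D -> (forall z, rnorm (D z) <= M * rnorm z) ->
  (forall g h, c g = c h -> forall z, D z g = D z h) ->
  exists E : W -> linfty R s G, [/\ finite_rank E,
    forall w, rnorm (E w) <= M * rnorm w & forall z, E (J z) = D z].
Proof.
move=> M0 Dl DM Dc; have [r [cr rc]] := colouring_representatives c.
have [F [Fl FM FJ]] := linfty_extend M0 Dl DM.
have Fb w : (fun g => F w (r g)) \in @bounded_family R s G.
  by apply/bounded_familyP; exists (rnorm (F w)) => g; exact: linfty_coord.
pose E w := Linfty (Fb w).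
have EM w : rnorm (E w) <= M * rnorm w.
  apply: linfty_le => [|g]; first by rewrite mulr_ge0 ?rnorm_ge0.
  by apply: le_trans (FM w); exact: (linfty_coord (F w) (r g)).
exists E; split=> //; last first.
  by move=> z; apply: val_inj; apply/funext => g /=; rewrite FJ; exact: Dc.
split.
  apply: (bounded_opI (M := M)) => // k x y; apply: val_inj; apply/funext => g /=.
  by rewrite Fl.
have [n [e eP]] := @linfty_colour_lspan R s G T c.
by exists n, e => w; apply: eP => g h gh /=; rewrite (rc _ _ gh).
Qed.

(** Reading U at representatives of ever finer colourings gives operators [Q n] converging to U. The
    differences are extended, not the [Q n]: extensions of the [Q n] chosen separately need not
    converge, whereas those of the differences keep their small norms. With J the identity this says
    that U itself is approximable. *)
Lemma compact_linfty_extend (U : Z -> linfty R s G) : compact_op U ->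
  exists2 E : W -> linfty R s G, approximable_op E & E \o J = U.
Proof.
move=> Uc; have Ub := proj1 Uc; have Ul := bounded_linear Ub.
have hfg0 n : 0 < hf ^+ n by rewrite exprn_gt0.
have hf0 n := ltW (hfg0 n).
have H n := compact_linfty_colouring (hfg0 n) Uc.
have /all_sig[T TP] n := cid (H n).
have /all_sig[c cP] n := cid (TP n).
have /choice[r rP] n := colouring_representatives (c n).
have rb n z : (fun g => U z (r n g)) \in @bounded_family R s G.
  by apply/bounded_familyP; exists (rnorm (U z)) => g; exact: linfty_coord.
pose Q n z : linfty R s G := if n is 0 then 0 else Linfty (rb n z).
have Ql n : linear (Q n).
  case: n => [|n] k x y; first by rewrite /= scaler0 addr0.
  by apply: val_inj; apply/funext => g /=; rewrite Ul.
have Qc n g h : c n g = c n h -> forall z, Q n z g = Q n z h.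
  by case: n => //= n gh z; rewrite (proj2 (rP n.+1) _ _ gh).
pose B := 1 + opnorm U.
have B0 : 0 <= B by rewrite addr_ge0// opnorm_ge0.
have QU n z : rnorm (Q n z - U z) <= B * hf ^+ n * rnorm z.
  case: n => [|n].
    rewrite sub0r rnormN mulr1; apply: (le_trans (opnormP z Ub)).
    by rewrite ler_wpM2r ?rnorm_ge0// lerDr.
  apply: (@le_trans _ _ (hf ^+ n.+1 * rnorm z)).
    apply: linfty_le => [|g]; first by rewrite mulr_ge0 ?rnorm_ge0.
    by apply: (cP n.+1); exact: (proj1 (rP n.+1)).
  by rewrite ler_wpM2r ?rnorm_ge0// ler_peMl// lerDl opnorm_ge0.
(* The difference of two successive [Q n] is constant on the classes of the product colouring. *)
have H2 n : exists E : W -> linfty R s G, [/\ finite_rank E,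
    forall w, rnorm (E w) <= 2 * B * hf ^+ n * rnorm w &
    forall z, E (J z) = Q n.+1 z - Q n z].
  apply: (@linfty_extend_colour _ _ (fun g => (c n.+1 g, c n g))).
  - by rewrite !mulr_ge0.
  - exact: linear_sub.
  - move=> z; apply: (le_trans (rnorm_distD (U z) _ _)).
    have h1 := QU n.+1 z; have h2 := QU n z; rewrite rnormBC in h2.
    apply: (le_trans (lerD h1 h2)).
    have -> : 2 * B * hf ^+ n * rnorm z = B * hf ^+ n * rnorm z + B * hf ^+ n * rnorm z by ring.
    rewrite lerD2r ler_wpM2r ?rnorm_ge0// ler_wpM2l//.
    by rewrite exprS ler_piMl// invf_le1// ler1n.
  - by move=> g h [g1 g2] z; rewrite -[LHS]/(Q n.+1 z g - Q n z g) (Qc _ _ _ g1) (Qc _ _ _ g2).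
have /choice[E EP] := H2.
have [|n|n w|V Va VE] := @approximable_series R s W (linfty R s G) E (2 * B).
- by rewrite mulr_ge0.
- by have [] := EP n.
- by have [] := EP n.
exists V => //; apply/funext => z /=.
apply: (@eq_of_half _ _ _ _ _ ((2 * (2 * B) + B) * rnorm z) 0) => n _.
apply: (le_trans (rnorm_distD (Q n z) _ _)).
have QE : Q n z = \sum_(i < n) E i (J z).
  elim: n => [|n IH]; first by rewrite big_ord0.
  by rewrite big_ord_recr/= -IH; have [_ _ ->] := EP n; rewrite addrC subrK.
have := VE n (J z); rewrite -QE Ji rnormBC => h1.
rewrite [leRHS](_ : _ = 2 * (2 * B) * hf ^+ n * rnorm z + B * hf ^+ n * rnorm z).
  by apply: lerD.
by ring.
Qed.

End LinftyExtension.

(** * Operators on l_1 *)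

Section Sums.
#[local] Existing Instance totally_filter.
Context {R : realType} {s : scalar_kind}.
Local Notation K := (scalars R s).
Local Notation S := (scalar_space R s).
Local Notation hf := (2^-1 : R).
Variable G : choiceType.

(** Unconditional summation over finite subsets, in epsilon form; [has_sum_sum] links it to
    [summability.sum]. *)
Definition has_sum (E : normedModType K) (x : G -> E) (v : E) : Prop :=
  forall e : R, 0 < e -> exists A : {fset G}, forall B : {fset G},
    (A `<=` B)%fset -> rnorm (\sum_(g <- B) x g - v) <= e.

Lemma has_sum_unique (E : banach R s) (x : G -> E) v w :
  has_sum x v -> has_sum x w -> v = w.
Proof.
move=> xv xw; apply: eq_of_rnorm_le => e e0.
have e2 : 0 < e / 2 by rewrite divr_gt0.
have [A AP] := xv _ e2; have [B BP] := xw _ e2.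
apply: (le_trans (rnorm_distD (\sum_(g <- (A `|` B)%fset) x g) _ _)).
rewrite [leRHS](splitr e); apply: lerD.
  by rewrite rnormBC; apply: AP; exact: fsubsetUl.
by apply: BP; exact: fsubsetUr.
Qed.

Lemma has_sum_sum (E : banach R s) (x : G -> E) v :
  has_sum x v -> summability.sum x = v.
Proof.
move=> xv; apply: cvg_lim; first exact: norm_hausdorff.
apply/cvgrPdist_le => e e0.
have e0' : 0 < repart e by rewrite -(@ltr_ofreal R s) ofreal0 repartK ?ltW.
have [A AP] := xv _ e0'; exists A => //= B /AP.
have <- : partial_sum x B = \sum_(g <- B) x g by exact/esym/big_seq_fsetE.
by rewrite rnormBC -rnorm_le repartK// ltW.
Qed.

Lemma has_sum_bounded_op (E F : banach R s) (T : E -> F) (x : G -> E) v :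
  bounded_op T -> has_sum x v -> has_sum (T \o x) (T v).
Proof.
move=> Tb xv e e0; have T1 : 0 < opnorm T + 1 by rewrite ltr_wpDl ?opnorm_ge0.
have [A AP] := xv (e / (opnorm T + 1)) ltac:(by rewrite divr_gt0).
exists A => B /AP; have Tl := bounded_linear Tb.
rewrite -(lin_sum _ _ _ Tl) -linB// ler_pdivlMr// => /le_trans.
move=> h; apply: (le_trans (opnormP _ Tb)); apply: le_trans (h _ (lexx _)).
by rewrite mulrC ler_wpM2l ?rnorm_ge0// lerDl.
Qed.

Local Notation L1 := (lone R s G).

Lemma lone_eval_linear (g : G) : linear (fun l : L1 => l g : S).
Proof. by []. Qed.

Lemma lone_sum_le (l : L1) (A : {fset G}) : \sum_(g <- A) rnorm (l g) <= rnorm l.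
Proof.
have l0 : (0 <= \esum_(g in [set: G]) (rnorm (l g))%:E)%E.
  by apply: esum_ge0 => g _; rewrite lee_fin rnorm_ge0.
rewrite rnorm_lone /lone_norm -lee_fin fineK; last first.
  by rewrite ge0_fin_numE//; exact: lone_funP.
rewrite -sumEFin; apply: ereal_sup_ubound; exists [set` A].
  by split=> //; exact: finite_fset.
by rewrite fsbig_finite ?set_fsetK//=; exact: finite_fset.
Qed.

Lemma lone_le (l : L1) (M : R) :
  (forall A : {fset G}, \sum_(g <- A) rnorm (l g) <= M) -> rnorm l <= M.
Proof.
have l0 : (0 <= \esum_(g in [set: G]) (rnorm (l g))%:E)%E.
  by apply: esum_ge0 => g _; rewrite lee_fin rnorm_ge0.
move=> lM; rewrite rnorm_lone /lone_norm -lee_fin fineK; last first.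
  by rewrite ge0_fin_numE//; exact: lone_funP.
apply: ge_ereal_sup => _ [A [Afin _] <-].
by rewrite fsbig_finite//= sumEFin lee_fin.
Qed.

Lemma big_fsetU_disjoint (M : nmodType) (x : G -> M) (A B : {fset G}) :
  [disjoint A & B]%fset ->
  \sum_(g <- (A `|` B)%fset) x g = \sum_(g <- A) x g + \sum_(g <- B) x g.
Proof.
move=> AB; rewrite -big_cat; apply: perm_big; apply: uniq_perm => //.
- rewrite cat_uniq !fset_uniq andbT/=; apply/hasPn => g gB.
  by apply/negP => gA; have := fdisjointP AB _ gA; rewrite gB.
- by move=> g; rewrite mem_cat inE.
Qed.

(** A finite set carrying all but e of the norm leaves at most e for any set disjoint from it. *)
Lemma lone_tail (l : L1) (e : R) : 0 < e -> exists A : {fset G},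
  forall B : {fset G}, [disjoint A & B]%fset -> \sum_(g <- B) rnorm (l g) <= e.
Proof.
move=> e0; have [A] : exists A : {fset G}, rnorm l - e < \sum_(g <- A) rnorm (l g).
  apply: contrapT => /forallNP nA; have : rnorm l <= rnorm l - e.
    by apply: lone_le => A; rewrite leNgt; apply/negP; exact: nA.
  by rewrite leNgt ltrBlDr ltrDl e0.
move=> Ae; exists A => B AB; have := lone_sum_le l (A `|` B)%fset.
by rewrite big_fsetU_disjoint// => h; lra.
Qed.

Lemma has_sum_le (E : banach R s) (x : G -> E) v (M : R) : has_sum x v ->
  (forall A : {fset G}, rnorm (\sum_(g <- A) x g) <= M) -> rnorm v <= M.
Proof.
move=> xv xM; apply/ler_addgt0Pr => e /xv[A AP].
rewrite -[v](subKr (\sum_(g <- A) x g)).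
by apply: (le_trans (rnormD _ _)); rewrite rnormN lerD// AP.
Qed.

Lemma rnorm_lone_comb_le (E : banach R s) (z : G -> E) (l : L1) (M : R) (A : {fset G}) :
  (forall g, rnorm (z g) <= M) ->
  rnorm (\sum_(g <- A) (l g : K) *: z g) <= M * \sum_(g <- A) rnorm (l g).
Proof.
move=> zM; apply: (le_trans (rnorm_sum _ _)).
rewrite mulr_sumr ler_sum// => g _.
by rewrite rnormZ mulrC ler_wpM2r// rabs_ge0.
Qed.

Lemma lone_has_sum (E : banach R s) (z : G -> E) (l : L1) (M : R) : 0 <= M ->
  (forall g, rnorm (z g) <= M) -> exists v, has_sum (fun g => (l g : K) *: z g) v.
Proof.
move=> M0 zM.
have hfM n : 0 < hf ^+ n / (M + 1) by rewrite divr_gt0 ?exprn_gt0// ltr_wpDl.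
have /choice[A AP] n := lone_tail l (hfM n).
(* Unions make the finite sets increasing, so that each sum differs from the next only by a tail. *)
pose B := nat_rect (fun=> {fset G}) (A 0) (fun n Bn => (Bn `|` A n.+1)%fset).
have AB n : (A n `<=` B n)%fset.
  by case: n => [|n]; [exact: fsubset_refl|exact: fsubsetUr].
pose u n := \sum_(g <- B n) (l g : K) *: z g.
have uP n (D : {fset G}) : (A n `<=` D)%fset ->
    forall D' : {fset G}, (D `<=` D')%fset ->
    rnorm (\sum_(g <- D') (l g : K) *: z g - \sum_(g <- D) (l g : K) *: z g) <= hf ^+ n.
  move=> AD D' DD'.
  have -> : D' = (D `|` (D' `\` D))%fset.
    by rewrite fsetUDl fsetDv fsetD0; apply/esym/fsetUidPr.
  have DD : [disjoint D & D' `\` D]%fset by apply/fdisjointP => g gD; rewrite inE gD.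
  rewrite big_fsetU_disjoint//.
  rewrite addrC addKr; apply: (le_trans (rnorm_lone_comb_le _ _ zM)).
  have : \sum_(g <- (D' `\` D)%fset) rnorm (l g) <= hf ^+ n / (M + 1).
    by apply: AP; exact: fdisjointWl DD.
  have Dn : 0 <= \sum_(g <- (D' `\` D)%fset) rnorm (l g).
    by apply: sumr_ge0 => g _; exact: rnorm_ge0.
  rewrite ler_pdivlMr ?ltr_wpDl// mulrC => h; apply: le_trans h.
  by rewrite ler_wpM2r// lerDl.
have [|v vP] := @fast_cvg R s E u.
  by move=> n; apply: uP; [exact: AB|exact: fsubsetUl].
exists v => e e0.
have [n ne] := @half_small R (e / 3) ltac:(by rewrite divr_gt0).
exists (B n) => D BD; apply: (le_trans (rnorm_distD (u n) _ _)).
have h1 := uP n _ (AB n) _ BD; have h2 := vP n.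
by apply: (le_trans (lerD h1 h2)); lra.
Qed.

Lemma has_sum_lin (E : banach R s) (x y : G -> E) v w (k : K) :
  has_sum x v -> has_sum y w -> has_sum (fun g => k *: x g + y g) (k *: v + w).
Proof.
move=> xv yw e e0; have k1 : 0 < repart `|k| + 1 by rewrite ltr_wpDl ?rabs_ge0.
have [A AP] := xv (e / 2 / (repart `|k| + 1)) ltac:(by rewrite !divr_gt0).
have [B BP] := yw (e / 2) ltac:(by rewrite divr_gt0).
exists (A `|` B)%fset => D; rewrite fsubUset => /andP[/AP hA /BP hB].
rewrite big_split/= -scaler_sumr opprD addrACA -scalerBr [leRHS](splitr e).
apply: (le_trans (rnormD _ _)); apply: lerD => //; rewrite rnormZ.
move: hA; rewrite ler_pdivlMr// mulrC => h; apply: le_trans h.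
by rewrite ler_wpM2r ?rnorm_ge0// lerDl.
Qed.

Let basis_fun (g : G) : G -> S := fun h => (h == g)%:R.

Let basis_sum_le g (A : {fset G}) : \sum_(h <- A) rnorm (basis_fun g h) <= 1.
Proof.
have r0 h : h != g -> rnorm (basis_fun g h) = 0.
  by move=> /negbTE hg; rewrite /basis_fun hg rnorm0.
have r1 : rnorm (basis_fun g g) = 1.
  by rewrite /basis_fun eqxx /rnorm normr1 -(@ofreal1 R s) ofrealK.
have [gA|gA] := boolP (g \in A).
  rewrite (bigD1_seq g)//= big1 => [|h]; last exact: r0.
  by rewrite addr0 r1.
rewrite big_seq big1// => h hA; apply: r0.
by apply: contraNneq gA => <-.
Qed.

Let basis_summable g : basis_fun g \in @summable_family R s G.
Proof. by apply/summable_familyP; exists 1 => A; exact: basis_sum_le. Qed.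

Definition lone_basis (g : G) : L1 := Lone (basis_summable g).

Lemma rnorm_lone_basis g : rnorm (lone_basis g) <= 1.
Proof. by apply: lone_le => A; exact: basis_sum_le. Qed.

Lemma lone_basisE g h : lone_basis g h = (h == g)%:R :> K.
Proof. by []. Qed.

Lemma lone_expansion (l : L1) : has_sum (fun g => (l g : K) *: lone_basis g) l.
Proof.
move=> e /(lone_tail l)[A AP]; exists A => B AB.
have coord h : (\sum_(g <- B) (l g : K) *: lone_basis g : L1) h =
    if h \in B then l h else 0.
  rewrite (lin_sum _ _ _ (@lone_eval_linear h)).
  rewrite (eq_bigr (fun g => (l g : K) * (h == g)%:R))//.
  case: ifPn => hB; last first.
    rewrite big_seq big1// => g gB; case: eqP => [hg|_]; last by rewrite mulr0.
    by rewrite hg gB in hB.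
  rewrite (bigD1_seq h)//= eqxx mulr1 big1 ?addr0// => g.
  by rewrite eq_sym => /negbTE ->; rewrite mulr0.
apply: lone_le => D; rewrite -(fsetID B D) big_fsetU_disjoint; last first.
  by apply/fdisjointP => g; rewrite !inE => /andP[_ ->].
rewrite [X in X + _]big_seq [X in X + _]big1 ?add0r => [|h]; last first.
  rewrite inE => /andP[_ hB].
  rewrite [X in rnorm X](linB _ _ (@lone_eval_linear h)) coord hB.
  by rewrite subrr rnorm0.
apply: le_trans (AP (D `\` B)%fset _); last first.
  apply/fdisjointP => g gA; rewrite inE negb_and negbK.
  by rewrite (fsubsetP AB).
rewrite big_seq [leRHS]big_seq; apply: ler_sum => h.
rewrite inE => /andP[/negbTE hB _].
rewrite [X in rnorm X](linB _ _ (@lone_eval_linear h)) coord hB.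
by rewrite sub0r rnormN.
Qed.

Lemma lone_op_has_sum (E : banach R s) (T : L1 -> E) (l : L1) : bounded_op T ->
  has_sum (fun g => (l g : K) *: T (lone_basis g)) (T l).
Proof.
move=> Tb; have := has_sum_bounded_op Tb (lone_expansion l).
congr has_sum; apply/funext => g /=; exact: (linZ _ _ (bounded_linear Tb)).
Qed.

Lemma lone_op_ext (E : banach R s) (T U : L1 -> E) : bounded_op T -> bounded_op U ->
  (forall g, T (lone_basis g) = U (lone_basis g)) -> T = U.
Proof.
move=> Tb Ub TU; apply/funext => l.
apply: has_sum_unique (lone_op_has_sum l Tb) _.
have := lone_op_has_sum l Ub; congr has_sum.
by apply/funext => g; rewrite TU.
Qed.

Lemma lone_comb_le (E : banach R s) (z : G -> E) (l : L1) v (M : R) : 0 <= M ->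
  (forall g, rnorm (z g) <= M) -> has_sum (fun g => (l g : K) *: z g) v ->
  rnorm v <= M * rnorm l.
Proof.
move=> M0 zM /has_sum_le; apply => A.
apply: (le_trans (rnorm_lone_comb_le l A zM)).
by rewrite ler_wpM2l// lone_sum_le.
Qed.

(** The universal property of l_1: a bounded family of vectors is the family of columns of a bounded
    operator. *)
Lemma lone_columns (E : banach R s) (z : G -> E) (M : R) : 0 <= M ->
  (forall g, rnorm (z g) <= M) -> exists T : L1 -> E,
    [/\ bounded_op T, forall l, rnorm (T l) <= M * rnorm l,
      forall g, T (lone_basis g) = z g &
      forall l : L1, has_sum (fun g => (l g : K) *: z g) (T l)].
Proof.
move=> M0 zM; have /choice[T TP] (l : L1) := lone_has_sum l M0 zM.
have TM l : rnorm (T l) <= M * rnorm l by exact: lone_comb_le (TP l).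
have Tb : bounded_op T.
  apply: (bounded_opI (M := M)) => // k l m.
  apply: has_sum_unique (TP _) _; have := has_sum_lin k (TP l) (TP m).
  congr has_sum; apply/funext => g.
  by rewrite scalerA -scalerDl.
exists T; split=> // g; apply: has_sum_unique (TP _) _ => e e0.
exists [fset g]%fset => B; rewrite fsub1set => gB.
rewrite (bigD1_seq g)//= big1 => [|h /negbTE hg]; last first.
  by rewrite [_ h]lone_basisE hg scale0r.
by rewrite [_ g]lone_basisE eqxx scale1r addr0 subrr rnorm0 ltW.
Qed.

(** P l is the sum over the colours t of (f t l) k t, where f t l adds the coefficients of l with
    colour t and k t is the common column. *)
Lemma lone_colour_columns (E : banach R s) (z : G -> E) (M : R) (T : finType) (c : G -> T) :
  0 <= M -> (forall g, rnorm (z g) <= M) -> (forall g h, c g = c h -> z g = z h) ->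
  exists P : L1 -> E, [/\ finite_rank P, forall l, rnorm (P l) <= M * rnorm l &
    forall g, P (lone_basis g) = z g].
Proof.
move=> M0 zM zc; have [P [Pb PM Pg _]] := lone_columns M0 zM.
exists P; split=> //; split=> //.
have /choice[k kP] t : exists k : E, forall g, c g = t -> z g = k.
  have [[g <-]|nt] := pselect (exists g, c g = t).
    by exists (z g) => h hg; exact: zc.
  by exists 0 => g gt; case: nt; exists g.
have ind1 t g : rnorm ((c g == t)%:R : S) <= 1.
  by case: eqP => _; rewrite /rnorm ?normr1 ?normr0 -?(@ofreal1 R s) -?(@ofreal0 R s) ofrealK.
have /choice[f fP] t := lone_columns ler01 (ind1 t).
have fkb t : bounded_op (fun l => (f t l : K) *: k t).
  have [fb _ _ _] := fP t.
  apply: (bounded_op_comp (U := fun a : S => (a : K) *: k t) fb).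
  apply: (bounded_opI (M := rnorm (k t))) => [a x y|a].
    by rewrite scalerA -scalerDl.
  by rewrite rnormZ mulrC.
exists #|T|, (k \o enum_val) => l; exists (fun i => f (enum_val i) l).
suff -> : P = (fun l => \sum_(i < #|T|) (f (enum_val i) l : K) *: k (enum_val i)) by [].
apply: lone_op_ext => // [|g]; first exact: bounded_op_sum (fun i => fkb (enum_val i)).
rewrite Pg (bigD1 (enum_rank (c g)))//= enum_rankK.
have [_ _ -> _] := fP (c g); rewrite eqxx scale1r big1 => [|i ig].
  by rewrite addr0; exact: kP.
have [_ _ -> _] := fP (enum_val i).
have -> : (c g == enum_val i) = false.
  by apply: contraNF ig => /eqP ->; rewrite enum_valK.
by rewrite scale0r.
Qed.

End Sums.

(** * The canonical quotient map from l_1 and liftings through it *)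

Section LoneQuotient.
Context {R : realType} {s : scalar_kind}.
Local Notation K := (scalars R s).
Local Notation hf := (2^-1 : R).
Variable X : banach R s.

Let ball_le (b : unit_ball X) : rnorm (\val b : X) <= 1.
Proof. by apply/unit_ballE; exact: set_valP. Qed.

Lemma lone_quotP : [/\ bounded_op (lone_quot X),
  forall l, rnorm (lone_quot X l) <= rnorm l &
  forall b : unit_ball X, lone_quot X (lone_basis b) = \val b].
Proof.
have [T [Tb T1 Tg TP]] := lone_columns ler01 ball_le.
have -> : lone_quot X = T by apply/funext => l; exact: has_sum_sum.
by split=> // l; rewrite (le_trans (T1 l))// mul1r.
Qed.

Lemma lone_quot_bounded : bounded_op (lone_quot X).
Proof. by have [] := lone_quotP. Qed.

(** The norm of x times the basis vector at x / |x| is a lift without loss of norm. For x = 0 the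
    inverse of the norm is 0, and the basis vector at 0 is used. *)
Lemma lone_quot_lift (x : X) : exists l : lone R s (unit_ball X),
  lone_quot X l = x /\ rnorm l <= rnorm x.
Proof.
have [qb _ qE] := lone_quotP; have ql := bounded_linear qb.
have xi0 : 0 <= (rnorm x)^-1 by rewrite invr_ge0 rnorm_ge0.
have bx : (ofreal (rnorm x)^-1 : K) *: x \in unit_ball X.
  apply/mem_set/unit_ballE; rewrite rnormZr//.
  have [->|x0] := eqVneq (rnorm x) 0; first by rewrite mulr0.
  by rewrite mulVf.
pose b : unit_ball X := SigSub bx.
exists ((ofreal (rnorm x) : K) *: lone_basis b); split; last first.
  by rewrite rnormZr ?rnorm_ge0// ler_piMr ?rnorm_ge0// rnorm_lone_basis.
rewrite (linZ _ _ ql) qE /= scalerA -ofrealM.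
have [x0|x0] := eqVneq (rnorm x) 0.
  by rewrite x0 mul0r ofreal0 scale0r (rnorm0_eq0 x0).
by rewrite mulfV// ofreal1 scale1r.
Qed.

(** Dual to the extension into l_oo: the columns of V form a totally bounded set, are replaced by
    those of class representatives, and successive differences are lifted column by column without
    loss of norm. Lifting differences keeps the series convergent although [lift] is not linear. *)
Lemma compact_lone_lift (G : choiceType) (V : lone R s G -> X) : compact_op V ->
  exists2 W : lone R s G -> lone R s (unit_ball X),
    approximable_op W & lone_quot X \o W = V.
Proof.
move=> Vc; have Vb := proj1 Vc; have /compact_opP[_ Vt] := Vc.
have hfg0 n : 0 < hf ^+ n by rewrite exprn_gt0.
have hf0 n := ltW (hfg0 n).
pose v g := V (lone_basis g).
have vt : totally_bounded (range v).
  apply: totally_boundedS Vt => _ [g _ <-]; apply: imageP.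
  by apply/unit_ballE; exact: rnorm_lone_basis.
have H n := totally_bounded_colouring (hfg0 n) vt.
have /all_sig[T TP] n := cid (H n).
have /all_sig[c cP] n := cid (TP n).
have /choice[r rP] n := colouring_representatives (c n).
pose u n g : X := if n is 0 then 0 else v (r n g).
have uc n g h : c n g = c n h -> u n g = u n h.
  by case: n => //= n gh; rewrite (proj2 (rP n.+1) _ _ gh).
pose B := 1 + opnorm V.
have B0 : 0 <= B by rewrite addr_ge0// opnorm_ge0.
have uv n g : rnorm (u n g - v g) <= B * hf ^+ n.
  case: n => [|n].
    rewrite sub0r rnormN mulr1; apply: (le_trans (opnormP _ Vb)).
    apply: (@le_trans _ _ (opnorm V)); last by rewrite lerDr.
    by rewrite ler_piMr ?opnorm_ge0 ?rnorm_lone_basis.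
  apply: (@le_trans _ _ (hf ^+ n.+1)); first by apply: cP; exact: (proj1 (rP n.+1)).
  by rewrite ler_peMl// lerDl opnorm_ge0.
(* Fixing the lift as a function gives equal columns equal lifts, so the lifted columns still depend
   only on the colours. *)
have /choice[lift liftP] := lone_quot_lift.
pose z n g := lift (u n.+1 g - u n g).
have zM n g : rnorm (z n g) <= 2 * B * hf ^+ n.
  apply: (le_trans (proj2 (liftP _))).
  apply: (le_trans (rnorm_distD (v g) _ _)).
  have h1 := uv n.+1 g; have h2 := uv n g; rewrite rnormBC in h2.
  apply: (le_trans (lerD h1 h2)).
  have -> : 2 * B * hf ^+ n = B * hf ^+ n + B * hf ^+ n by ring.
  rewrite lerD2r ler_wpM2l//.
  by rewrite exprS ler_piMl// invf_le1// ler1n.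
have M0 n : 0 <= 2 * B * hf ^+ n by rewrite !mulr_ge0.
have zc n g h : (c n.+1 g, c n g) = (c n.+1 h, c n h) -> z n g = z n h.
  by move=> [g1 g2]; rewrite /z (uc _ _ _ g1) (uc _ _ _ g2).
have /choice[P PP] n := lone_colour_columns (M0 n) (zM n) (zc n).
have [|n|n l|W Wa WP] := @approximable_series R s _ _ P (2 * B).
- by rewrite mulr_ge0.
- by have [] := PP n.
- by have [_ PM _] := PP n.
have [qb q1 qE] := lone_quotP; have ql := bounded_linear qb.
exists W => //; apply: lone_op_ext => // [|g].
  by apply: bounded_op_comp => //; case: Wa.
rewrite -/(v g) /=.
apply: (@eq_of_half _ _ _ _ _ (2 * (2 * B) + B) 0) => n _.
apply: (le_trans (rnorm_distD (u n g) _ _)); rewrite mulrDl; apply: lerD; last exact: uv.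
have -> : u n g = lone_quot X (\sum_(i < n) P i (lone_basis g)).
  elim: n => [|n IH]; first by rewrite big_ord0 lin0.
  rewrite big_ord_recr/= (linD _ _ ql) -IH; have [_ _ ->] := PP n.
  by rewrite (proj1 (liftP _)) addrC subrK.
rewrite -(linB _ _ ql); apply: (le_trans (q1 _)); rewrite rnormBC.
apply: (le_trans (WP n _)).
by rewrite ler_piMr ?rnorm_lone_basis// !mulr_ge0.
Qed.

End LoneQuotient.

(** * The hulls *)

Section CompactFactors.
Context {R : realType} {s : scalar_kind}.
Local Notation K := (scalars R s).
Local Notation hf := (2^-1 : R).
Implicit Types X Y Z W : banach R s.

Lemma compact_isometry X Y Z (V : X -> Y) (J : Y -> Z) : bounded_op V ->
  linear J -> (forall y, rnorm (J y) = rnorm y) -> compact_op (J \o V) ->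
  compact_op V.
Proof.
move=> Vb Jl Ji /compact_opP[_ JVt]; apply/compact_opP; split=> //.
apply: (totally_bounded_isometry (f := J)); last by rewrite image_comp.
by move=> x y; rewrite -linB.
Qed.

Lemma compact_lone_quot X Y (V : X -> Y) : bounded_op V ->
  compact_op (V \o lone_quot X) -> compact_op V.
Proof.
move=> Vb /compact_opP[_ Vt]; apply/compact_opP; split=> //.
apply: totally_boundedS Vt => _ [x /unit_ballE x1 <-].
have [l [lE lx]] := lone_quot_lift x.
by exists l; [apply/unit_ballE; exact: le_trans lx x1|rewrite /= lE].
Qed.

(** Vectors of the unit ball of the quotient lift with norm at most 2, whence the dilation by 2. *)
Lemma compact_quot_map X Y (L : closed_subspace X) (U : quot_banach L -> Y) :
  bounded_op U -> compact_op (U \o quot_map L) -> compact_op U.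
Proof.
move=> Ub /compact_opP[_ Ut]; apply/compact_opP; split=> //.
have two0 : 0 <= 2 :> R by [].
apply: (@totally_boundedS _ _ _ _
  ((fun y => (ofreal 2 : K) *: y) @` ((U \o quot_map L) @` unit_ball X))).
  move=> _ [q /unit_ballE q1 <-].
  have [x qE xq] := quot_map_lift q ltr01.
  exists ((U \o quot_map L) ((ofreal 2^-1 : K) *: x)).
    apply: imageP; apply/unit_ballE; rewrite rnormZr ?invr_ge0//.
    by rewrite ler_pdivrMl// mulr1; apply: (le_trans xq); lra.
  rewrite /= (linZ _ _ (@quot_map_linear _ _ _ L)) (linZ _ _ (bounded_linear Ub)).
  by rewrite qE scalerA -ofrealM mulfV ?pnatr_eq0// ofreal1 scale1r.
apply: (totally_bounded_image (M := 2)) Ut => x y.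
by rewrite -scalerBr rnormZr.
Qed.

Section RangePreimage.
Variables (W Y V : banach R s) (U : W -> V) (i : Y -> V).
Hypothesis Ub : bounded_op U.
Hypothesis il : linear i.
Hypothesis ii : forall y, rnorm (i y) = rnorm y.

Let Ul := bounded_linear Ub.
Let A := [set w | exists y, U w = i y].

Let A0 : A 0. Proof. by exists 0; rewrite !lin0. Qed.

Let AP (k : K) x y : A x -> A y -> A (k *: x + y).
Proof. by move=> [a xa] [b yb]; exists (k *: a + b); rewrite Ul il xa yb. Qed.

(** If w is a limit of points of A, then U w is a limit of values i (y n); the isometry makes y
    Cauchy, and its limit is a preimage of U w. *)
Let A_closed : closed A.
Proof.
apply: closed_approx => w wA.
have /choice[y yP] n : exists y, rnorm (U w - i y) <= opnorm U * hf ^+ n.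
  have [x [y Uxy] xw] := wA (hf ^+ n) ltac:(by rewrite exprn_gt0).
  exists y; rewrite -Uxy -linB//; apply: (le_trans (opnormP _ Ub)).
  by rewrite ler_wpM2l ?opnorm_ge0.
have [|n|l lP] := @half_cvg _ _ _ y (2 * opnorm U).
- by rewrite mulr_ge0 ?opnorm_ge0.
- rewrite -ii linB//; apply: (le_trans (rnorm_distD (U w) _ _)).
  have h1 := yP n.+1; have h2 := yP n; rewrite rnormBC in h1.
  apply: (le_trans (lerD h1 h2)).
  rewrite [leRHS](_ : _ = opnorm U * hf ^+ n + opnorm U * hf ^+ n); last by ring.
  rewrite lerD2r ler_wpM2l ?opnorm_ge0//.
  by rewrite exprS ler_piMl ?exprn_ge0// invf_le1// ler1n.
exists l; apply: (@eq_of_half _ _ _ _ _ (opnorm U + 2 * (2 * opnorm U)) 0) => n _.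
apply: (le_trans (rnorm_distD (i (y n)) _ _)).
by rewrite mulrDl; apply: lerD => //; rewrite -linB// ii.
Qed.

Definition range_preimage : closed_subspace W := ClosedSubspace A0 AP A_closed.

(** P takes its values where U lands in the range of i, and there U can be followed by the inverse
    of i. The last two equations transfer compactness and ideal membership from P and U to the new
    factors. *)
Lemma factor_range_preimage X (T : X -> Y) (P : X -> W) : bounded_op P ->
  i \o T = U \o P ->
  exists (P0 : X -> sub_banach range_preimage) (U0 : sub_banach range_preimage -> Y),
    [/\ bounded_op P0, bounded_op U0, T = U0 \o P0,
        @sub_incl _ _ _ range_preimage \o P0 = P &
        i \o U0 = U \o @sub_incl _ _ _ range_preimage].
Proof.
move=> Pb iT; have inj_i : injective i.
  move=> x y xy; apply/eqP; rewrite -subr_eq0; apply/eqP/rnorm0_eq0.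
  by rewrite -ii linB// xy subrr rnorm0.
have P0P x : P x \in csub_pred range_preimage.
  by apply/csub_predP; exists (T x); rewrite -[LHS]/((U \o P) x) -iT.
have /choice[U0 U0P] (w : sub_banach range_preimage) : exists y, U (sub_incl w) = i y.
  by have /csub_predP := sub_inclP w.
exists (fun x => SubBanach (P0P x)), U0; split=> //.
- apply: (bounded_opI (M := opnorm P)) => [k x y|x].
    by apply: val_inj => /=; rewrite (bounded_linear Pb).
  exact: (opnormP x Pb).
- apply: (bounded_opI (M := opnorm U)) => [k x y|x].
    by apply: inj_i; rewrite -U0P il -!U0P -Ul.
  by rewrite -ii -U0P; exact: (opnormP (sub_incl x) Ub).
- apply/funext => x; apply: inj_i; rewrite -[LHS]/((i \o T) x) iT /= -U0P//.
- by apply/funext => w /=; rewrite U0P.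
Qed.

End RangePreimage.

(** [P0] x is the class of P l for any lift l of x: two lifts of x have the same image under U o P =
    T o [lone_quot X], so their classes modulo ker U agree. *)
Lemma factor_quotient X Y W (T : X -> Y) (P : lone R s (unit_ball X) -> W) (U : W -> Y)
    (Ub : bounded_op U) : bounded_op P -> T \o lone_quot X = U \o P ->
  let L := ker_subspace Ub in
  exists (P0 : X -> quot_banach L) (U0 : quot_banach L -> Y),
    [/\ bounded_op P0, bounded_op U0, T = U0 \o P0,
        P0 \o lone_quot X = quot_map L \o P & U0 \o quot_map L = U].
Proof.
move=> Pb TU L; have Ul := bounded_linear Ub; have Pl := bounded_linear Pb.
have [U0 [U0b _ U0E]] := @quot_factor _ _ _ L _ U (opnorm U) Ul (opnorm_ge0 U)
  (fun x => opnormP x Ub) (fun x Lx => Lx).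
have /choice[lift liftP] := @lone_quot_lift R s X.
have liftE x : lone_quot X (lift x) = x by have [] := liftP x.
have [qb _ _] := @lone_quotP R s X; have ql := bounded_linear qb.
have wd l m : lone_quot X l = lone_quot X m -> quot_map L (P l) = quot_map L (P m).
  move=> lm; apply/quot_map_eq; rewrite /= linB//.
  by rewrite -[U (P l)]/((U \o P) l) -[U (P m)]/((U \o P) m) -TU /= lm subrr.
exists (fun x => quot_map L (P (lift x))), U0; split=> //.
- apply: (bounded_opI (M := opnorm P)) => [k x y|x].
    by rewrite -quot_map_linear -Pl; apply: wd; rewrite ql !liftE.
  apply: (le_trans (rnorm_quot_map _ _)); apply: (le_trans (opnormP _ Pb)).
  by rewrite ler_wpM2l ?opnorm_ge0//; have [] := liftP x.
- apply/funext => x /=; rewrite U0E -[RHS]/((U \o P) (lift x)) -TU /=.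
  by rewrite liftE.
- by apply/funext => l /=; apply: wd; rewrite liftE.
- by apply/funext => w /=; rewrite U0E.
Qed.

(** The points of the ball lift to W with norm at most 2, and these lifts are the columns of Q. This
    turns membership of U0 o [quot_map L] in an ideal into membership of U0 o [lone_quot]. *)
Lemma lone_quot_through_quotient W (L : closed_subspace W) :
  exists2 Q : lone R s (unit_ball (quot_banach L)) -> W,
    bounded_op Q & quot_map L \o Q = lone_quot (quot_banach L).
Proof.
have /choice[z zP] (b : unit_ball (quot_banach L)) :
    exists x, quot_map L x = \val b /\ rnorm x <= 2.
  have [x xb xle] := quot_map_lift (\val b : quot_banach L) ltr01.
  exists x; split=> //; apply: (le_trans xle).
  have /unit_ballE : unit_ball _ (\val b : quot_banach L) by exact: set_valP.
  lra.
have [Q [Qb _ Qz _]] := lone_columns (ler0n R 2) (fun b => proj2 (zP b)).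
exists Q => //; have [qb _ qE] := @lone_quotP R s (quot_banach L).
apply: lone_op_ext => // [|b].
  by apply: bounded_op_comp => //; exact: quot_map_bounded.
by rewrite qE /= Qz; have [] := zP b.
Qed.

End CompactFactors.

(** * The inclusions between the hulls and the products *)

Section Hulls.
Context {R : realType} {s : scalar_kind}.
Local Notation F := (@approximable_op R s).
Local Notation C := (@compact_op R s).
Implicit Types X Y Z : banach R s.
Variable A : operator_ideal R s.

Lemma min_com X Y (T : X -> Y) : min_ideal A T -> com_ideal A T.
Proof.
move=> [Z [V [U [[W [V0 [S [V0a AS ->]]]] Ua ->]]]].
exists Z, (S \o V0), U; split=> //; last exact: approximable_compact.
by exists W, V0, S; split=> //; exact: approximable_compact.
Qed.

(** The factorization is cut in front of the left compact factor. [P0] is in the injective hull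
    because the embedding of the subspace L into l_oo extends to Z, so that it can be applied after
    S o V0. *)
Lemma inj_hull_com_left X Y (T : X -> Y) :
  inj_hull (com_ideal A) T -> comp_op C (inj_hull A) T.
Proof.
move=> [Tb [Z [V [U [[W [V0 [S [V0c AS ->]]]] Uc iT]]]]].
have AP : ideal_mem A (S \o V0) by apply: ideal_compr => //; case: V0c.
have Ub := proj1 Uc.
have il := @linfty_inj_linear R s Y; have ii := @linfty_inj_isometry R s Y.
have [P0 [U0 [P0b U0b TE PE UE]]] :=
  factor_range_preimage Ub il ii (ideal_bounded AP) iT.
set L := range_preimage _ _ _ in P0 U0 P0b U0b TE PE UE.
exists (sub_banach L), P0, U0; split=> //; last first.
  apply: (compact_isometry U0b il ii); rewrite UE.
  by apply: compact_compr => //; exact: sub_incl_bounded.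
split=> //.
have i1 x : rnorm (linfty_inj (sub_banach L) x) <= 1 * rnorm x.
  by rewrite mul1r linfty_inj_isometry.
have [E [El EM EJ]] := @linfty_extend R s (sub_banach L) Z _ (@sub_incl _ _ _ L)
  (@sub_incl_linear R s Z L) (@rnorm_sub_incl R s Z L) _ 1 ler01
  (@linfty_inj_linear R s _) i1.
have -> : linfty_inj (sub_banach L) \o P0 = E \o (S \o V0).
  by rewrite -PE; apply/funext => x /=; rewrite EJ.
by apply: ideal_compl => //; exact: bounded_opI El EM.
Qed.

(** The cut is made after the right compact factor, with U o S as the factor from the ideal. *)
Lemma inj_hull_com_right X Y (T : X -> Y) :
  inj_hull (com_ideal A) T -> comp_op (inj_hull A) C T.
Proof.
move=> [Tb [Z [V [U [[W [V0 [S [V0c AS ->]]]] Uc iT]]]]].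
have Ub := proj1 Uc.
have AU : ideal_mem A (U \o S) by exact: ideal_compl.
have USb := ideal_bounded AU.
have il := @linfty_inj_linear R s Y; have ii := @linfty_inj_isometry R s Y.
have [P0 [U0 [P0b U0b TE PE UE]]] :=
  factor_range_preimage USb il ii (proj1 V0c) iT.
set L := range_preimage _ _ _ in P0 U0 P0b U0b TE PE UE.
exists (sub_banach L), P0, U0; split=> //.
  apply: (compact_isometry P0b (@sub_incl_linear R s W L) (@rnorm_sub_incl R s W L)).
  by rewrite PE.
split=> //; rewrite UE; apply: ideal_compr => //; exact: sub_incl_bounded.
Qed.

(** Only [linfty_inj Z] o V is known to be in A, so the compact operator into l_oo is extended from
    Z along [linfty_inj Z], and its extension is approximable. *)
Lemma inj_hull_min_left X Y (T : X -> Y) : left_accessible A ->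
  comp_op C (inj_hull A) T -> inj_hull (min_ideal A) T.
Proof.
move=> Al [Z [V [U [[Vb AV] Uc ->]]]]; split.
  by apply: bounded_op_comp => //; case: Uc.
have [E Ea EJ] := compact_linfty_extend (@linfty_inj_linear R s Z)
  (@linfty_inj_isometry R s Z) (compact_compl Uc (@linfty_inj_bounded R s Y)).
apply: left_accessible_min => //.
exists (linfty R s (dual_ball Z)), (linfty_inj Z \o V), E; split=> //.
by rewrite -[RHS]/((E \o linfty_inj Z) \o V) EJ.
Qed.

(** The extension property lets the factor from A start at l_oo; the compact V followed by
    [linfty_inj Z] then maps into l_oo and is approximable. *)
Lemma inj_hull_min_right X Y (T : X -> Y) : right_accessible A ->
  linfty_extension A -> comp_op (inj_hull A) C T -> inj_hull (min_ideal A) T.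
Proof.
move=> Ar Ae [Z [V [U [Vc [Ub AU] ->]]]]; split.
  by apply: bounded_op_comp => //; case: Vc.
have [U' [AU' UE _]] := Ae _ _ _ AU.
have [E Ea EV] := compact_linfty_extend (@linear_id _ _ _) (fun z => erefl)
  (compact_compl Vc (@linfty_inj_bounded R s Z)).
apply: right_accessible_min => //.
exists (linfty R s (dual_ball Z)), (linfty_inj Z \o V), U'; split; [|exact: AU'|].
  by rewrite -EV.
by rewrite -[RHS]/((U' \o linfty_inj Z) \o V) -UE.
Qed.

Lemma sur_hull_com_right X Y (T : X -> Y) :
  sur_hull (com_ideal A) T -> comp_op (sur_hull A) C T.
Proof.
move=> [Tb [Z [V [U [[W [V0 [S [V0c AS ->]]]] Uc Tq]]]]].
have AU : ideal_mem A (U \o S) by apply: ideal_compl => //; case: Uc.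
have USb := ideal_bounded AU.
have [P0 [U0 [P0b U0b TE PE UE]]] := factor_quotient USb (proj1 V0c) Tq.
set L := ker_subspace _ in P0 U0 P0b U0b TE PE UE.
exists (quot_banach L), P0, U0; split=> //.
  apply: (compact_lone_quot P0b); rewrite PE.
  by apply: compact_compl => //; exact: quot_map_bounded.
split=> //; have [Q Qb QE] := lone_quot_through_quotient L.
by rewrite -QE -[U0 \o _]/((U0 \o quot_map L) \o Q) UE; exact: ideal_compr.
Qed.

Lemma sur_hull_com_left X Y (T : X -> Y) :
  sur_hull (com_ideal A) T -> comp_op C (sur_hull A) T.
Proof.
move=> [Tb [Z [V [U [[W [V0 [S [V0c AS ->]]]] Uc Tq]]]]].
have AP : ideal_mem A (S \o V0) by apply: ideal_compr => //; case: V0c.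
have [P0 [U0 [P0b U0b TE PE UE]]] := factor_quotient (proj1 Uc) (ideal_bounded AP) Tq.
set L := ker_subspace _ in P0 U0 P0b U0b TE PE UE.
exists (quot_banach L), P0, U0; split=> //; last first.
  by apply: (compact_quot_map U0b); rewrite UE.
by split=> //; rewrite PE; apply: ideal_compl => //; exact: quot_map_bounded.
Qed.

(** V o [lone_quot X] lifts to an approximable W through [lone_quot Z], which is absorbed by U. *)
Lemma sur_hull_min_right X Y (T : X -> Y) : right_accessible A ->
  comp_op (sur_hull A) C T -> sur_hull (min_ideal A) T.
Proof.
move=> Ar [Z [V [U [Vc [Ub AU] ->]]]]; split.
  by apply: bounded_op_comp => //; case: Vc.
have [W Wa WE] := compact_lone_lift (compact_compr (@lone_quot_bounded R s X) Vc).
apply: right_accessible_min => //.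
exists (lone R s (unit_ball Z)), W, (U \o lone_quot Z); split=> //.
by rewrite -[RHS]/(U \o (lone_quot Z \o W)) WE.
Qed.

Lemma sur_hull_min_left X Y (T : X -> Y) : left_accessible A ->
  lone_lifting A -> comp_op C (sur_hull A) T -> sur_hull (min_ideal A) T.
Proof.
move=> Al Ae [Z [V [U [[Vb AV] Uc ->]]]]; split.
  by apply: bounded_op_comp => //; case: Uc.
have [V' [AV' VE _]] := Ae _ _ _ AV.
have [W Wa WE] := compact_lone_lift (compact_compr (@lone_quot_bounded R s Z) Uc).
apply: left_accessible_min => //.
exists (lone R s (unit_ball Z)), V', (U \o lone_quot Z); split=> //.
  by rewrite -WE; apply: approximable_compl => //; exact: lone_quot_bounded.
by rewrite -[RHS]/(U \o (lone_quot Z \o V')) VE.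
Qed.

Lemma inj_hull_sub (B D : opclass R s) : (forall X Y (T : X -> Y), B _ _ T -> D _ _ T) ->
  forall X Y (T : X -> Y), inj_hull B T -> inj_hull D T.
Proof. by move=> BD X Y T [Tb /BD]. Qed.

Lemma sur_hull_sub (B D : opclass R s) : (forall X Y (T : X -> Y), B _ _ T -> D _ _ T) ->
  forall X Y (T : X -> Y), sur_hull B T -> sur_hull D T.
Proof. by move=> BD X Y T [Tb /BD]. Qed.

(** Applied with B the hull of the compact kernel, E the product and D the hull of the minimal
    kernel, which leaves three inclusions for two equalities. *)
Lemma opclass_cycle (B D E : opclass R s) :
  (forall X Y (T : X -> Y), B _ _ T -> E _ _ T) ->
  (forall X Y (T : X -> Y), E _ _ T -> D _ _ T) ->
  (forall X Y (T : X -> Y), D _ _ T -> B _ _ T) ->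
  B = D /\ D = E.
Proof.
move=> BE ED DB; split; apply: functional_extensionality_dep => X;
  apply: functional_extensionality_dep => Y; apply/seteqP.
  by split=> T => [/BE/ED|/DB].
by split=> T => [/DB/BE|/ED].
Qed.

End Hulls.

Theorem corollary5p3 (R : realType) (s : scalar_kind) (A : operator_ideal R s) :
  (left_accessible A ->
     inj_hull (com_ideal A) = inj_hull (min_ideal A) /\
     inj_hull (min_ideal A) = comp_op (@compact_op R s) (inj_hull A)) /\
  (right_accessible A -> linfty_extension A ->
     inj_hull (com_ideal A) = inj_hull (min_ideal A) /\
     inj_hull (min_ideal A) = comp_op (inj_hull A) (@compact_op R s)) /\
  (right_accessible A ->
     sur_hull (com_ideal A) = sur_hull (min_ideal A) /\
     sur_hull (min_ideal A) = comp_op (sur_hull A) (@compact_op R s)) /\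
  (left_accessible A -> lone_lifting A ->
     sur_hull (com_ideal A) = sur_hull (min_ideal A) /\
     sur_hull (min_ideal A) = comp_op (@compact_op R s) (sur_hull A)).
Proof.
have inj_mc := inj_hull_sub (@min_com R s A).
have sur_mc := sur_hull_sub (@min_com R s A).
split; [move=> Al|split; [move=> Ar Ae|split; [move=> Ar|move=> Al Ae]]];
  apply: opclass_cycle => // X Y T.
- exact: inj_hull_com_left.
- exact: inj_hull_min_left.
- exact: inj_hull_com_right.
- exact: inj_hull_min_right.
- exact: sur_hull_com_right.
- exact: sur_hull_min_right.
- exact: sur_hull_com_left.
- exact: sur_hull_min_left.
Qed.
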